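(* $$\int_{0}^{\infty}\frac{\left|\zeta\left(\frac12+iv\right)\right|^{2}}{\cosh(\pi v)}\left(\cos\left(v\ln(2\pi)\right)\cosh\left(\frac{\pi v}{2}\right)-\sin\left(v\ln(2\pi)\right)\sinh\left(\frac{\pi v}{2}\right)\right)dv=\sqrt{\pi}\left(\sum_{j=1}^{\infty}\frac{1}{e^{j}-1}-\gamma\right).$$
   Context: $\gamma$ is the Euler–Mascheroni constant and $\zeta$ is the Riemann zeta function (analytically continued). *)

(* Defs.v *)
From HB Require Import structures.
From mathcomp Require Export all_boot all_order all_algebra.
From mathcomp Require Export complex.
From mathcomp Require Export all_classical all_reals all_analysis.

Set Implicit Arguments.
Unset Strict Implicit.
Unset Printing Implicit Defensive.

Import Order.TTheory GRing.Theory Num.Theory.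
Import numFieldNormedType.Exports.

Local Open Scope classical_set_scope.
Local Open Scope ring_scope.
Local Open Scope complex_scope.

Definition cosh (R : realType) (x : R) : R := (expR x + expR (- x)) / 2.
Definition sinh (R : realType) (x : R) : R := (expR x - expR (- x)) / 2.

Definition euler_gamma (R : realType) : R :=
  limn (fun n : nat => (\sum_(1 <= k < n.+1) k%:R^-1) - ln (n%:R : R)).

Definition cexp (R : realType) (z : R[i]) : R[i] :=
  (expR (complex.Re z) * cos (complex.Im z)) +i*
  (expR (complex.Re z) * sin (complex.Im z)).

(* The principal value n^z = exp (z ln n), used for n > 0 only. *)
Definition cpow_nat (R : realType) (n : nat) (z : R[i]) : R[i] :=
  cexp (z * (ln (n%:R : R))%:C).

(* Convergence in [R[i]] is taken in [R[i]^o], i.e. for the modulus; the order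
   on [R[i]] compares real parts of numbers with equal imaginary parts, so
   [`|z - a| < r%:C] is the open disc of radius [r]. *)
Definition analytic_on (R : realType) (D : set R[i]) (f : R[i] -> R[i]) : Prop :=
  forall a : R[i], D a ->
    exists (c : nat -> R[i]) (r : R), 0 < r /\
      forall z : R[i], `|z - a| < r%:C ->
        series (fun k : nat => c k * (z - a) ^+ k : R[i]^o) @ \oo
          --> (f z : R[i]^o).

(* [zeta] is the analytic continuation to C \ {1} of the Dirichlet series
   \sum_(n >= 1) n^(-s), Re s > 1; since C \ {1} is connected this determines
   [zeta] on C \ {1}, and its value at 1 is left arbitrary. *)
Definition is_riemann_zeta (R : realType) (zeta : R[i] -> R[i]) : Prop :=
  analytic_on [set s | s != 1] zeta /\
  forall s : R[i], 1 < complex.Re s ->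
    series (fun n : nat => cpow_nat n.+1 (- s) : R[i]^o) @ \oo
      --> (zeta s : R[i]^o).

(* [complex.ComplexField.Normc.normc] is the modulus as an element of [R]. *)
Definition zeta_integrand (R : realType) (zeta : R[i] -> R[i]) (v : R) : R :=
  ComplexField.Normc.normc (zeta (2^-1 +i* v)) ^+ 2 / cosh (pi * v) *
  (cos (v * ln (2 * pi)) * cosh (pi * v / 2) -
   sin (v * ln (2 * pi)) * sinh (pi * v / 2)).

(* Main.v *)
Require Import Defs.
From mathcomp Require Import all_boot all_order all_algebra.
From mathcomp Require Import complex.
From mathcomp Require Import all_classical all_reals all_analysis.
From mathcomp Require Import measurable_realfun lebesgue_integral_under.
From mathcomp Require Import ring lra.

Import Order.TTheory GRing.Theory Num.Theory.
Import numFieldNormedType.Exports.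

Local Open Scope classical_set_scope.
Local Open Scope ring_scope.

Set Implicit Arguments.
Unset Strict Implicit.
Unset Printing Implicit Defensive.

(** Let {x} be the fractional part of x. For 0 < Re s < 1 the zeta function is
    zeta(s) = - s \int_0^oo {x} x^(-s-1) dx, so that on the critical line
      |zeta(1/2 + iv)|^2 = (1/4 + v^2) (C(v)^2 + S(v)^2),
    where C(v) and S(v) are the integrals of Psi(x) = {x} x^(-3/2) against
    cos(v ln x) and sin(v ln x) ([zeta_critical_line]). The other factor of the
    integrand is a kernel K(tau, v) at tau = ln(2 pi) which is, up to a constant,
    cos(tau v) A(v) - sin(tau v) B(v) for the cosine and sine transforms A and B of
    the two parts of 1 / (2 cosh((t + i pi/2) / 2)). Hence Fourier inversion gives the
    integral of K(tau, v) over v > 0 in closed form ([int_kerK]), and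
    differentiating twice in tau the integral of (1/4 + v^2) K(tau, v)
    ([int_weighted_kerK]).

    Expanding C^2 + S^2 as a double integral and integrating over v first
    ([Psi_fubini]) leaves, up to the factor sqrt(pi), the integral over x, y > 0 of
    {x} {y} times the mixed second derivative of 2 y / (y^2 + (2 pi x)^2). Both
    remaining integrals are remainders in Euler's comparison of a sum with an integral
    ([euler_summation]). In x the sum of 2 y / (y^2 + (2 pi k)^2) is known from the
    partial fractions of coth ([coth_partial_fractions]), and the result is the
    derivative of 1 / (e^y - 1) - 1 / y ([bose_fract], [bose_slopeE]). In y the sum
    of 1 / (e^k - 1) - 1 / k over k <= N minus
    ln ((1 - e^(-N)) / N) tends to the sum of the 1 / (e^k - 1) minus Euler's
    constant ([sum_bose]).

    The formula for zeta holds for Re s > 1, with the integral restricted to x > 1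
    and an explicit rational term, by Euler summation of the Dirichlet series
    ([dirichlet_tail]). It extends to Re s > 0 along the line Im s = v, v != 0: both
    sides are real-analytic functions of Re s there, and [identity_theorem]
    applies ([zeta_tail]). At Re s = 1/2 the rational term is the missing integral over
    0 < x <= 1 ([full_integrals]). *)

(** * Derivatives, measurability and integrals of real functions *)

(** The rules below are stated for explicit functions of a bound variable, with the
    value of the derivative free, so that they can be chained by unification. *)
Lemma der_eq (R : realType) (f : R -> R) (x a b : R) : is_derive x 1 f a ->
  a = b -> is_derive x 1 f b.
Proof. by move=> ? <-. Qed.

Lemma der_add (R : realType) (f g : R -> R) (x a b : R) : is_derive x 1 f a ->
  is_derive x 1 g b -> is_derive x 1 (fun t => f t + g t) (a + b).
Proof. by move=> ? ?; exact: is_deriveD. Qed.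

Lemma der_opp (R : realType) (f : R -> R) (x a : R) : is_derive x 1 f a ->
  is_derive x 1 (fun t => - f t) (- a).
Proof. by move=> ?; exact: is_deriveN. Qed.

Lemma der_mul (R : realType) (f g : R -> R) (x a b : R) : is_derive x 1 f a ->
  is_derive x 1 g b -> is_derive x 1 (fun t => f t * g t) (a * g x + f x * b).
Proof.
move=> df dg; have := @is_deriveM _ _ f g x 1 a b df dg.
by rewrite /GRing.scale /= addrC (mulrC a).
Qed.

Lemma der_pow (R : realType) (f : R -> R) n (x a : R) : is_derive x 1 f a ->
  is_derive x 1 (fun t => f t ^+ n) (n%:R * f x ^+ n.-1 * a).
Proof.
move=> d; elim: n => [|n IH].
  by rewrite mul0r mul0r; under eq_fun do rewrite expr0; exact: is_derive_cst.
under eq_fun do rewrite exprS.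
apply: der_eq (der_mul d IH) _.
by case: n {IH} => [|n] /=; rewrite ?expr0 ?exprS; ring.
Qed.

Lemma der_inv (R : realType) (f : R -> R) (x a : R) : is_derive x 1 f a -> f x != 0 ->
  is_derive x 1 (fun t => (f t)^-1) (- (a / f x ^+ 2)).
Proof.
move=> d h; have := @is_deriveV _ f x a 1 h d.
by rewrite /GRing.scale /= mulNr mulrC.
Qed.

Lemma der_comp (R : realType) (f g : R -> R) (x a b : R) : is_derive x 1 g b ->
  is_derive (g x) 1 f a -> is_derive x 1 (fun t => f (g t)) (b * a).
Proof. by move=> dg df; rewrite mulrC; exact: is_derive1_comp. Qed.

Lemma der_expR (R : realType) (f : R -> R) (x a : R) : is_derive x 1 f a ->
  is_derive x 1 (fun t => expR (f t)) (a * expR (f x)).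
Proof. by move=> d; apply: der_comp. Qed.

Lemma der_cos (R : realType) (f : R -> R) (x a : R) : is_derive x 1 f a ->
  is_derive x 1 (fun t => cos (f t)) (a * - sin (f x)).
Proof. by move=> d; apply: der_comp. Qed.

Lemma der_sin (R : realType) (f : R -> R) (x a : R) : is_derive x 1 f a ->
  is_derive x 1 (fun t => sin (f t)) (a * cos (f x)).
Proof. by move=> d; apply: der_comp. Qed.

Lemma der_atan (R : realType) (f : R -> R) (x a : R) : is_derive x 1 f a ->
  is_derive x 1 (fun t => atan (f t)) (a / (1 + f x ^+ 2)).
Proof. by move=> d; apply: der_comp. Qed.

Lemma der_ln (R : realType) (f : R -> R) (x a : R) : is_derive x 1 f a -> 0 < f x ->
  is_derive x 1 (fun t => ln (f t)) (a / f x).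
Proof. by move=> d h; apply: der_comp; exact: is_derive1_ln. Qed.

Lemma der_id (R : realType) (x : R) : is_derive x 1 (fun t : R => t) 1.
Proof. exact: is_derive_id. Qed.

Lemma der_cst (R : realType) (x c : R) : is_derive x 1 (fun=> c : R) 0.
Proof. exact: is_derive_cst. Qed.

Lemma der_cosh (R : realType) (f : R -> R) (x a : R) : is_derive x 1 f a ->
  is_derive x 1 (fun t => cosh (f t)) (a * sinh (f x)).
Proof.
move=> d; apply: (der_eq (der_mul (der_add (der_expR d) (der_expR (der_opp d))) (der_cst x 2^-1))).
by rewrite /sinh; field.
Qed.

Lemma der_sinh (R : realType) (f : R -> R) (x a : R) : is_derive x 1 f a ->
  is_derive x 1 (fun t => sinh (f t)) (a * cosh (f x)).
Proof.
move=> d; apply: (der_eq (der_mul (der_add (der_expR d) (der_opp (der_expR (der_opp d)))) (der_cst x 2^-1))).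
by rewrite /cosh; field.
Qed.

(** Computes the derivative of an expression; what remains are the conditions that
    denominators do not vanish and arguments of ln are positive. *)
Ltac der := lazymatch goal with
 | |- is_derive _ _ (fun _ => ?c) _ => eapply der_cst
 | |- is_derive _ _ (fun t => t) _ => eapply der_id
 | |- is_derive _ _ (fun t => @GRing.add _ (@?f t) (@?g t)) _ =>
     eapply (@der_add _ f g); [der|der]
 | |- is_derive _ _ (fun t => @GRing.opp _ (@?f t)) _ => eapply (@der_opp _ f); der
 | |- is_derive _ _ (fun t => @GRing.mul _ (@?f t) (@?g t)) _ =>
     eapply (@der_mul _ f g); [der|der]
 | |- is_derive _ _ (fun t => @GRing.exp _ (@?f t) ?n) _ =>
     eapply (@der_pow _ f n); der
 | |- is_derive _ _ (fun t => @GRing.inv _ (@?f t)) _ =>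
     eapply (@der_inv _ f); [der|]
 | |- is_derive _ _ (fun t => expR (@?f t)) _ => eapply (@der_expR _ f); der
 | |- is_derive _ _ (fun t => cos (@?f t)) _ => eapply (@der_cos _ f); der
 | |- is_derive _ _ (fun t => sin (@?f t)) _ => eapply (@der_sin _ f); der
 | |- is_derive _ _ (fun t => cosh (@?f t)) _ => eapply (@der_cosh _ f); der
 | |- is_derive _ _ (fun t => sinh (@?f t)) _ => eapply (@der_sinh _ f); der
 | |- is_derive _ _ (fun t => atan (@?f t)) _ => eapply (@der_atan _ f); der
 | |- is_derive _ _ (fun t => ln (@?f t)) _ => eapply (@der_ln _ f); [der|]
 | |- _ => try eassumption
 end.

Lemma is_derive_cont (R : realType) (f : R -> R) (x a : R) :
  is_derive x 1 f a -> {for x, continuous f}.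
Proof.
by move=> d; apply/differentiable_continuous/derivable1_diffP; exact: ex_derive.
Qed.

Lemma meas_comp d (T : measurableType d) (R : realType) (g : R -> R) (f : T -> R) :
  continuous g -> measurable_fun setT f -> measurable_fun setT (fun t => g (f t)).
Proof.
by move=> cg mf; apply: measurableT_comp => //; apply: continuous_measurable_fun.
Qed.

Lemma meas_inv d (T : measurableType d) (R : realType) (f : T -> R) :
  measurable_fun setT f -> measurable_fun setT (fun t => (f t)^-1).
Proof.
move=> mf; apply: (@measurableT_comp _ _ _ _ _ _ (fun x : R => x^-1) _ f) => //.
rewrite (_ : (fun x : R => x^-1) =
  (fun x : R => if x == 0 then 0 else x^-1)); last first.
  by apply/funext => x; case: eqVneq => // ->; rewrite invr0.
apply: measurable_fun_if => //.
- exact: measurable_fun_eqr.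
- have -> : [set: R] `&` (fun x : R => x == 0) @^-1` [set false] = ~` [set 0].
    apply/seteqP; split=> x /=; first by case=> _ /negbT/eqP.
    by move=> /eqP h; split => //; exact/negbTE.
  apply: open_continuous_measurable_fun => [|x].
    by apply: closed_openC; exact: closed_eq.
  rewrite inE /= => /eqP h; exact: (@inv_continuous R x h).
Qed.

Definition fract (R : realType) (x : R) : R := x - (Num.floor x)%:~R.

Lemma fract_ge0 (R : realType) (x : R) : 0 <= fract x.
Proof. by rewrite subr_ge0 floor_le. Qed.

Lemma fract_le1 (R : realType) (x : R) : fract x <= 1.
Proof. by rewrite lerBlDl ltW// (lt_le_trans (floorD1_gt x))// intrD. Qed.

Lemma fract_int (R : realType) (n : nat) (x : R) :
  n%:R <= x < n.+1%:R -> fract x = x - n%:R.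
Proof.
move=> h; rewrite /fract (_ : Num.floor x = n) ?pmulrn//.
apply: floor_def; have -> : (n%:Z + 1)%:~R = n.+1%:R :> R.
  by rewrite intrD -pmulrn -addn1 natrD.
by rewrite -pmulrn.
Qed.

Lemma meas_fract d (T : measurableType d) (R : realType) (f : T -> R) :
  measurable_fun setT f -> measurable_fun setT (fun t => fract (f t)).
Proof.
move=> mf; apply: measurable_funB => //.
apply: (@measurableT_comp _ _ _ _ _ _ (fun x : R => (Num.floor x)%:~R : R)) => //.
by apply: nondecreasing_measurable => // x y xy; rewrite ler_int le_floor.
Qed.

Lemma meas_abs d (T : measurableType d) (R : realType) (f : T -> R) :
  measurable_fun setT f -> measurable_fun setT (fun t => `|f t|).
Proof. by move=> mf; apply: measurableT_comp. Qed.

Lemma meas_opp d (T : measurableType d) (R : realType) (f : T -> R) :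
  measurable_fun setT f -> measurable_fun setT (fun t => - f t).
Proof. exact: measurable_funN. Qed.

Lemma meas_ln d (T : measurableType d) (R : realType) (f : T -> R) :
  measurable_fun setT f -> measurable_fun setT (fun t => ln (f t)).
Proof. by move=> mf; apply: measurableT_comp => //; exact: measurable_ln. Qed.

Lemma meas_fst d d1 d2 (T : measurableType d) (T1 : measurableType d1)
    (T2 : measurableType d2) (f : T -> T1 * T2) :
  measurable_fun setT f -> measurable_fun setT (fun t => (f t).1).
Proof. by move=> mf; exact: measurableT_comp (@measurable_fst _ _ _ _) mf. Qed.

Lemma meas_snd d d1 d2 (T : measurableType d) (T1 : measurableType d1)
    (T2 : measurableType d2) (f : T -> T1 * T2) :
  measurable_fun setT f -> measurable_fun setT (fun t => (f t).2).
Proof. by move=> mf; exact: measurableT_comp (@measurable_snd _ _ _ _) mf. Qed.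

Lemma meas_cosh d (T : measurableType d) (R : realType) (f : T -> R) :
  measurable_fun setT f -> measurable_fun setT (fun t => cosh (f t)).
Proof.
by apply: meas_comp => x; apply: is_derive_cont (der_cosh (der_id x)).
Qed.

Lemma meas_sinh d (T : measurableType d) (R : realType) (f : T -> R) :
  measurable_fun setT f -> measurable_fun setT (fun t => sinh (f t)).
Proof.
by apply: meas_comp => x; apply: is_derive_cont (der_sinh (der_id x)).
Qed.

Ltac mf := lazymatch goal with
 | |- measurable_fun _ (fun _ => ?c) => exact: measurable_cst
 | |- measurable_fun _ (fun t => t) => exact: measurable_id
 | |- measurable_fun _ (fun t => fst (@?f t)) =>
     apply: (@meas_fst _ _ _ _ _ _ f); mf
 | |- measurable_fun _ (fun t => snd (@?f t)) =>
     apply: (@meas_snd _ _ _ _ _ _ f); mf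
 | |- measurable_fun _ (fun t => @GRing.add _ (@?f t) (@?g t)) =>
     apply: (@measurable_funD _ _ _ _ f g); [mf|mf]
 | |- measurable_fun _ (fun t => @GRing.opp _ (@?f t)) =>
     apply: (@meas_opp _ _ _ f); mf
 | |- measurable_fun _ (fun t => @GRing.mul _ (@?f t) (@?g t)) =>
     apply: (@measurable_funM _ _ _ _ f g); [mf|mf]
 | |- measurable_fun _ (fun t => @GRing.exp _ (@?f t) ?n) =>
     apply: (@measurable_funX _ _ _ _ f n); mf
 | |- measurable_fun _ (fun t => @GRing.inv _ (@?f t)) => apply: (@meas_inv _ _ _ f); mf
 | |- measurable_fun _ (fun t => expR (@?f t)) =>
     apply: (@meas_comp _ _ _ _ f (@continuous_expR _)); mf
 | |- measurable_fun _ (fun t => cos (@?f t)) =>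
     apply: (@meas_comp _ _ _ _ f (@continuous_cos _)); mf
 | |- measurable_fun _ (fun t => sin (@?f t)) =>
     apply: (@meas_comp _ _ _ _ f (@continuous_sin _)); mf
 | |- measurable_fun _ (fun t => cosh (@?f t)) => apply: (@meas_cosh _ _ _ f); mf
 | |- measurable_fun _ (fun t => sinh (@?f t)) => apply: (@meas_sinh _ _ _ f); mf
 | |- measurable_fun _ (fun t => ln (@?f t)) =>
     apply: (@meas_ln _ _ _ f); mf
 | |- measurable_fun _ (fun t => fract (@?f t)) => apply: (@meas_fract _ _ _ f); mf
 | |- measurable_fun _ (fun t => Num.norm (@?f t)) => apply: (@meas_abs _ _ _ f); mf
 | |- _ => try eassumption
 end.

Section real_integrals.
Context d (T : measurableType d) (R : realType) (mu : {measure set T -> \bar R}).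
Implicit Types (D : set T) (f g : T -> R).

Lemma le_integrableR D f g : measurable D -> measurable_fun D f ->
  mu.-integrable D (EFin \o g) -> (forall x, D x -> `|f x| <= g x) ->
  mu.-integrable D (EFin \o f).
Proof.
move=> mD mf ig fg; apply: (le_integrable mD _ _ ig).
  exact/measurable_EFinP.
by move=> x Dx /=; rewrite lee_fin (le_trans (fg _ Dx))// ler_norm.
Qed.

Lemma eq_integrableR D f g : measurable D -> (forall x, D x -> f x = g x) ->
  mu.-integrable D (EFin \o f) -> mu.-integrable D (EFin \o g).
Proof.
move=> mD fg; apply: eq_integrable => // x; rewrite inE => Dx /=.
by rewrite fg.
Qed.

Lemma integrableDR D f g : measurable D -> mu.-integrable D (EFin \o f) ->
  mu.-integrable D (EFin \o g) -> mu.-integrable D (EFin \o (fun x => f x + g x)).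
Proof.
move=> mD fi gi; rewrite (_ : _ \o _ = (EFin \o f) \+ (EFin \o g))%E //.
exact: integrableD.
Qed.

Lemma integrableZR D f k : measurable D -> mu.-integrable D (EFin \o f) ->
  mu.-integrable D (EFin \o (fun x => k * f x)).
Proof. by move=> mD fi; exact: (@integrableZl _ _ _ mu D mD k _ fi). Qed.

Lemma integrableNR D f : measurable D -> mu.-integrable D (EFin \o f) ->
  mu.-integrable D (EFin \o (fun x => - f x)).
Proof. by move=> mD fi; exact: (@integrableN _ _ _ mu D _ fi). Qed.

Lemma eq_RintegralR D f g : (forall x, D x -> f x = g x) ->
  \int[mu]_(x in D) f x = \int[mu]_(x in D) g x.
Proof. by move=> fg; apply: eq_Rintegral => x; rewrite inE => /fg. Qed.

Lemma Rdominated_cvg D (f_ : nat -> T -> R) f g : measurable D ->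
  (forall n, measurable_fun D (f_ n)) ->
  (forall x, D x -> f_ ^~ x @ \oo --> f x) ->
  mu.-integrable D (EFin \o g) ->
  (forall n x, D x -> `|f_ n x| <= g x) ->
  mu.-integrable D (EFin \o f) /\
  (\int[mu]_(x in D) f_ n x) @[n --> \oo] --> \int[mu]_(x in D) f x.
Proof.
move=> mD mf cf ig fg.
have mlim : measurable_fun D f by exact: measurable_fun_cvg mf cf.
have [|||||fi _ lim] := @dominated_convergence _ _ _ mu D mD (fun n => EFin \o f_ n)
    (EFin \o f) (EFin \o g).
- by move=> n; exact/measurable_EFinP.
- exact/measurable_EFinP.
- by apply: aeW => x Dx /=; apply: cvg_EFin; [exact: nearW|exact: cf].
- exact: ig.
- by apply: aeW => x n Dx /=; rewrite lee_fin fg.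
split => //.
have in_ n : mu.-integrable D (EFin \o f_ n) by exact: le_integrableR ig (fg n).
apply/fine_cvg; rewrite fineK; last exact: integrable_fin_num.
by apply: lim.
Qed.

Lemma le_RintegralR D f g : measurable D -> mu.-integrable D (EFin \o f) ->
  mu.-integrable D (EFin \o g) -> (forall x, D x -> f x <= g x) ->
  \int[mu]_(x in D) f x <= \int[mu]_(x in D) g x.
Proof. by move=> mD fi gi fg; exact: le_Rintegral. Qed.

Lemma is_derive_under_integral D (f f' : R -> T -> R) (a u v : R) (G : T -> R) :
  measurable D -> u < a < v ->
  (forall x, u < x < v -> mu.-integrable D (EFin \o f x)) ->
  (forall x y, u < x < v -> D y -> is_derive x 1 (f ^~ y) (f' x y)) ->
  mu.-integrable D (EFin \o G) ->
  (forall x y, u < x < v -> D y -> `|f' x y| <= G y) ->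
  is_derive a 1 (fun x => \int[mu]_(y in D) f x y) (\int[mu]_(y in D) f' a y).
Proof.
move=> mD ab fi df Gi fG.
have I x : `]u, v[%classic x -> u < x < v by rewrite /= in_itv.
have Ia : `]u, v[%classic a by rewrite /= in_itv.
have dE x y : `]u, v[%classic x -> D y -> partial1of2 f x y = f' x y.
  by move=> /I xI Dy; rewrite partial1of2E; exact: (@derive_val _ _ _ _ _ _ _ (df _ _ xI Dy)).
have := @derivable_under_integral R _ T mu f D mD a u v Ia
  (fun x h => fi x (I x h)) (fun x y h Dy => @ex_derive _ _ _ _ _ _ _ (df x y (I x h) Dy))
  (fun y => `|G y|) (fun y => normr_ge0 _) (integrable_norm Gi).
have := @differentiation_under_integral R _ T mu f D mD a u v Ia
  (fun x h => fi x (I x h)) (fun x y h Dy => @ex_derive _ _ _ _ _ _ _ (df x y (I x h) Dy))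
  (fun y => `|G y|) (fun y => normr_ge0 _) (integrable_norm Gi).
have fG' x y : `]u, v[%classic x -> D y -> `|partial1of2 f x y| <= `|G y|.
  by move=> xI Dy; rewrite dE// (le_trans _ (ler_norm _))// fG//; exact: I.
move=> /(_ fG') d1 /(_ fG') d2; split => //.
rewrite -derive1E d1; apply: eq_Rintegral => y; rewrite inE => Dy.
exact: dE.
Qed.

End real_integrals.

Section fubini_real.
Local Open Scope ereal_scope.
Context d1 d2 (T1 : measurableType d1) (T2 : measurableType d2) (R : realType).
Variables (m1 : {sigma_finite_measure set T1 -> \bar R})
  (m2 : {sigma_finite_measure set T2 -> \bar R}).

(** Domination by a product f(x) g(y) of integrable functions makes h integrable on
    the product and its partial integrals integrable. *)
Lemma Rfubini (A : set T1) (B : set T2) (h : T1 * T2 -> R) (f : T1 -> R)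
    (g : T2 -> R) : measurable A -> measurable B -> measurable_fun setT h ->
  m1.-integrable A (EFin \o f) -> m2.-integrable B (EFin \o g) ->
  (forall x y, A x -> B y -> `|h (x, y)| <= f x * g y)%R ->
  [/\ (m1 \x m2).-integrable (A `*` B) (EFin \o h),
    m1.-integrable A (EFin \o (fun x => \int[m2]_(y in B) h (x, y))%R),
    (\int[m1]_(x in A) \int[m2]_(y in B) h (x, y) =
     \int[(m1 \x m2)%E]_(z in A `*` B) h z)%R &
    (\int[m2]_(y in B) \int[m1]_(x in A) h (x, y) =
     \int[(m1 \x m2)%E]_(z in A `*` B) h z)%R].
Proof.
move=> mA mB mh fi gi hfg.
have mAB : measurable (A `*` B) by exact: measurableX.
pose k : T1 * T2 -> R := (h \_ (A `*` B))%R.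
have mk : measurable_fun setT (EFin \o k).
  apply/measurable_EFinP; apply/(measurable_restrictT _ mAB).
  exact: measurable_funTS.
have fin_g := integrable_norm gi; have fin_f := integrable_norm fi.
have kE x y : k (x, y) = (if (x \in A) && (y \in B) then h (x, y) else 0)%R.
  by rewrite /k patchE in_setX /=.
have kfg x y : (`|k (x, y)| <= (Num.norm \o f) \_ A x * (Num.norm \o g) \_ B y)%R.
  rewrite kE !patchE; case: ifPn => [/andP[xA yB]|_].
    rewrite xA yB /=; rewrite !inE in xA yB.
    by rewrite (le_trans (hfg _ _ xA yB))// (le_trans (ler_norm _))// normrM.
  rewrite normr0 (_ : point = 0%R :> R)//.
  by case: (x \in A); case: (y \in B); rewrite /= ?mul0r ?mulr0// mulr_ge0.
have fA : m1.-integrable setT (EFin \o ((Num.norm \o f) \_ A)%R).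
  by rewrite -restrict_EFin; apply/(integrable_mkcond _ mA).
have gB : m2.-integrable setT (EFin \o ((Num.norm \o g) \_ B)%R).
  by rewrite -restrict_EFin; apply/(integrable_mkcond _ mB).
have ik : (m1 \x m2).-integrable setT (EFin \o k).
  apply/integrable12ltyP => //.
  have gfin : \int[m2]_y `|((Num.norm \o g) \_ B y)%:E| < +oo.
    by case/integrableP : gB.
  have ffin : \int[m1]_x `|((Num.norm \o f) \_ A x)%:E| < +oo.
    by case/integrableP : fA.
  apply: (@le_lt_trans _ _ (\int[m1]_x (`|((Num.norm \o f) \_ A x)%:E| *
      \int[m2]_y `|((Num.norm \o g) \_ B y)%:E|))).
    apply: ge0_le_integral => //.
    - by move=> x _; exact: integral_ge0.
    - apply: (measurable_fun_fubini_tonelli_F (abse \o (EFin \o k))) => [|z].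
        exact: measurableT_comp.
      exact: abse_ge0.
    - by apply: emeasurable_funM => //; apply: measurableT_comp => //;
        case/integrableP : fA.
    - move=> x _; rewrite -ge0_integralZl//; last first.
        by apply: measurableT_comp => //; case/integrableP : gB.
      apply: ge0_le_integral => //.
      + by apply: measurableT_comp => //; apply: measurableT_comp => //;
          exact: pair1_measurable.
      + apply: emeasurable_funM => //; apply: measurableT_comp => //.
        by case/integrableP : gB.
      + move=> y _ /=; rewrite lee_fin (le_trans (kfg x y))//.
        by rewrite -normrM ler_norm.
  rewrite ge0_integralZr//; last 2 first.
    - by apply: measurableT_comp => //; case/integrableP : fA.
    - exact: integral_ge0.
  rewrite lte_mul_pinfty//; first exact: integral_ge0.
  by rewrite ge0_fin_numE//; exact: integral_ge0.
have kAB (z : T1 * T2) : ((EFin \o h) \_ (A `*` B)) z = (k z)%:E.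
  by rewrite restrict_EFin.
have E1 x : (\int[m2]_y (k (x, y))%:E =
    ((fun x => \int[m2]_(y in B) (h (x, y))%:E) \_ A) x).
  rewrite patchE; case: ifPn => xA.
    rewrite [RHS]integral_mkcond; apply: eq_integral => y _.
    by rewrite kE xA /= patchE; case: ifPn.
  rewrite (eq_integral (cst 0)) ?integral0// => y _.
  by rewrite kE (negbTE xA).
have E2 y : (\int[m1]_x (k (x, y))%:E =
    ((fun y => \int[m1]_(x in A) (h (x, y))%:E) \_ B) y).
  rewrite patchE; case: ifPn => yB.
    rewrite [RHS]integral_mkcond; apply: eq_integral => x _.
    by rewrite kE yB andbT /= patchE; case: ifPn.
  rewrite (eq_integral (cst 0)) ?integral0// => x _.
  by rewrite kE (negbTE yB) andbF.
have hB x : A x -> m2.-integrable B (EFin \o (fun y => h (x, y))).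
  move=> Ax; apply: (@le_integrableR _ _ _ _ _ _ (fun y => f x * g y)%R) => //.
  - by apply: measurable_funTS; apply: measurableT_comp => //; exact: pair1_measurable.
  - exact: integrableZR.
  - by move=> y; exact: hfg.
have hA y : B y -> m1.-integrable A (EFin \o (fun x => h (x, y))).
  move=> By; apply: (@le_integrableR _ _ _ _ _ _ (fun x => g y * f x)%R) => //.
  - by apply: measurable_funTS; apply: measurableT_comp => //; exact: pair2_measurable.
  - exact: integrableZR.
  - by move=> x Ax; rewrite mulrC; exact: hfg.
have F1 x : A x -> (\int[m2]_(y in B) h (x, y))%R%:E = \int[m2]_(y in B) (h (x, y))%:E.
  by move=> Ax; rewrite /Rintegral fineK//; apply: integrable_fin_num => //; exact: hB.
have F2 y : B y -> (\int[m1]_(x in A) h (x, y))%R%:E = \int[m1]_(x in A) (h (x, y))%:E.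
  by move=> By; rewrite /Rintegral fineK//; apply: integrable_fin_num => //; exact: hA.
have G0 : \int[m1 \x m2]_(z in A `*` B) (h z)%:E = \int[m1 \x m2]_z (k z)%:E.
  by rewrite integral_mkcond; apply: eq_integral => z _; rewrite kAB.
split.
- by apply/(integrable_mkcond _ mAB); rewrite restrict_EFin.
- have := integrable_fubini_F ik.
  rewrite (_ : fubini_F m2 _ = (EFin \o (fun x => \int[m2]_(y in B) h (x, y))%R) \_ A).
    by move/(integrable_mkcond _ mA).
  apply/funext => x; rewrite /fubini_F /= E1 !patchE; case: ifPn => //.
  by rewrite inE => Ax; rewrite /= F1.
- rewrite [LHS]/Rintegral [RHS]/Rintegral; congr fine.
  rewrite G0 -(integral12_prod_meas1 ik) [LHS]integral_mkcond.
  apply: eq_integral => x _; rewrite /fubini_F /= E1 !patchE; case: ifPn => //.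
  by rewrite inE => Ax; rewrite /= F1.
- rewrite [LHS]/Rintegral [RHS]/Rintegral; congr fine.
  rewrite G0 -(integral21_prod_meas1 ik) [LHS]integral_mkcond.
  apply: eq_integral => y _; rewrite /fubini_G /= E2 !patchE; case: ifPn => //.
  by rewrite inE => By; rewrite /= F2.
Qed.

End fubini_real.

(** * The fundamental theorem of calculus on non-compact intervals *)

Section ftc_exhaustion.
Variable R : realType.
Notation mu := (@lebesgue_measure R).

Lemma FTC_itvcc (f F : R -> R) (a b : R) : a < b ->
  (forall x, a <= x <= b -> is_derive x 1 F (f x)) ->
  (forall x, a <= x <= b -> {for x, continuous f}) ->
  \int[mu]_(x in `[a, b]) f x = F b - F a.
Proof.
move=> ab dF cf.
have cF x : a <= x <= b -> {for x, continuous F}.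
  by move=> /dF; exact: is_derive_cont.
have cfw : {within `[a, b], continuous f}.
  apply: continuous_in_subspaceT => x; rewrite inE /= in_itv /=; exact: cf.
rewrite /Rintegral (@continuous_FTC2 _ f F)//.
- split.
  + move=> x; rewrite in_itv /= => /andP[/ltW ax /ltW xb].
    by apply: ex_derive; apply: dF; rewrite ax.
  + by apply: cvg_at_right_filter; apply: cF; rewrite lexx ltW.
  + by apply: cvg_at_left_filter; apply: cF; rewrite lexx ltW.
- move=> x; rewrite in_itv /= => /andP[/ltW ax /ltW xb].
  by rewrite derive1E; apply: derive_val; apply: dF; rewrite ax.
Qed.

Variables (D : set R) (f F : R -> R) (a b : nat -> R).
Hypothesis mD : measurable D.
Hypothesis mf : measurable_fun D f.
Hypothesis ab : forall n, a n < b n.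
Hypothesis sub : forall n, `[a n, b n] `<=` D.
Hypothesis dF : forall x, D x -> is_derive x 1 F (f x).
Hypothesis cf : forall x, D x -> {for x, continuous f}.
Hypothesis exh : forall x, D x -> \forall n \near \oo, a n <= x <= b n.

Let FTC_n n : \int[mu]_(x in D) (f \_ `[a n, b n]) x = F (b n) - F (a n).
Proof.
rewrite -Rintegral_mkcondr setIidr//; apply: FTC_itvcc => // x xab.
  by apply: dF; apply: (@sub n); rewrite /= in_itv.
by apply: cf; apply: (@sub n); rewrite /= in_itv.
Qed.

Let mfn n : measurable_fun D (f \_ `[a n, b n]).
Proof. by apply/measurable_restrict => //; exact: measurable_funS mf. Qed.

Let cfn x : D x -> (f \_ `[a n, b n]) x @[n --> \oo] --> f x.
Proof.
move=> Dx; apply: cvg_near_cst; near=> n.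
rewrite patchE ifT// inE /= in_itv /=; near: n; exact: exh.
Unshelve. all: by end_near. Qed.

(** On the intervals [a n, b n] this is the fundamental theorem for continuous functions;
    dominated convergence with bound |f| gives the integral over D. *)
Lemma FTC_exhaust (l : R) : mu.-integrable D (EFin \o f) ->
  F (b n) - F (a n) @[n --> \oo] --> l -> \int[mu]_(x in D) f x = l.
Proof.
move=> fi Fl.
have [|_ lim] := @Rdominated_cvg _ _ _ mu D (fun n => f \_ `[a n, b n]) f (fun x => `|f x|) mD
   mfn cfn (integrable_norm fi).
  by move=> n x Dx; rewrite patchE; case: ifPn => // _; rewrite normr0.
move: lim; rewrite (eq_cvg _ _ FTC_n) => lim.
exact: cvg_unique lim Fl.
Qed.

(** For f >= 0 Fatou's lemma bounds the integral of f by the limit of the increments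
    of its primitive. *)
Lemma integrable_exhaust (l : R) : (forall x, D x -> 0 <= f x) ->
  F (b n) - F (a n) @[n --> \oo] --> l -> mu.-integrable D (EFin \o f).
Proof.
move=> f0 Fl; apply/integrableP; split; first exact/measurable_EFinP.
have fn0 n x : D x -> (0 <= ((f \_ `[a n, b n]) x)%:E)%E.
  by move=> Dx; rewrite lee_fin patchE; case: ifPn => // _; exact: f0.
have mfnE n : measurable_fun D (EFin \o (f \_ `[a n, b n])).
  exact/measurable_EFinP.
have := @fatou _ _ _ mu D mD (fun n => EFin \o (f \_ `[a n, b n])) mfnE fn0.
rewrite (_ : (\int[mu]_(x in D) _ = \int[mu]_(x in D) `|(EFin \o f) x|)%E); last first.
  apply: eq_integral => x; rewrite inE => Dx /=.
  rewrite ger0_norm ?f0//.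
  have cx : (EFin \o (fun n => (f \_ `[a n, b n]) x)) @ \oo --> (f x)%:E.
    by apply: cvg_EFin; [exact: nearW|exact: cfn].
  have [<- _] := cvg_limn_einf_sup cx; by [].
move=> /le_lt_trans; apply.
rewrite (_ : (fun n => _) = (fun n => (F (b n) - F (a n))%:E)); last first.
  apply/funext => n; rewrite -FTC_n /Rintegral fineK//.
  apply: (@integrable_fin_num _ _ _ mu D mD (EFin \o (f \_ `[a n, b n]))).
  rewrite -restrict_EFin.
  apply/integrable_restrict => //; rewrite setIidr//.
  apply: continuous_compact_integrable; first exact: segment_compact.
  apply: continuous_in_subspaceT => x; rewrite inE => xab; apply: cf.
  exact: (@sub n).
have cx : (fun n => (F (b n) - F (a n))%:E) @ \oo --> l%:E.
  by apply: cvg_EFin => //; exact: nearW.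
by have [-> _] := cvg_limn_einf_sup cx; rewrite ltry.
Qed.

End ftc_exhaustion.

Lemma cvg_at_right_seq (R : realType) (F : R -> R) (a l : R) :
  F x @[x --> a^'+] --> l -> F (a + n.+1%:R^-1) @[n --> \oo] --> l.
Proof.
move=> Fa; apply: cvg_comp Fa => A [e /= e0 eA].
have : (n.+1%:R^-1 : R) @[n --> \oo] --> (0 : R) by exact: cvg_harmonic.
move/cvgrPdist_lt => /(_ _ e0) [N _ NA].
exists N => // n Nn /=; apply: eA => /=; last by rewrite ltrDl invr_gt0.
by have := NA n Nn; rewrite /= opprD addrA subrr !sub0r.
Qed.

Lemma cvg_at_pinfty_seq (R : realType) (F : R -> R) (a l : R) :
  F x @[x --> +oo] --> l -> F (a + n.+1%:R) @[n --> \oo] --> l.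
Proof.
move=> Fa; apply: cvg_comp Fa.
apply: (@cvg_comp _ _ _ (fun n => n.+1%:R) (+%R a) _ _ _ _ (cvg_addrl a)).
apply/cvgryPge => A; near=> n.
rewrite (@le_trans _ _ n%:R)// ?ler_nat//.
near: n; exact: nbhs_infty_ger.
Unshelve. all: by end_near. Qed.

Section ftc_halfline.
Variables (R : realType) (f F : R -> R) (a la lb : R).
Notation mu := (@lebesgue_measure R).
Hypothesis dF : forall x, a < x -> is_derive x 1 F (f x).
Hypothesis cf : forall x, a < x -> {for x, continuous f}.
Hypothesis mf : measurable_fun setT f.
Hypothesis Fa : F x @[x --> a^'+] --> la.
Hypothesis Fb : F x @[x --> +oo] --> lb.

Let I x : `]a, +oo[%classic x <-> a < x.
Proof. by rewrite /= in_itv /= andbT. Qed.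

Let ab n : a + n.+1%:R^-1 < a + 1 + n.+1%:R :> R.
Proof.
rewrite -addrA ltrD2l (@le_lt_trans _ _ 1)// ?ltrDl// invf_le1// ler1n//.
Qed.

Let sub n : `[a + n.+1%:R^-1, a + 1 + n.+1%:R] `<=` `]a, +oo[.
Proof.
move=> x; rewrite /= !in_itv /= andbT => /andP[h _].
by rewrite (lt_le_trans _ h)// ltrDl invr_gt0.
Qed.

Let exh x : `]a, +oo[%classic x ->
  \forall n \near \oo, a + n.+1%:R^-1 <= x <= a + 1 + n.+1%:R.
Proof.
move=> /I ax; near=> n; apply/andP; split.
  rewrite -lerBrDl; near: n.
  have : (n.+1%:R^-1 : R) @[n --> \oo] --> (0 : R) by exact: cvg_harmonic.
  move/cvgr_le; apply; by rewrite subr_gt0.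
rewrite -lerBlDl (@le_trans _ _ n%:R)// ?ler_nat//.
near: n; exact: nbhs_infty_ger.
Unshelve. all: by end_near. Qed.

Let lim : F (a + 1 + n.+1%:R) - F (a + n.+1%:R^-1) @[n --> \oo] --> lb - la.
Proof.
by apply: cvgB; [exact: cvg_at_pinfty_seq|exact: cvg_at_right_seq].
Qed.

Lemma FTC_oy : mu.-integrable `]a, +oo[ (EFin \o f) ->
  \int[mu]_(x in `]a, +oo[) f x = lb - la.
Proof.
move=> fi; apply: (@FTC_exhaust R _ f F) lim => //.
- exact: measurable_funTS.
- by move=> x /I; exact: dF.
- by move=> x /I; exact: cf.
Qed.

Lemma integrable_oy : (forall x, a < x -> 0 <= f x) ->
  mu.-integrable `]a, +oo[ (EFin \o f).
Proof.
move=> f0; apply: (@integrable_exhaust R _ f F) lim => //.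
- exact: measurable_funTS.
- by move=> x /I; exact: dF.
- by move=> x /I; exact: cf.
- by move=> x /I; exact: f0.
Qed.

End ftc_halfline.

(** Stated over the measurable type that [lebesgue_measure] lives on. *)
Lemma measurable_pos (R : realType) :
  measurable (`]0, +oo[ : set (measurableTypeR R)).
Proof. exact: measurable_itv. Qed.
Arguments measurable_pos : clear implicits.

(** * Hyperbolic functions *)

Lemma cosh2 (R : realType) (x : R) : cosh x ^+ 2 = 1 + sinh x ^+ 2.
Proof.
have e0 := expR_gt0 x.
rewrite /cosh /sinh expRN; field; lra.
Qed.

Lemma cosh_ge_exp (R : realType) (x : R) : expR x / 2 <= cosh x.
Proof. by rewrite /cosh ler_pM2r ?lerDl ?expR_ge0// invr_gt0. Qed.

Lemma cosh_gt0 (R : realType) (x : R) : 0 < cosh x.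
Proof. by rewrite (lt_le_trans _ (cosh_ge_exp x))// divr_gt0// expR_gt0. Qed.

Lemma norm_sinh_le (R : realType) (x : R) : `|sinh x| <= cosh x.
Proof.
rewrite ler_norml /cosh /sinh.
by have := expR_gt0 x; have := expR_gt0 (- x) => h1 h2; apply/andP; split; lra.
Qed.

Lemma sinh0 (R : realType) : sinh (0 : R) = 0.
Proof. by rewrite /sinh oppr0 subrr mul0r. Qed.

Lemma coshV_le (R : realType) (x : R) : (cosh x)^-1 <= 2 * expR (- x).
Proof.
rewrite expRN -[2]invrK -invfM lef_pV2 ?posrE ?cosh_gt0 ?mulr_gt0 ?expR_gt0 ?invr_gt0//.
by rewrite mulrC cosh_ge_exp.
Qed.

Lemma le_of_eq (R : realType) (x y : R) : x = y -> x <= y.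
Proof. by move=> ->. Qed.

Lemma cvg_right_derive (R : realType) (f : R -> R) (a b l : R) :
  is_derive a 1 f b -> f a = l -> f x @[x --> a^'+] --> l.
Proof. by move=> /is_derive_cont cf <-; exact: cvg_at_right_filter. Qed.

Lemma cvg_expNy (R : realType) (k : R) : 0 < k ->
  expR (- (k * t)) @[t --> +oo] --> 0.
Proof.
move=> k0; apply: (@cvg_comp _ _ _ (fun t : R => k * t) (fun t => expR (- t)) _ +oo).
  by apply: gt0_cvgMry.
exact: cvgr_expR.
Qed.

Lemma integrable_expN (R : realType) (c k : R) : 0 < k ->
  (@lebesgue_measure R).-integrable `]0, +oo[ (EFin \o (fun t => c * expR (- (k * t)))).
Proof.
move=> k0; apply: integrableZR => //.
apply: (@integrable_oy R _ (fun t => - k^-1 * expR (- (k * t))) 0 (- k^-1) 0).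
- by move=> t _; eapply der_eq; [der|field; rewrite gt_eqF].
- by move=> t _; eapply is_derive_cont; der.
- by mf.
- by eapply cvg_right_derive; [der|rewrite mulr0 oppr0 expR0 mulr1].
- rewrite -[X in _ --> X](mulr0 (- k^-1)); apply: cvgMr; exact: cvg_expNy.
- by move=> t _; exact: expR_ge0.
Qed.

Lemma ler_norm_div (R : realType) (x y b : R) :
  0 < y -> `|x| <= b * y -> `|x / y| <= b.
Proof. by move=> y0 h; rewrite normf_div (gtr0_norm y0) ler_pdivrMr. Qed.

Lemma ler_normM (R : realType) (x y a b : R) :
  `|x| <= a -> `|y| <= b -> `|x * y| <= a * b.
Proof. by move=> xa yb; rewrite normrM ler_pM. Qed.

(** The estimates for [stripP], [stripQ] and their derivatives, with S, C, c, s standing for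
    sinh(t/2), cosh(t/2), cos(th/2), sin(th/2). All decay like 1/C, uniformly where
    C^2 / N <= k. *)
Lemma strip_bounds (R : realType) (S C c s k N : R) : 1 <= C -> 0 < N ->
  `|S| <= C -> `|c| <= 1 -> `|s| <= 1 -> C ^+ 2 <= k * N -> 0 <= k ->
  S ^+ 2 + c ^+ 2 = N ->
  [/\ `|C * c / (2 * N)| <= k / C / 2,
      `|S * s / (2 * N)| <= k / C / 2,
      `|C * s * (c ^+ 2 - S ^+ 2) / (4 * N ^+ 2)| <= k / C / 4 &
      `|S * c * (N / 2 + s ^+ 2) / (2 * N ^+ 2)| <= (k / 4 + k ^+ 2 / 2) / C].
Proof.
move=> C1 N0 SC c1 s1 CN k0 NE.
have C0 : 0 < C by lra.
have nz : (C != 0) && (N != 0) by rewrite !gt_eqF.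
have /andP[Cn Nn] := nz.
have nC : `|C| <= C by rewrite ger0_norm// ltW.
have CkN : C <= k * N / C by rewrite ler_pdivlMr// -expr2.
have N2 : 0 < N ^+ 2 by rewrite exprn_gt0.
split; apply: ler_norm_div; rewrite ?mulr_gt0//.
- have := ler_normM nC c1; rewrite mulr1 => /le_trans; apply.
  by rewrite (le_trans CkN)//; apply: le_of_eq; field; rewrite Cn.
- have := ler_normM SC s1; rewrite mulr1 => /le_trans; apply.
  by rewrite (le_trans CkN)//; apply: le_of_eq; field; rewrite Cn.
- have h1 : `|c ^+ 2 - S ^+ 2| <= N.
    by rewrite ler_norml -NE; have := sqr_ge0 c; have := sqr_ge0 S; lra.
  have := ler_normM (ler_normM nC s1) h1 => /le_trans; apply; rewrite mulr1.
  rewrite (@le_trans _ _ (k * N / C * N))//; first by rewrite ler_pM2r.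
  by apply: le_of_eq; field; rewrite Cn.
- have h1 : `|N / 2 + s ^+ 2| <= k * N + N / 2.
    rewrite ger0_norm; last by have := sqr_ge0 s; lra.
    have : s ^+ 2 <= 1 by rewrite -real_normK ?num_real// expr_le1.
    have : 1 <= C ^+ 2 by rewrite expr_ge1//; lra.
    lra.
  have := ler_normM (ler_normM SC c1) h1 => /le_trans; apply; rewrite mulr1.
  rewrite (@le_trans _ _ (k * N / C * (k * N + N / 2)))//.
    by rewrite ler_wpM2r// addr_ge0 ?mulr_ge0 ?divr_ge0// ltW.
  by apply: le_of_eq; field; rewrite Cn.
Qed.

Lemma cosh_ge1 (R : realType) (x : R) : 1 <= cosh x.
Proof.
rewrite -(@ler_pXn2r _ 2)// ?nnegrE ?(ltW (cosh_gt0 _))//.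
by rewrite cosh2 expr1n lerDl sqr_ge0.
Qed.

(** * Fourier transform of the hyperbolic secant on horizontal lines *)

Section strip.
Variable R : realType.
Notation mu := (@lebesgue_measure R).
Implicit Types (th t v : R).

(** 1 / (2 cosh((t + i th) / 2)) = [stripP th t] - i [stripQ th t]. *)
Definition stripP th t : R :=
  cosh (t / 2) * cos (th / 2) / (2 * (sinh (t / 2) ^+ 2 + cos (th / 2) ^+ 2)).
Definition stripQ th t : R :=
  sinh (t / 2) * sin (th / 2) / (2 * (sinh (t / 2) ^+ 2 + cos (th / 2) ^+ 2)).

(** [M] and [F] are the real and imaginary parts of e^(i v z) / (2 cosh(z / 2)) at z = t + i th,
   up to the sign of [F]; [M'] is the derivative of [M] in th and, by Cauchy-Riemann, that of
    [F] in t. *)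
Let M v th t := expR (- (v * th)) *
  (cos (v * t) * stripP th t + sin (v * t) * stripQ th t).
Let F v th t := expR (- (v * th)) *
  (cos (v * t) * stripQ th t - sin (v * t) * stripP th t).
Let M' v th t := let N := sinh (t / 2) ^+ 2 + cos (th / 2) ^+ 2 in
  expR (- (v * th)) *
  (- v * (cos (v * t) * stripP th t + sin (v * t) * stripQ th t)
   + cos (v * t) * (cosh (t / 2) * sin (th / 2) * (cos (th / 2) ^+ 2 - sinh (t / 2) ^+ 2)
       / (4 * N ^+ 2))
   + sin (v * t) * (sinh (t / 2) * cos (th / 2) * (N / 2 + sin (th / 2) ^+ 2)
       / (2 * N ^+ 2))).

Let cos_gt0 th : - pi < th < pi -> 0 < cos (th / 2).
Proof. by move=> /andP[h1 h2]; apply: cos_gt0_pihalf; apply/andP; split; lra. Qed.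

Let N_gt0 th t : - pi < th < pi -> 0 < sinh (t / 2) ^+ 2 + cos (th / 2) ^+ 2.
Proof. by move=> /cos_gt0 c0; rewrite ltr_wpDl ?sqr_ge0// exprn_gt0. Qed.

Let derM v th t : - pi < th < pi -> is_derive th 1 (fun th => M v th t) (M' v th t).
Proof.
move=> h; have N0 := N_gt0 t h; have c0 := cos_gt0 h.
rewrite /M /M' /stripP /stripQ; eapply der_eq.
  by der; rewrite gt_eqF// mulr_gt0.
have C2 := cosh2 (t / 2); have s2 := cos2Dsin2 (th / 2).
move: (sinh _) (cosh _) (cos (th / 2)) (sin (th / 2)) (cos (v * t)) (sin (v * t)) (expR _) C2 s2 N0 c0 => S C c s cv sv e C2 s2 N0 c0.
field. lra.
Qed.

Let derF v th t : - pi < th < pi -> is_derive t 1 (F v th) (M' v th t).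
Proof.
move=> h; have N0 := N_gt0 t h; have c0 := cos_gt0 h.
rewrite /F /M' /stripP /stripQ; eapply der_eq.
  by der; rewrite gt_eqF// mulr_gt0.
have C2 := cosh2 (t / 2); have s2 := cos2Dsin2 (th / 2).
move: (sinh _) (cosh _) (cos (th / 2)) (sin (th / 2)) (cos (v * t)) (sin (v * t)) (expR _) C2 s2 N0 c0 => S C c s cv sv e C2 s2 N0 c0.
have -> : s ^+ 2 = 1 - c ^+ 2 by lra.
field: C2. lra.
Qed.

Let strip_const_bound v c0 := expR (`|v| * pi) * (2 * ((c0 ^- 2 * `|v| + c0 ^- 2 / 4)
  + (c0 ^- 2 / 4 + (c0 ^- 2) ^+ 2 / 2))).

Let N_ge th c0 t : 0 < c0 -> c0 <= cos (th / 2) ->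
  cosh (t / 2) ^+ 2 <= c0 ^- 2 * (sinh (t / 2) ^+ 2 + cos (th / 2) ^+ 2).
Proof.
move=> c00 c0c; rewrite ler_pdivlMl ?exprn_gt0// cosh2.
have c1 := cos_le1 (th / 2).
move: (sinh _) (cos _) c0c c1 => S c h1 h2.
have : 0 <= S ^+ 2 * (1 - c0 ^+ 2).
  by apply: mulr_ge0; [exact: sqr_ge0|rewrite subr_ge0 expr_le1//; lra].
have : c0 ^+ 2 <= c ^+ 2 by rewrite ler_pXn2r ?nnegrE//; lra.
by lra.
Qed.

Let bounds th c0 t : - pi < th < pi -> 0 < c0 -> c0 <= cos (th / 2) ->
  let S := sinh (t / 2) in let C := cosh (t / 2) in
  let c := cos (th / 2) in let s := sin (th / 2) in let k := c0 ^- 2 in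
  let N := S ^+ 2 + c ^+ 2 in
  [/\ `|stripP th t| <= k / C / 2, `|stripQ th t| <= k / C / 2,
      `|C * s * (c ^+ 2 - S ^+ 2) / (4 * N ^+ 2)| <= k / C / 4 &
      `|S * c * (N / 2 + s ^+ 2) / (2 * N ^+ 2)| <= (k / 4 + k ^+ 2 / 2) / C].
Proof.
move=> h c00 c0c S C c s k N; apply: (@strip_bounds R) => //.
- exact: cosh_ge1.
- exact: N_gt0.
- exact: norm_sinh_le.
- exact: cos_max.
- exact: sin_max.
- exact: N_ge.
- by rewrite invr_ge0 exprn_ge0// ltW.
Qed.

Let exp_bound v th : - pi < th < pi -> expR (- (v * th)) <= expR (`|v| * pi).
Proof.
move=> h; rewrite ler_expR (le_trans (ler_norm _))// normrN normrM.
by rewrite ler_wpM2l// ler_norml; lra.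
Qed.

Let M'_bound v th c0 t : - pi < th < pi -> 0 < c0 -> c0 <= cos (th / 2) ->
  `|M' v th t| <= strip_const_bound v c0 * expR (- (t / 2)).
Proof.
move=> h c00 c0c; have [bP bQ b1 b2] := bounds t h c00 c0c.
have k0 : 0 <= c0 ^- 2 by rewrite invr_ge0 exprn_ge0// ltW.
rewrite /strip_const_bound /M' -[leRHS]mulrA; apply: ler_normM.
  by rewrite ger0_norm ?expR_ge0// exp_bound.
have cv := cos_max (v * t); have sv := sin_max (v * t).
have C0 := cosh_gt0 (t / 2); have CV := coshV_le (t / 2).
move: bP bQ b1 b2 (ler_normM cv bP) (ler_normM sv bQ) (ler_normM cv b1) (ler_normM sv b2).
set T1 := _ / (4 * _); set T2 := _ / (2 * _).
rewrite !mul1r => _ _ _ _ h1 h2 h3 h4.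
have h5 := ler_normM (lexx `|- v|) (le_trans (ler_normD _ _) (lerD h1 h2)).
apply: (le_trans (ler_normD _ _)); apply: (le_trans (lerD (ler_normD _ _) (lexx _))).
apply: (le_trans (lerD (lerD h5 h3) h4)); rewrite normrN.
apply: (@le_trans _ _ ((c0 ^- 2 * `|v| + c0 ^- 2 / 4 +
   (c0 ^- 2 / 4 + c0 ^- 2 ^+ 2 / 2)) * (cosh (t / 2))^-1)).
  by apply: le_of_eq; field; rewrite ?gt_eqF.
have X0 : 0 <= c0 ^- 2 * `|v| + c0 ^- 2 / 4 + (c0 ^- 2 / 4 + c0 ^- 2 ^+ 2 / 2).
  by rewrite !addr_ge0// ?mulr_ge0// ?sqr_ge0// invr_ge0.
by have := ler_wpM2l X0 CV; rewrite [in leRHS]mulrCA mulrA.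
Qed.

Let weight_int k : mu.-integrable `]0, +oo[ (EFin \o (fun t => k * expR (- (t / 2)))).
Proof.
have := @integrable_expN R k 2^-1; rewrite invr_gt0 => /(_ (ltr0Sn R 1)).
by apply: eq_integrableR => // t _; rewrite (mulrC 2^-1).
Qed.

Let M_bound v th c0 t : - pi < th < pi -> 0 < c0 -> c0 <= cos (th / 2) ->
  `|M v th t| <= 2 * expR (`|v| * pi) * c0 ^- 2 * expR (- (t / 2)) /\
  `|F v th t| <= 2 * expR (`|v| * pi) * c0 ^- 2 * expR (- (t / 2)).
Proof.
move=> h c00 c0c; have [bP bQ _ _] := bounds t h c00 c0c.
have k0 : 0 <= c0 ^- 2 by rewrite invr_ge0 exprn_ge0// ltW.
have cv := cos_max (v * t); have sv := sin_max (v * t).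
have CV := coshV_le (t / 2).
have eb : `|expR (- (v * th))| <= expR (`|v| * pi).
  by rewrite ger0_norm ?expR_ge0// exp_bound.
have kC : c0 ^- 2 / cosh (t / 2) / 2 + c0 ^- 2 / cosh (t / 2) / 2 <=
    2 * (c0 ^- 2 * expR (- (t / 2))).
  by rewrite -splitr [leRHS]mulrCA ler_wpM2l.
rewrite (mulrC 2) -!mulrA (mulrA 2) -(mulrA 2) /M /F; split; apply: ler_normM => //;
  apply: (le_trans (ler_normD _ _)); apply: le_trans kC; apply: lerD; rewrite ?normrN.
- by have := ler_normM cv bP; rewrite mul1r.
- by have := ler_normM sv bQ; rewrite mul1r.
- by have := ler_normM cv bQ; rewrite mul1r.
- by have := ler_normM sv bP; rewrite mul1r.
Qed.

Let mM v th : measurable_fun setT (M v th).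
Proof. by rewrite /M /stripP /stripQ; mf. Qed.

Let intM v th : - pi < th < pi -> mu.-integrable `]0, +oo[ (EFin \o M v th).
Proof.
move=> h; apply: (le_integrableR _ _ (weight_int _)) => //.
  by apply: measurable_funTS; exact: mM.
by move=> t _; exact: (M_bound v t h (cos_gt0 h) (lexx _)).1.
Qed.

Let intM' v th : - pi < th < pi -> mu.-integrable `]0, +oo[ (EFin \o M' v th).
Proof.
move=> h; apply: (le_integrableR _ _ (weight_int _)) => //.
  by apply: measurable_funTS; rewrite /M' /stripP /stripQ; mf.
by move=> t _; exact: M'_bound h (cos_gt0 h) (lexx _).
Qed.

Let int_M'0 v th : - pi < th < pi -> \int[mu]_(t in `]0, +oo[) M' v th t = 0.
Proof.
move=> h; rewrite -[RHS](subrr 0); apply: (@FTC_oy R (M' v th) (F v th) 0 0 0).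
- by move=> t _; exact: derF.
- move=> t _; have N0 := N_gt0 t h; eapply is_derive_cont.
  by rewrite /M' /stripP /stripQ; der; rewrite gt_eqF// ?mulr_gt0// exprn_gt0.
- by rewrite /M' /stripP /stripQ; mf.
- apply: (cvg_right_derive (derF v 0 h)).
  by rewrite /F /stripQ mul0r mulr0 sinh0 sin0; ring.
- have e0 : (fun t => 2 * expR (`|v| * pi) * cos (th / 2) ^- 2 * expR (- (t / 2))) @ +oo --> 0.
    rewrite -[X in _ --> X](mulr0 (2 * expR (`|v| * pi) * cos (th / 2) ^- 2)).
    apply: cvgMr; have := @cvg_expNy R 2^-1; rewrite invr_gt0 => /(_ (ltr0Sn R 1)).
    by under eq_fun do rewrite mulrC.
  apply/norm_cvg0P; apply: (squeeze_cvgr _ (cvg_cst 0) e0).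
  apply: nearW => t; rewrite normr_ge0.
  exact: (M_bound v t h (cos_gt0 h) (lexx _)).2.
- exact: intM'.
Qed.

(** Differentiating in th under the integral sign turns the derivative, by
   Cauchy-Riemann, into the integral in t of a derivative, which vanishes. *)
Let dE v th : - pi < th < pi ->
  is_derive th 1 (fun th => \int[mu]_(t in `]0, +oo[) M v th t) 0.
Proof.
move=> h; refine (der_eq _ (int_M'0 v h)).
pose b := (`|th| + pi) / 2.
have thpi : `|th| < pi by rewrite ltr_norml.
have bpi : 0 <= b < pi by rewrite /b; apply/andP; split; have := normr_ge0 th; lra.
have cb : 0 < cos (b / 2) by apply: cos_gt0; lra.
have sub x : - b < x < b -> - pi < x < pi by lra.
have cx x : - b < x < b -> cos (b / 2) <= cos (x / 2).
  move=> xb; rewrite -(cos_norm (x / 2)).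
  have : `|x / 2| <= b / 2 by rewrite ler_norml; lra.
  have : 0 <= `|x / 2| by [].
  move: (`|x / 2|) => y y0 yb; case: (ltgtP y (b / 2)) yb => // [yb|->] _ //.
  by apply/ltW; rewrite ltr_cos// in_itv /=; lra.
have wi := weight_int (strip_const_bound v (cos (b / 2))).
refine (@is_derive_under_integral _ _ _ mu `]0, +oo[ (M v) (M' v) th (- b) b
   _ _ _ _ _ wi _).
- exact: measurable_itv.
- by rewrite -ltr_norml /b; lra.
- by move=> x /sub xb; exact: intM.
- by move=> x t /sub xb _; exact: derM.
- by move=> x t xb _; apply: M'_bound => //; [exact: sub|exact: cx].
Qed.

Let E_const v th : - pi < th < pi ->
  \int[mu]_(t in `]0, +oo[) M v th t = \int[mu]_(t in `]0, +oo[) M v 0 t.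
Proof.
pose E th := \int[mu]_(t in `]0, +oo[) M v th t.
have key a b : a < b -> - pi < a -> b < pi -> E a = E b.
  move=> ab ha hb.
  have I x : a <= x <= b -> is_derive x 1 E 0.
    by move=> xab; apply: dE; lra.
  have [||c _] := @MVT R E (fun=> 0) a b ab.
  - by move=> x; rewrite in_itv /= => /andP[ax xb]; apply: I; lra.
  - apply: continuous_in_subspaceT => x; rewrite inE /= in_itv /= => xab.
    exact: is_derive_cont (I x xab).
  - by rewrite mul0r; lra.
move=> h; have p0 := pi_gt0 R; case: (ltgtP th 0) => [t0|t0|->//].
- by apply: key => //; lra.
- by symmetry; apply: key => //; lra.
Qed.

Definition stripA v th := \int[mu]_(t in `]0, +oo[) (cos (v * t) * stripP th t).
Definition stripB v th := \int[mu]_(t in `]0, +oo[) (sin (v * t) * stripQ th t).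

Let int_cP v th : - pi < th < pi ->
  mu.-integrable `]0, +oo[ (EFin \o (fun t => cos (v * t) * stripP th t)).
Proof.
move=> h; apply: (le_integrableR _ _ (weight_int (cos (th / 2) ^- 2))) => //.
  by apply: measurable_funTS; rewrite /stripP; mf.
move=> t _; have [bP _ _ _] := bounds t h (cos_gt0 h) (lexx _).
have := ler_normM (cos_max (v * t)) bP; rewrite mul1r => /le_trans; apply.
rewrite -!mulrA ler_wpM2l ?invr_ge0 ?sqr_ge0//.
by have := coshV_le (t / 2); lra.
Qed.

Let int_sQ v th : - pi < th < pi ->
  mu.-integrable `]0, +oo[ (EFin \o (fun t => sin (v * t) * stripQ th t)).
Proof.
move=> h; apply: (le_integrableR _ _ (weight_int (cos (th / 2) ^- 2))) => //.
  by apply: measurable_funTS; rewrite /stripQ; mf.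
move=> t _; have [_ bQ _ _] := bounds t h (cos_gt0 h) (lexx _).
have := ler_normM (sin_max (v * t)) bQ; rewrite mul1r => /le_trans; apply.
rewrite -!mulrA ler_wpM2l ?invr_ge0 ?sqr_ge0//.
by have := coshV_le (t / 2); lra.
Qed.

Let EAB v th : - pi < th < pi ->
  \int[mu]_(t in `]0, +oo[) M v th t = expR (- (v * th)) * (stripA v th + stripB v th).
Proof.
move=> h; rewrite /M RintegralZl//; last first.
  by apply: integrableDR => //; [exact: int_cP|exact: int_sQ].
by rewrite RintegralD//; [exact: int_cP|exact: int_sQ].
Qed.

(** The integral of [M] does not depend on th. Comparing th and - th, for which the cosine
    integral is even and the sine integral odd, separates the two. *)
Lemma stripAB v th : - pi < th < pi ->
  stripA v th = stripA v 0 * cosh (v * th) /\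
  stripB v th = stripA v 0 * sinh (v * th).
Proof.
move=> h; have h' : - pi < - th < pi by lra.
have h0 : - pi < (0 : R) < pi by have := pi_gt0 R; lra.
have AN : stripA v (- th) = stripA v th.
  by rewrite /stripA /stripP mulNr cosN.
have BN : stripB v (- th) = - stripB v th.
  rewrite /stripB -[RHS]mulN1r -RintegralZl//; last exact: int_sQ.
  by apply: eq_RintegralR => t _; rewrite /stripQ mulNr sinN cosN; ring.
have B0 : stripB v 0 = 0.
  rewrite /stripB (@eq_RintegralR _ _ _ mu _ _ (fun=> 0)).
    by rewrite /Rintegral integral0.
  by move=> t _; rewrite /stripQ mul0r sin0 !(mulr0, mul0r).
have := E_const v h; have := E_const v h'.
rewrite !EAB// AN BN B0 addr0 mulr0 oppr0 expR0 mul1r mulrN opprK => e1 e2.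
have p0 := expR_gt0 (v * th); rewrite expRN in e2.
rewrite /cosh /sinh expRN.
move: (stripA v th) (stripB v th) (stripA v 0) (expR _) p0 e1 e2 => A B a x p0 e1 e2.
have e3 : A + B = a * x by rewrite -e2; field; lra.
have e4 : A - B = a / x by rewrite -e1; field; lra.
by rewrite mulrA (mulrA a) mulrDr mulrBr -e3 -e4; split; field.
Qed.

End strip.

Lemma norm_sin_le (R : realType) (x : R) : `|sin x| <= `|x|.
Proof.
have key (y : R) : 0 < y -> `|sin y| <= y.
  move=> y0; have [|c _] := @MVT R (@sin R) (@cos R) 0 y y0.
  - by apply: continuous_subspaceT => z; exact: continuous_sin.
  - rewrite sin0 !subr0 => ->; rewrite normrM (gtr0_norm y0).
    by rewrite ler_piMl ?cos_max// ltW.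
have [x0|x0|->] := ltgtP x 0; last by rewrite sin0.
- by rewrite -normrN -sinN (ltr0_norm x0) key// oppr_gt0.
- by rewrite (gtr0_norm x0) key.
Qed.

Lemma oneBcos_le (R : realType) (x : R) : 0 <= 1 - cos x <= x ^+ 2 / 2.
Proof.
rewrite subr_ge0 cos_le1 /= (_ : cos x = cos ((x / 2) *+ 2)); last first.
  by congr cos; rewrite mulr2n; lra.
rewrite cos_mulr2n cos2sin2.
have h : sin (x / 2) ^+ 2 <= (x / 2) ^+ 2.
  by rewrite -[leLHS]real_normK ?num_real// -[leRHS]real_normK ?num_real// ler_pXn2r ?nnegrE// norm_sin_le.
rewrite mulr2n.
have -> : x ^+ 2 / 2 = 2 * (x / 2) ^+ 2 by field.
lra.
Qed.

Lemma sinh_ge (R : realType) (x : R) : 0 <= x -> x / 2 <= sinh x.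
Proof.
move=> x0; rewrite /sinh ler_pM2r ?invr_gt0//.
have : expR (- x) <= 1 by rewrite expR_le1; lra.
by have := expR_ge1Dx x; lra.
Qed.

Lemma sinh_ge_exp (R : realType) (x : R) : 0 <= x ->
  x * expR x <= (1 + 2 * x) * sinh x.
Proof.
move=> x0; have e0 := expR_gt0 x.
have h : 1 + 2 * x <= expR x ^+ 2 by rewrite -expRM_natl; exact: expR_ge1Dx.
rewrite /sinh expRN -subr_ge0.
rewrite (_ : _ - _ = (expR x ^+ 2 - (1 + 2 * x)) / (2 * expR x)).
  by rewrite divr_ge0 ?subr_ge0// mulr_ge0// ltW.
by field; rewrite gt_eqF.
Qed.

(** [stripP th] has the primitive atan (sinh (t / 2) / cos (th / 2)). *)
Lemma stripP_total (R : realType) (th : R) : 0 < cos (th / 2) ->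
  (@lebesgue_measure R).-integrable `]0, +oo[ (EFin \o stripP th) /\
  \int[@lebesgue_measure R]_(t in `]0, +oo[) stripP th t = pi / 2.
Proof.
move=> c0.
have N0 t : 0 < sinh (t / 2) ^+ 2 + cos (th / 2) ^+ 2.
  by rewrite ltr_wpDl ?sqr_ge0// exprn_gt0.
pose F (t : R) := atan (sinh (t / 2) / cos (th / 2)).
have dF (t : R) : is_derive t 1 F (stripP th t).
  rewrite /F /stripP; eapply der_eq; first by der.
  by field; rewrite !gt_eqF//= addrC.
have cP (t : R) : {for t, continuous (stripP th)}.
  by eapply is_derive_cont; rewrite /stripP; der; rewrite gt_eqF// mulr_gt0.
have mP : measurable_fun setT (stripP th) by rewrite /stripP; mf.
have F0 : F x @[x --> 0^'+] --> 0.
  by apply: (cvg_right_derive (dF 0)); rewrite /F mul0r sinh0 mul0r atan0.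
have Fy : F x @[x --> +oo] --> pi / 2.
  apply: (@cvg_comp _ _ _ (fun t : R => sinh (t / 2) / cos (th / 2)) (@atan R)); last exact: cvgy_atan.
  apply: gt0_cvgMly; first by rewrite invr_gt0.
  apply/cvgryPge => A; near=> t.
  have t0 : 0 <= t by near: t; exact: nbhs_pinfty_ge.
  apply: (@le_trans _ _ (t / 4)); last by have := @sinh_ge R (t / 2); lra.
  rewrite ler_pdivlMr//; near: t; exact: nbhs_pinfty_ge.
have iP : (@lebesgue_measure R).-integrable `]0, +oo[ (EFin \o stripP th).
  refine (@integrable_oy R (stripP th) F 0 0 (pi / 2) _ _ _ _ _ _) => // t t0.
  by rewrite divr_ge0// ?mulr_ge0// ltW// cosh_gt0.
split => //; rewrite -[RHS]subr0.
exact: (@FTC_oy R (stripP th) F 0 0 (pi / 2)).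
Unshelve. all: by end_near. Qed.

(** As th tends to pi, [stripP th] is a Poisson-type kernel of mass pi / 2 that concentrates
    at t = 0: the difference to the mass is controlled by 1 - cos(v t) <= (v t)^2 / 2 and
    carries a factor cos(th / 2). *)
Lemma norm_stripA_le (R : realType) (v th : R) : 0 <= th < pi ->
  `|stripA v th - pi / 2| <=
  cos (th / 2) * \int[@lebesgue_measure R]_(t in `]0, +oo[)
    (64 * v ^+ 2 * expR (- (4^-1 * t))).
Proof.
move=> h; have c0 : 0 < cos (th / 2).
  by apply: cos_gt0_pihalf; have := pi_gt0 R; lra.
have [iP vP] := stripP_total c0.
have mi : measurable (`]0, +oo[ : set R) by exact: measurable_itv.
have P0 t : 0 <= stripP th t.
  apply: divr_ge0; first exact: mulr_ge0 (ltW (cosh_gt0 _)) (ltW c0).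
  by rewrite mulr_ge0// addr_ge0 ?sqr_ge0.
have icP : (@lebesgue_measure R).-integrable `]0, +oo[
    (EFin \o (fun t => cos (v * t) * stripP th t)).
  apply: (le_integrableR _ _ iP) => //.
    by apply: measurable_funTS; rewrite /stripP; mf.
  move=> t _; rewrite normrM (ger0_norm (P0 t)).
  by rewrite ler_piMl ?cos_max.
have w := @integrable_expN R (64 * v ^+ 2) 4^-1.
have {}w : (@lebesgue_measure R).-integrable `]0, +oo[
    (EFin \o (fun t => 64 * v ^+ 2 * expR (- (4^-1 * t)))) by apply: w; rewrite invr_gt0.
rewrite /stripA -vP -RintegralB// -RintegralZl//.
apply: (le_trans (le_normr_Rintegral _ _)) => //.
  apply: integrableDR => //; exact: integrableNR.
apply: le_RintegralR => //.
- apply: integrable_norm; apply: integrableDR => //; exact: integrableNR.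
- exact: integrableZR.
move=> t; rewrite /= in_itv /= andbT => t0.
rewrite -[X in _ - X]mul1r -mulrBl normrM distrC.
have /andP[k0 k1] := oneBcos_le (v * t).
rewrite (ger0_norm k0) (ger0_norm (P0 t)).
apply: (le_trans (ler_wpM2r (P0 t) k1)); rewrite /stripP.
move SE: (sinh (t / 2)) => S; move CC: (cosh (t / 2)) => C.
move: c0; move: (cos (th / 2)) => c c0.
have t20 : 0 <= t / 2 by lra.
have S0 : 0 < S by have := sinh_ge t20; rewrite SE; lra.
have C0 : 0 < C by rewrite -CC; exact: cosh_gt0.
have [C00 S00 c00] : [/\ 0 <= C, 0 <= S & 0 <= c] by split; exact: ltW.
have N0 : 0 < S ^+ 2 + c ^+ 2 by rewrite ltr_wpDr ?sqr_ge0// exprn_gt0.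
apply: (@le_trans _ _ ((v * t) ^+ 2 / 2 * (C * c / (2 * S ^+ 2)))).
  rewrite ler_wpM2l// ?divr_ge0 ?sqr_ge0// ler_wpM2l// ?mulr_ge0//.
  rewrite lef_pV2 ?posrE ?mulr_gt0// ?exprn_gt0//.
  by rewrite ler_pM2l// lerDl sqr_ge0.
(* S >= t e^(t/2) / (2 (1 + t)) and 1 + t <= 8 e^(t/8) give t^2 C / S^2 <= 256 e^(-t/4). *)
have E : t * expR (t / 2) <= 2 * (1 + t) * S.
  have := sinh_ge_exp t20; rewrite SE; have e0 := expR_gt0 (t / 2).
  have -> : 1 + 2 * (t / 2) = 1 + t by field.
  lra.
have CE : C <= expR (t / 2).
  have : expR (- (t / 2)) <= expR (t / 2) by rewrite ler_expR; lra.
  rewrite -CC /cosh; lra.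
have T : 1 + t <= 8 * expR (t / 8) by have := expR_ge1Dx (t / 8); lra.
have e0 := expR_gt0 (t / 8).
have e8 : expR (t / 2) = expR (t / 8) ^+ 4.
  by rewrite -expRM_natl; congr expR; field.
have e4 : expR (- (4^-1 * t)) = expR (t / 8) ^- 2.
  by rewrite expRN -expRM_natl; congr (expR _)^-1; field.
rewrite e4; rewrite e8 in E CE; move: (expR (t / 8)) e0 E CE T => e e0 E CE T.
have t00 := ltW t0; have e00 := ltW e0.
have h1 : t ^+ 2 * e ^+ 8 <= 4 * (1 + t) ^+ 2 * S ^+ 2.
  have -> : t ^+ 2 * e ^+ 8 = (t * e ^+ 4) ^+ 2 by ring.
  have -> : 4 * (1 + t) ^+ 2 * S ^+ 2 = (2 * (1 + t) * S) ^+ 2 by ring.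
  by rewrite ler_pXn2r// nnegrE ?mulr_ge0 ?exprn_ge0 ?addr_ge0.
have h2 : (1 + t) ^+ 2 <= 64 * e ^+ 2.
  have -> : 64 * e ^+ 2 = (8 * e) ^+ 2 by ring.
  by rewrite ler_pXn2r// nnegrE ?mulr_ge0 ?addr_ge0.
have h3 : t ^+ 2 * e ^+ 8 <= 256 * e ^+ 2 * S ^+ 2.
  apply: (le_trans h1); rewrite ler_wpM2r ?sqr_ge0//; lra.
have h4 : t ^+ 2 * C * e ^+ 2 <= 256 * S ^+ 2.
  have : t ^+ 2 * C * e ^+ 4 <= 256 * e ^+ 2 * S ^+ 2.
    apply: le_trans h3; have -> : t ^+ 2 * e ^+ 8 = t ^+ 2 * e ^+ 4 * e ^+ 4 by ring.
    by rewrite mulrAC ler_wpM2l ?mulr_ge0 ?sqr_ge0 ?exprn_ge0.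
  have -> : t ^+ 2 * C * e ^+ 4 = e ^+ 2 * (t ^+ 2 * C * e ^+ 2) by ring.
  have -> : 256 * e ^+ 2 * S ^+ 2 = e ^+ 2 * (256 * S ^+ 2) by ring.
  by rewrite ler_pM2l ?exprn_gt0.
have -> : (v * t) ^+ 2 / 2 * (C * c / (2 * S ^+ 2)) =
   c * v ^+ 2 * (t ^+ 2 * C) / (4 * S ^+ 2) by field; rewrite gt_eqF.
rewrite ler_pdivrMr ?mulr_gt0 ?exprn_gt0//.
have -> : c * (64 * v ^+ 2 * e ^- 2) * (4 * S ^+ 2) =
  c * v ^+ 2 * (256 * S ^+ 2 * e ^- 2) by field; rewrite gt_eqF.
apply: ler_wpM2l; first exact: mulr_ge0 c00 (sqr_ge0 _).
by rewrite ler_pdivlMr ?exprn_gt0.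
Qed.

(** stripA v 0 * cosh(v th) = stripA v th tends to pi / 2 as th tends to pi. *)
Lemma stripA0 (R : realType) (v : R) : stripA v 0 = pi / (2 * cosh (pi * v)).
Proof.
set K := \int[@lebesgue_measure R]_(t in `]0, +oo[) (64 * v ^+ 2 * expR (- (4^-1 * t))).
have p0 := pi_gt0 R.
pose g (th : R) := cos (th / 2) * K - `|stripA v 0 * cosh (v * th) - pi / 2|.
have g0 : \forall th \near pi^'-, 0 <= g th.
  near=> th; have h : 0 <= th < pi.
    by apply/andP; split; near: th; [exact: nbhs_left_ge|exact: nbhs_left_lt].
  rewrite /g subr_ge0; have := norm_stripA_le v h.
  have [|-> _] := @stripAB R v th; last by [].
  by lra.
have cg : g th @[th --> pi^'-] --> g pi.
  have c1 : {for (pi : R), continuous (fun th : R => cos (th / 2) * K)}.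
    by eapply is_derive_cont; der.
  have c2 : {for (pi : R), continuous (fun th : R => stripA v 0 * cosh (v * th) - pi / 2)}.
    by eapply is_derive_cont; der.
  by apply: cvg_at_left_filter; apply: cvgB; [exact: c1|apply: cvg_norm; exact: c2].
have : 0 <= g pi by apply: (cvgr_to_ge cg g0).
rewrite /g cos_pihalf mul0r sub0r oppr_ge0 normr_le0 subr_eq0 => /eqP h.
have C0 := cosh_gt0 (v * pi).
rewrite [pi * v]mulrC invfM mulrA -h mulfK// gt_eqF//.
Unshelve. all: by end_near. Qed.

Lemma stripAB_half (R : realType) (v : R) :
  stripA v (pi / 2) = pi / 2 * (cosh (pi * v / 2) / cosh (pi * v)) /\
  stripB v (pi / 2) = pi / 2 * (sinh (pi * v / 2) / cosh (pi * v)).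
Proof.
have p0 := pi_gt0 R; have [|-> ->] := @stripAB R v (pi / 2); first lra.
rewrite stripA0 (_ : v * (pi / 2) = pi * v / 2); last by field.
by have C0 := cosh_gt0 (pi * v); split; field; rewrite gt_eqF.
Qed.

(** * Fourier inversion by Abel summation *)

Section abel.
Variable R : realType.
Notation mu := (@lebesgue_measure R).
Implicit Types e s t v : R.

(** The Laplace transform of cos(v s) in v, equal to pi times the Poisson kernel of the half
    plane. *)
Definition abelK e s : R := e / (e ^+ 2 + s ^+ 2).

Lemma cvg_bounded_exp (f : R -> R) e (c : R) : 0 < e ->
  (forall v, `|f v| <= c) -> expR (- (e * v)) * f v @[v --> +oo] --> 0.
Proof.
move=> e0 fc; have c1 : c * expR (- (e * v)) @[v --> +oo] --> 0.
  by rewrite -[X in _ --> X](mulr0 c); apply: cvgMr; exact: cvg_expNy.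
apply/norm_cvg0P; apply: (squeeze_cvgr _ (cvg_cst 0) c1).
apply: nearW => v; rewrite normr_ge0 /= normrM mulrC.
by rewrite ler_pM// ger0_norm// expR_ge0.
Qed.

Lemma int_exp_cos e s : 0 < e ->
  \int[mu]_(v in `]0, +oo[) (expR (- (e * v)) * cos (v * s)) = abelK e s.
Proof.
move=> e0; have D0 : 0 < e ^+ 2 + s ^+ 2 by rewrite ltr_wpDr ?sqr_ge0// exprn_gt0.
pose f v := expR (- (e * v)) * cos (v * s).
pose F v := expR (- (e * v)) * ((s * sin (v * s) - e * cos (v * s)) / (e ^+ 2 + s ^+ 2)).
have dF (v : R) : is_derive v 1 F (f v).
  by rewrite /F; eapply der_eq; [der; rewrite ?gt_eqF|rewrite /f; field; rewrite gt_eqF].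
have -> : abelK e s = 0 - - abelK e s by rewrite opprK add0r.
refine (@FTC_oy R f F 0 (- abelK e s) 0 _ _ _ _ _ _).
- by move=> v _; eapply is_derive_cont; rewrite /f; der.
- by rewrite /f; mf.
- apply: (cvg_right_derive (dF 0)); rewrite /F /abelK.
  by rewrite mulr0 mul0r sin0 cos0 oppr0 expR0; field; rewrite gt_eqF.
- apply: (cvg_bounded_exp (c := (`|s| + `|e|) / (e ^+ 2 + s ^+ 2)) e0) => v.
  rewrite normf_div (gtr0_norm D0) ler_pM2r ?invr_gt0//.
  apply: (le_trans (ler_normB _ _)); apply: lerD; rewrite normrM ler_piMr//.
    exact: sin_max.
  exact: cos_max.
- apply: (le_integrableR _ _ (integrable_expN 1 e0)) => //.
    by apply: measurable_funTS; rewrite /f; mf.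
  move=> v _; rewrite /f normrM mul1r ger0_norm ?expR_ge0// ler_piMr ?expR_ge0//.
  exact: cos_max.
Qed.

Lemma abelK_ge0 e s : 0 <= e -> 0 <= abelK e s.
Proof. by move=> e0; rewrite divr_ge0// addr_ge0 ?sqr_ge0. Qed.

(** A bound uniform in e: the oscillation m of a bounded Lipschitz function compensates
    the singularity of the kernel at s = 0. *)
Lemma abelK_min e s (m : R) : 0 < e <= 1 -> 0 <= m -> m <= `|s| -> m <= 1 ->
  abelK e s * m <= (1 + s ^+ 2)^-1.
Proof.
move=> /andP[e0 e1] m0 ms m1; rewrite /abelK.
have s2 : s ^+ 2 = `|s| ^+ 2 by rewrite real_normK// num_real.
rewrite s2; move: (`|s|) (normr_ge0 s) ms => a a0 ma.
have D0 : 0 < e ^+ 2 + a ^+ 2 by rewrite ltr_wpDr ?sqr_ge0// exprn_gt0.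
have S0 : 0 < 1 + a ^+ 2 by rewrite ltr_wpDr ?sqr_ge0.
rewrite mulrAC ler_pdivrMr// ler_pdivlMl//.
case: (lerP a 1) => a1.
  have h : e * m <= e * a by rewrite ler_wpM2l// ltW.
  have := sqr_ge0 (e - a); have : a ^+ 2 <= 1 by rewrite expr_le1.
  have : 0 <= e * a by rewrite mulr_ge0// ltW.
  nra.
have h : e * m <= e by rewrite ler_piMr// ltW.
have a2 : 1 <= a ^+ 2 by rewrite expr_ge1// ltW.
nra.
Qed.

Lemma int_abelK (tau e : R) : 0 < e ->
  mu.-integrable `]0, +oo[
    (EFin \o (fun t => abelK e (tau - t) + abelK e (tau + t))) /\
  \int[mu]_(t in `]0, +oo[) (abelK e (tau - t) + abelK e (tau + t)) = pi.
Proof.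
move=> e0; have D0 s : 0 < e ^+ 2 + s ^+ 2 by rewrite ltr_wpDr ?sqr_ge0// exprn_gt0.
pose f t := abelK e (tau - t) + abelK e (tau + t).
pose F t := atan ((t - tau) / e) + atan ((t + tau) / e).
have dF (t : R) : is_derive t 1 F (f t).
  rewrite /F; eapply der_eq; first by der.
  have := D0 (t - tau); have := D0 (t + tau).
  by rewrite /f /abelK => h1 h2; field; rewrite !gt_eqF//; nra.
have cf (t : R) : {for t, continuous f}.
  by eapply is_derive_cont; rewrite /f /abelK; der; rewrite gt_eqF.
have mf : measurable_fun setT f by rewrite /f /abelK; mf.
have F0 : F x @[x --> 0^'+] --> 0.
  apply: (cvg_right_derive (dF 0)); rewrite /F sub0r add0r.
  by rewrite mulNr atanN addNr.
have Fy : F x @[x --> +oo] --> pi.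
  rewrite (splitr pi); apply: cvgD.
    apply: (@cvg_comp _ _ _ (fun t : R => (t - tau) / e) (@atan R)); last exact: cvgy_atan.
    by apply: gt0_cvgMly; [rewrite invr_gt0|exact: cvg_addrr].
  apply: (@cvg_comp _ _ _ (fun t : R => (t + tau) / e) (@atan R)); last exact: cvgy_atan.
  by apply: gt0_cvgMly; [rewrite invr_gt0|exact: cvg_addrr].
have iP : mu.-integrable `]0, +oo[ (EFin \o f).
  refine (@integrable_oy R f F 0 0 pi _ _ _ _ _ _) => // t t0.
  by rewrite addr_ge0// abelK_ge0// ltW.
split => //; rewrite -[RHS]subr0.
exact: (@FTC_oy R f F 0 0 pi).
Qed.

End abel.

Section kernel_inversion.
Variable R : realType.
Notation mu := (@lebesgue_measure R).
Implicit Types e s t v tau : R.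

(** The factor of the integrand next to |zeta|^2, with ln(2 pi) replaced by a parameter. *)
Definition kerK tau v : R :=
  (cos (v * tau) * cosh (pi * v / 2) - sin (v * tau) * sinh (pi * v / 2))
  / cosh (pi * v).

(** With cos(pi / 2 / 2) = 1 / sqrt 2 this is sqrt 2 e^(tau/2) / (1 + e^(2 tau)). *)
Definition kerG tau : R :=
  2 * cos (pi / 2 / 2) * expR (tau / 2) / (1 + expR (2 * tau)).

Lemma cos_quarter : 0 < cos (pi / 2 / 2 : R) <= 1 /\ cos (pi / 2 / 2 : R) ^+ 2 = 2^-1
  /\ sin (pi / 2 / 2 : R) = cos (pi / 2 / 2).
Proof.
have p0 := pi_gt0 R; split; [|split].
- by rewrite cos_le1 andbT cos_gt0_pihalf//; lra.
- have := cos_mulr2n (pi / 2 / 2 : R).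
  rewrite (_ : (pi / 2 / 2) *+ 2 = pi / 2 :> R) ?cos_pihalf; last by rewrite mulr2n; field.
  by rewrite mulr2n; lra.
- by rewrite -cosBpihalf -[RHS]cosN; congr cos; field.
Qed.

Let k0 : 0 < cos (pi / 2 / 2 : R). Proof. by have [/andP[]] := cos_quarter. Qed.

Let k1 : cos (pi / 2 / 2 : R) <= 1. Proof. by have [/andP[]] := cos_quarter. Qed.

(** At th = pi / 2 the hyperbolic secant on the line becomes explicit in e^(t/2). *)
Lemma stripPQ_half t :
  stripP (pi / 2) t - stripQ (pi / 2) t = kerG t /\
  stripP (pi / 2) t + stripQ (pi / 2) t = kerG (- t).
Proof.
have [_ [k2 ks]] := cos_quarter.
rewrite /stripP /stripQ /kerG ks k2 /cosh /sinh !mulNr !mulrN.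
have -> : 2 * t = 4%:R * (t / 2) by field.
rewrite !expRN expRM_natl; move: (expR _) (expR_gt0 (t / 2)) (cos _) => u u0 c.
have u4 : 0 < 1 + u ^+ 4 by rewrite addr_gt0// exprn_gt0.
have u2 : 0 < u ^+ 2 by rewrite exprn_gt0.
by split; field; rewrite !gt_eqF//=; nra.
Qed.

Lemma kerG_bounds t : 0 <= kerG t <= 2.
Proof.
rewrite /kerG; have -> : 2 * t = 4%:R * (t / 2) by field.
rewrite expRM_natl; move: (expR _) (expR_gt0 (t / 2)) (cos _) k0 k1 => u u0 c c0 c1.
have u4 : 0 < 1 + u ^+ 4 by rewrite addr_gt0// exprn_gt0.
apply/andP; split; first by rewrite divr_ge0// ?mulr_ge0// ltW.
rewrite ler_pdivrMr//.
have h : c * u <= u by rewrite ler_piMl// ltW.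
have : u <= 1 + u ^+ 4.
  have := sqr_ge0 (u ^+ 2 - 2^-1); have := sqr_ge0 (u - 2^-1); nra.
lra.
Qed.

Definition kerG' t : R := cos (pi / 2 / 2) * expR (t / 2) * (1 - 3 * expR (2 * t)) / (1 + expR (2 * t)) ^+ 2.

Lemma der_kerG t : is_derive t 1 kerG (kerG' t).
Proof.
rewrite /kerG /kerG'; eapply der_eq; first by der; rewrite gt_eqF.
by field; rewrite gt_eqF.
Qed.

Lemma norm_kerG'_le t : `|kerG' t| <= 3.
Proof.
rewrite /kerG'; have -> : 2 * t = 4%:R * (t / 2) by field.
rewrite expRM_natl; move: (expR _) (expR_gt0 (t / 2)) (cos _) k0 k1 => u u0 c c0 c1.
have u4 : 0 < 1 + u ^+ 4 by rewrite addr_gt0// exprn_gt0.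
have u40 : 0 < u ^+ 4 by rewrite exprn_gt0.
apply: ler_norm_div; first by rewrite exprn_gt0.
have h1 : `|1 - 3 * u ^+ 4| <= 3 * (1 + u ^+ 4) by rewrite ler_norml; lra.
have h2 : `|c * u| <= 1 + u ^+ 4.
  rewrite ger0_norm ?mulr_ge0// ?ltW//.
  have h : c * u <= u by rewrite ler_piMl// ltW.
  have := sqr_ge0 (u ^+ 2 - 2^-1); have := sqr_ge0 (u - 2^-1); nra.
by apply: (le_trans (ler_normM h2 h1)); apply: le_of_eq; ring.
Qed.

Lemma kerG_lip s t : `|kerG t - kerG s| <= 3 * `|t - s|.
Proof.
wlog st : s t / s < t => [hw|].
  case: (ltgtP s t) => [|ts|->]; [exact: hw|rewrite distrC (distrC t); exact: hw|].
  by rewrite !subrr normr0 mulr0.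
have [x _||c _ ->] := @MVT R kerG kerG' s t st.
  exact: der_kerG.
  by apply: continuous_subspaceT => z; exact: is_derive_cont (der_kerG z).
by rewrite normrM ler_wpM2r// norm_kerG'_le.
Qed.

Lemma kerG_osc s t : `|kerG t - kerG s| <= 3 * Num.min `|t - s| 1.
Proof.
rewrite minEle; case: ifPn => _; first exact: kerG_lip.
have := kerG_bounds s; have := kerG_bounds t; rewrite ler_norml; lra.
Qed.

Lemma meas_kerG : measurable_fun setT kerG.
Proof. by rewrite /kerG; mf. Qed.

Let mkerGf (f : R -> R) : measurable_fun setT f ->
  measurable_fun setT (fun t => kerG (f t)).
Proof. by move=> mf; exact: measurableT_comp meas_kerG mf. Qed.

Let en n : 0 < (n.+1%:R^-1 : R) <= 1.
Proof. by rewrite invr_gt0 ltr0Sn /= invf_le1// ler1n. Qed.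

(** The kernels at tau - t and tau + t have total mass pi over t > 0, so the claim is that the
    integral against the differences to kerG tau tends to 0. It is dominated by
    [abelK_min], as [kerG] is bounded and Lipschitz. *)
Lemma abel_approx tau :
  \int[mu]_(t in `]0, +oo[) (abelK n.+1%:R^-1 (tau - t) * kerG t +
     abelK n.+1%:R^-1 (tau + t) * kerG (- t)) @[n --> \oo] --> pi * kerG tau.
Proof.
pose h n t : R := abelK n.+1%:R^-1 (tau - t) * (kerG t - kerG tau) +
     abelK n.+1%:R^-1 (tau + t) * (kerG (- t) - kerG tau).
pose b t : R := 3 * (abelK 1 (tau - t) + abelK 1 (tau + t)).
have mh n : measurable_fun setT (h n).
  rewrite /h /abelK; apply: measurable_funD; apply: measurable_funM; try mf.
  - exact: meas_kerG.
  - by apply: mkerGf; mf.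
have ib : mu.-integrable `]0, +oo[ (EFin \o b).
  by apply: integrableZR => //; have [] := int_abelK tau ltr01.
have one s : abelK 1 s = (1 + s ^+ 2)^-1 by rewrite /abelK expr1n mul1r.
have term n s t : abelK n.+1%:R^-1 s * `|kerG t - kerG tau| <= 3 * (1 + s ^+ 2)^-1
    \/ `|t - tau| != `|s|.
  case: (eqVneq `|t - tau| `|s|) => [E|]; [left|by right].
  apply: (@le_trans _ _ (abelK n.+1%:R^-1 s * (3 * Num.min `|t - tau| 1))).
    by rewrite ler_wpM2l ?kerG_osc// abelK_ge0// invr_ge0.
  rewrite mulrCA ler_wpM2l//; apply: abelK_min => //.
  by rewrite E ge_min lexx.
have hb n t : `|h n t| <= b t.
  rewrite /h /b [in leRHS]mulrDr !one; apply: (le_trans (ler_normD _ _)).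
  have A0 s : `|abelK n.+1%:R^-1 s| = abelK n.+1%:R^-1 s.
    by rewrite ger0_norm// abelK_ge0// invr_ge0.
  rewrite (normrM (abelK _ (tau - t))) (normrM (abelK _ (tau + t))) !A0.
  apply: lerD.
    by case: (term n (tau - t) t) => //; rewrite distrC eqxx.
  by case: (term n (tau + t) (- t)) => //; rewrite -opprD normrN addrC eqxx.
have lim0 s (g : R) : (s = 0 -> g = 0) -> abelK n.+1%:R^-1 s * g @[n --> \oo] --> 0.
  move=> sg; have [s0|s0] := eqVneq s 0.
    by rewrite sg//; under eq_fun do rewrite mulr0; exact: cvg_cst.
  have e0 : (n.+1%:R^-1 : R) @[n --> \oo] --> (0 : R) by exact: cvg_harmonic.
  rewrite -[X in _ --> X](mul0r g); apply: cvgMl.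
  rewrite -[X in _ --> X](mul0r ((0 ^+ 2 + s ^+ 2)^-1)); apply: cvgM => //.
  apply: cvgV; first by rewrite expr0n add0r expf_neq0.
  apply: cvgD; last exact: cvg_cst.
  by rewrite expr2; apply: cvgM.
have hlim t : h n t @[n --> \oo] --> 0.
  rewrite -[X in _ --> X]addr0; apply: cvgD; apply: lim0 => E.
    by rewrite (_ : t = tau) ?subrr//; lra.
  by rewrite (_ : - t = tau) ?subrr//; lra.
have mi : measurable (`]0, +oo[ : set R) by exact: measurable_itv.
have [|_ L] := @Rdominated_cvg _ _ _ mu `]0, +oo[ h (fun=> 0) b mi
   (fun n => measurable_funTS (mh n)) (fun x _ => hlim x) ib.
  by move=> n t _.
have ih n : mu.-integrable `]0, +oo[ (EFin \o h n).
  by apply: (le_integrableR _ _ ib) => //; apply: measurable_funTS; exact: mh.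
rewrite (_ : (fun n => _) = (fun n => \int[mu]_(t in `]0, +oo[) h n t + pi * kerG tau)).
  rewrite -[X in _ --> X]add0r; apply: cvgD; last exact: cvg_cst.
  have I0 : \int[mu]_(t in `]0, +oo[) (0 : R) = 0 by rewrite /Rintegral integral0.
  by rewrite I0 in L.
apply/funext => n; have /andP[n0 n1] := en n.
have [iA vA] := int_abelK tau n0.
rewrite -vA mulrC -RintegralZl// -RintegralD//; last exact: integrableZR.
by apply: eq_RintegralR => t _; rewrite /h; ring.
Qed.

End kernel_inversion.

Section kernel_transform.
Variable R : realType.
Notation mu := (@lebesgue_measure R).
Implicit Types e s t v tau : R.

Lemma sech_weight v : 0 < v ->
  `|cosh (pi * v / 2) / cosh (pi * v)| <= 2 * expR (- (pi * v / 2)) /\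
  `|sinh (pi * v / 2) / cosh (pi * v)| <= 2 * expR (- (pi * v / 2)).
Proof.
move=> v0; have pv : 0 < pi * v by rewrite mulr_gt0// pi_gt0.
have C0 := cosh_gt0 (pi * v).
have h : cosh (pi * v / 2) <= 2 * expR (- (pi * v / 2)) * cosh (pi * v).
  have c1 := cosh_ge_exp (pi * v).
  have E : expR (pi * v) = expR (pi * v / 2) * expR (pi * v / 2).
    by rewrite -expRD; congr expR; field.
  rewrite E in c1.
  apply: (@le_trans _ _ (expR (pi * v / 2))).
    have : expR (- (pi * v / 2)) <= expR (pi * v / 2) by rewrite ler_expR; lra.
    rewrite /cosh; lra.
  rewrite expRN; have e0 := expR_gt0 (pi * v / 2).
  rewrite [leRHS]mulrAC ler_pdivlMr//; lra.
have hs := norm_sinh_le (pi * v / 2).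
split; apply: ler_norm_div => //; last exact: le_trans hs h.
by rewrite ger0_norm// ltW// cosh_gt0.
Qed.

Lemma poly_exp_weight v : 0 < v ->
  (1 + v ^+ 2) * (4 * expR (- (pi * v / 2))) <= 68 * expR (- (2^-1 * v)).
Proof.
move=> v0; have e1 : expR (- (pi * v / 2)) <= expR (- v).
  rewrite ler_expR lerN2; have := pi_ge2 R; nra.
have e0 := expR_gt0 (v / 4).
have h1 : v <= 4 * expR (v / 4) by have := expR_ge1Dx (v / 4); lra.
have h2 : v ^+ 2 <= 16 * expR (v / 4) ^+ 2.
  have -> : 16 * expR (v / 4) ^+ 2 = (4 * expR (v / 4)) ^+ 2 by ring.
  by rewrite ler_pXn2r// nnegrE; lra.
have E : 1 <= expR (v / 4) by have := expR_ge1Dx (v / 4); lra.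
have h3 : 1 + v ^+ 2 <= 17 * expR (v / 4) ^+ 2.
  have : 1 <= expR (v / 4) ^+ 2 by rewrite expr_ge1// ltW.
  lra.
apply: (@le_trans _ _ (17 * expR (v / 4) ^+ 2 * (4 * expR (- v)))).
  apply: ler_pM => //; first by rewrite addr_ge0// sqr_ge0.
  by rewrite ler_pM2l.
apply: le_of_eq; rewrite -expRM_natl mulrACA -expRD.
by congr (_ * expR _); [ring|field].
Qed.

(** A majorant of (1 + v^2) [kerK tau v], from |kerK tau v| <= 4 e^(-v) and
    1 + v^2 <= 17 e^(v/2). *)
Definition kerW v : R := 68 * expR (- (2^-1 * v)).

Lemma kerW_int : mu.-integrable `]0, +oo[ (EFin \o kerW).
Proof. by apply: integrable_expN; rewrite invr_gt0. Qed.

Lemma trig_combo_bound (c s v m : R) : 0 < v -> `|c| <= 1 -> `|s| <= 1 ->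
  `|m| <= 1 + v ^+ 2 ->
  `|m * ((c * cosh (pi * v / 2) - s * sinh (pi * v / 2)) / cosh (pi * v))| <= kerW v.
Proof.
move=> v0 c1 s1 m1; have [h1 h2] := sech_weight v0.
apply: le_trans (poly_exp_weight v0); apply: ler_normM => //.
rewrite mulrBl -(mulrA c) -(mulrA s); apply: (le_trans (ler_normB _ _)).
have := ler_normM c1 h1; have := ler_normM s1 h2; rewrite !mul1r => g1 g2; lra.
Qed.

Lemma kerK_bound tau v m : 0 < v -> `|m| <= 1 + v ^+ 2 -> `|m * kerK tau v| <= kerW v.
Proof.
by move=> v0; apply: trig_combo_bound => //; [exact: cos_max|exact: sin_max].
Qed.

Lemma meas_kerK tau : measurable_fun setT (kerK tau).
Proof. by rewrite /kerK; mf. Qed.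

Lemma kerK_int tau (m : R -> R) : measurable_fun setT m ->
  (forall v, 0 < v -> `|m v| <= 1 + v ^+ 2) ->
  mu.-integrable `]0, +oo[ (EFin \o (fun v => m v * kerK tau v)).
Proof.
move=> mm mb; apply: (le_integrableR _ _ kerW_int) => //.
  by apply: measurable_funTS; apply: measurable_funM => //; exact: meas_kerK.
by move=> v; rewrite /= in_itv /= andbT => v0; apply: kerK_bound => //; exact: mb.
Qed.

Lemma cos_quarter_sq : cos (pi / 2 / 2 : R) ^+ 2 = 2^-1.
Proof. by have [_ []] := @cos_quarter R. Qed.

Lemma strip_half_bound t : `|stripP (pi / 2) t| <= 4 * expR (- (2^-1 * t)) /\
                 `|stripQ (pi / 2) t| <= 4 * expR (- (2^-1 * t)).
Proof.
have D0 : 0 < sinh (t / 2) ^+ 2 + cos (pi / 2 / 2 : R) ^+ 2.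
  by rewrite cos_quarter_sq// ltr_wpDl ?sqr_ge0// invr_gt0.
have CV := coshV_le (t / 2); have C0 := cosh_gt0 (t / 2).
have [||||||||h1 h2 _ _] := @strip_bounds R (sinh (t / 2)) (cosh (t / 2))
   (cos (pi / 2 / 2)) (sin (pi / 2 / 2)) 2 (sinh (t / 2) ^+ 2 + cos (pi / 2 / 2 : R) ^+ 2) => //.
- exact: cosh_ge1.
- exact: norm_sinh_le.
- exact: cos_max.
- exact: sin_max.
- by rewrite cos_quarter_sq cosh2; have := sqr_ge0 (sinh (t / 2)); lra.
have E : 2 / cosh (t / 2) / 2 <= 4 * expR (- (2^-1 * t)).
  have -> : 2^-1 * t = t / 2 by rewrite mulrC.
  by have := expR_gt0 (- (t / 2)); lra.
by split; apply: le_trans E.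
Qed.

Lemma half_weight_int : mu.-integrable `]0, +oo[ (EFin \o (fun t : R => 8 * expR (- (2^-1 * t)))).
Proof. by apply: integrable_expN; rewrite invr_gt0. Qed.

Lemma cos_stripP_int v : mu.-integrable `]0, +oo[ (EFin \o (fun t => cos (v * t) * stripP (pi / 2) t)).
Proof.
apply: (le_integrableR (measurable_pos R) _ half_weight_int); first by apply: measurable_funTS; rewrite /stripP; mf.
move=> t _; have [bP _] := strip_half_bound t; have := ler_normM (cos_max (v * t)) bP.
by have := expR_gt0 (- (2^-1 * t)); lra.
Qed.

Lemma sin_stripQ_int v : mu.-integrable `]0, +oo[ (EFin \o (fun t => sin (v * t) * stripQ (pi / 2) t)).
Proof.
apply: (le_integrableR (measurable_pos R) _ half_weight_int); first by apply: measurable_funTS; rewrite /stripQ; mf.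
move=> t _; have [_ bQ] := strip_half_bound t; have := ler_normM (sin_max (v * t)) bQ.
by have := expR_gt0 (- (2^-1 * t)); lra.
Qed.

Section abel_sides.
Variables (tau e : R).
Hypothesis e0 : 0 < e.

Definition abel_integrand (z : R * R) : R := expR (- (e * z.1)) *
   (cos (z.1 * tau) * (cos (z.1 * z.2) * stripP (pi / 2) z.2)
    - sin (z.1 * tau) * (sin (z.1 * z.2) * stripQ (pi / 2) z.2)).

Lemma exp_e_int : mu.-integrable `]0, +oo[ (EFin \o (fun v => 1 * expR (- (e * v)))).
Proof. exact: integrable_expN. Qed.

Lemma abel_fubini :
  \int[mu]_(v in `]0, +oo[) \int[mu]_(t in `]0, +oo[) abel_integrand (v, t) =
  \int[mu]_(t in `]0, +oo[) \int[mu]_(v in `]0, +oo[) abel_integrand (v, t).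
Proof.
have mh : measurable_fun setT abel_integrand by rewrite /abel_integrand /stripP /stripQ; mf.
have hb v t : `]0, +oo[%classic v -> `]0, +oo[%classic t ->
    `|abel_integrand (v, t)| <= 1 * expR (- (e * v)) * (8 * expR (- (2^-1 * t))).
  move=> _ _; rewrite /abel_integrand /= mul1r; apply: ler_normM.
    by rewrite ger0_norm// expR_ge0.
  have [bP bQ] := strip_half_bound t.
  have := ler_normM (cos_max (v * tau)) (ler_normM (cos_max (v * t)) bP).
  have := ler_normM (sin_max (v * tau)) (ler_normM (sin_max (v * t)) bQ).
  rewrite !mul1r => h1 h2; apply: (le_trans (ler_normB _ _)); lra.
have [_ _ F1 F2] := @Rfubini _ _ _ _ R mu mu _ _ abel_integrand _ _ (measurable_pos R) (measurable_pos R) mh exp_e_int half_weight_int hb.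
exact: etrans F1 (esym F2).
Qed.

Lemma exp_kerK_int : mu.-integrable `]0, +oo[ (EFin \o (fun v => expR (- (e * v)) * kerK tau v)).
Proof.
apply: kerK_int; first by mf.
move=> v v0; rewrite ger0_norm ?expR_ge0// (@le_trans _ _ 1)//.
  by rewrite expR_le1 oppr_le0 mulr_ge0// ltW.
by rewrite lerDl sqr_ge0.
Qed.

Lemma abel_left : \int[mu]_(v in `]0, +oo[) \int[mu]_(t in `]0, +oo[) abel_integrand (v, t) =
    pi / 2 * \int[mu]_(v in `]0, +oo[) (expR (- (e * v)) * kerK tau v).
Proof.
rewrite -(RintegralZl _ (measurable_pos R) exp_kerK_int).
apply: eq_RintegralR => v _; rewrite /abel_integrand /=.
have [hA hB] := stripAB_half v.
have i1 := integrableZR (cos (v * tau)) (measurable_pos R) (cos_stripP_int v).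
have i2 := integrableZR (sin (v * tau)) (measurable_pos R) (sin_stripQ_int v).
rewrite (RintegralZl _ (measurable_pos R) (integrableDR (measurable_pos R) i1 (integrableNR (measurable_pos R) i2))).
rewrite (RintegralB (measurable_pos R) i1 i2) (RintegralZl _ (measurable_pos R) (cos_stripP_int v)) (RintegralZl _ (measurable_pos R) (sin_stripQ_int v)).
rewrite -/(stripA v (pi / 2)) -/(stripB v (pi / 2)) hA hB /kerK.
by have C0 := cosh_gt0 (pi * v); field; rewrite gt_eqF.
Qed.

Lemma abel_kerG_int : mu.-integrable `]0, +oo[ (EFin \o (fun t => abelK e (tau - t) * kerG t +
     abelK e (tau + t) * kerG (- t))).
Proof.
have [iA _] := int_abelK tau e0.
apply: (le_integrableR (measurable_pos R) _ (integrableZR 2 (measurable_pos R) iA)).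
  rewrite /abelK; apply: measurable_funTS; apply: measurable_funD; apply: measurable_funM; try mf.
  - exact: meas_kerG.
  - by apply: (measurableT_comp (@meas_kerG R)); mf.
move=> t _; have /andP[g1 g2] := kerG_bounds t; have /andP[g3 g4] := kerG_bounds (- t).
have a1 := @abelK_ge0 R e (tau - t) (ltW e0); have a2 := @abelK_ge0 R e (tau + t) (ltW e0).
rewrite ger0_norm; last by rewrite addr_ge0// mulr_ge0.
by rewrite mulrDr; apply: lerD; rewrite mulrC; apply: ler_wpM2r.
Qed.

Lemma abel_right : \int[mu]_(t in `]0, +oo[) \int[mu]_(v in `]0, +oo[) abel_integrand (v, t) =
    2^-1 * \int[mu]_(t in `]0, +oo[) (abelK e (tau - t) * kerG t +
     abelK e (tau + t) * kerG (- t)).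
Proof.
rewrite -(RintegralZl _ (measurable_pos R) abel_kerG_int).
apply: eq_RintegralR => t _; rewrite /abel_integrand /=.
have ic s : mu.-integrable `]0, +oo[ (EFin \o (fun v => expR (- (e * v)) * cos (v * s))).
  apply: (le_integrableR (measurable_pos R) _ exp_e_int); first by apply: measurable_funTS; mf.
  move=> v _; rewrite mul1r normrM ger0_norm ?expR_ge0// ler_piMr ?expR_ge0//.
  exact: cos_max.
have [<- <-] := stripPQ_half t.
transitivity (2^-1 * ((stripP (pi / 2) t - stripQ (pi / 2) t) * abelK e (tau - t)
  + (stripP (pi / 2) t + stripQ (pi / 2) t) * abelK e (tau + t))); last by ring.
rewrite -(int_exp_cos (tau - t) e0) -(int_exp_cos (tau + t) e0).
have i1 := integrableZR (stripP (pi / 2) t - stripQ (pi / 2) t) (measurable_pos R) (ic (tau - t)).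
have i2 := integrableZR (stripP (pi / 2) t + stripQ (pi / 2) t) (measurable_pos R) (ic (tau + t)).
rewrite -(RintegralZl _ (measurable_pos R) (ic (tau - t))) -(RintegralZl _ (measurable_pos R) (ic (tau + t))).
rewrite -(RintegralD (measurable_pos R) i1 i2) -(RintegralZl _ (measurable_pos R) (integrableDR (measurable_pos R) i1 i2)).
apply: eq_RintegralR => v _.
by rewrite (mulrBr v) (mulrDr v) cosB cosD; field.
Qed.

(** Both sides evaluate one double integral: over t first it produces the transforms
    [stripAB_half], over v first the Laplace transforms [int_exp_cos]. *)
Lemma abel_kerK :
  \int[mu]_(v in `]0, +oo[) (expR (- (e * v)) * kerK tau v) =
  pi^-1 * \int[mu]_(t in `]0, +oo[) (abelK e (tau - t) * kerG t +
     abelK e (tau + t) * kerG (- t)).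
Proof.
have F := etrans (esym abel_left) (etrans abel_fubini abel_right).
move: F (gt_eqF (pi_gt0 R)) => /[swap].
move: (Rintegral _ _ _) (Rintegral _ _ _) (pi : R) => A B p /negbT p0 F.
have -> : B = 2 / p * (p / 2 * B) by field.
by rewrite F; field.
Qed.

End abel_sides.

(** Let e tend to 0 in [abel_kerK]; the right side converges by [abel_approx]. *)
Lemma int_kerK tau : \int[mu]_(v in `]0, +oo[) kerK tau v = kerG tau.
Proof.
pose f n v : R := expR (- (n.+1%:R^-1 * v)) * kerK tau v.
have mf n : measurable_fun setT (f n) by apply: measurable_funM; [mf|exact: meas_kerK].
have cf (v : R) : f n v @[n --> \oo] --> kerK tau v.
  rewrite -[X in _ --> X]mul1r; apply: cvgMl.
  have c : {for (0 : R), continuous (fun x : R => expR (- (x * v)))}.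
    by eapply is_derive_cont; der.
  have E : expR (- (0 * v)) = 1 by rewrite mul0r oppr0 expR0.
  rewrite -[X in _ --> X]E; apply: (@cvg_comp _ _ _ (fun n : nat => n.+1%:R^-1 : R)
    (fun x : R => expR (- (x * v))) _ _ _ _ c).
  exact: cvg_harmonic.
have fb n (v : R) : `]0, +oo[%classic v -> `|f n v| <= kerW v.
  rewrite /= in_itv /= andbT => v0; apply: kerK_bound => //.
  rewrite ger0_norm ?expR_ge0// (@le_trans _ _ 1)//; last by rewrite lerDl sqr_ge0.
  by rewrite expR_le1 oppr_le0 mulr_ge0// ?ltW// invr_ge0.
have [_ L] := @Rdominated_cvg _ _ _ mu `]0, +oo[ f (kerK tau) kerW (measurable_pos R)
   (fun n => measurable_funTS (mf n)) (fun v _ => cf v) kerW_int fb.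
apply: (cvg_unique _ L) => //.
rewrite (_ : (fun n => _) = (fun n => pi^-1 * \int[mu]_(t in `]0, +oo[)
    (abelK n.+1%:R^-1 (tau - t) * kerG t + abelK n.+1%:R^-1 (tau + t) * kerG (- t)))).
  rewrite (_ : kerG tau = pi^-1 * (pi * kerG tau)); last first.
    by rewrite mulKf// gt_eqF// pi_gt0.
  by apply: cvgMr; exact: abel_approx.
by apply/funext => n; rewrite /f abel_kerK// invr_gt0.
Qed.

End kernel_transform.

(** * The weighted kernel *)

Section kernel_derivatives.
Variable R : realType.
Notation mu := (@lebesgue_measure R).
Implicit Types tau v : R.

(** Up to the factor - v, the derivative of [kerK] in tau. *)
Definition kerK1 tau v : R :=
  (sin (v * tau) * cosh (pi * v / 2) + cos (v * tau) * sinh (pi * v / 2))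
  / cosh (pi * v).

(** kerG / 4 minus the second derivative of kerG. *)
Definition wkerG tau : R := 4 * cos (pi / 2 / 2) * (expR (tau / 2) * expR (2 * tau))
  * (3 - expR (2 * tau)) / (1 + expR (2 * tau)) ^+ 3.

Lemma kerK1_bound tau v m : 0 < v -> `|m| <= 1 + v ^+ 2 ->
  `|m * kerK1 tau v| <= kerW v.
Proof.
move=> v0 mb; have := @trig_combo_bound R (sin (v * tau)) (- cos (v * tau)) v m v0.
rewrite mulNr opprK; apply => //; rewrite ?normrN; [exact: sin_max|exact: cos_max].
Qed.

Lemma der_kerK v tau : is_derive tau 1 (fun tau => kerK tau v) (- v * kerK1 tau v).
Proof.
have C0 := cosh_gt0 (pi * v); rewrite /kerK /kerK1; eapply der_eq; first by der; rewrite gt_eqF.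
by field; rewrite gt_eqF.
Qed.

Lemma der_kerK1 v tau : is_derive tau 1 (fun tau => - v * kerK1 tau v) (- v ^+ 2 * kerK tau v).
Proof.
have C0 := cosh_gt0 (pi * v); rewrite /kerK /kerK1; eapply der_eq; first by der; rewrite gt_eqF.
by field; rewrite gt_eqF.
Qed.

Lemma kerK1_int tau :
  mu.-integrable `]0, +oo[ (EFin \o (fun v => - v * kerK1 tau v)).
Proof.
apply: (le_integrableR (measurable_pos R) _ (kerW_int R)).
  by apply: measurable_funTS; rewrite /kerK1; mf.
move=> v; rewrite /= in_itv /= andbT => v0; apply: kerK1_bound => //.
rewrite normrN gtr0_norm//; have := sqr_ge0 (v - 2^-1); nra.
Qed.

Lemma int_kerK1 tau :
  \int[mu]_(v in `]0, +oo[) (- v * kerK1 tau v) = kerG' tau.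
Proof.
have D : is_derive tau 1 (fun x => \int[mu]_(v in `]0, +oo[) kerK x v)
    (\int[mu]_(v in `]0, +oo[) (- v * kerK1 tau v)).
  refine (@is_derive_under_integral _ _ _ mu `]0, +oo[ (@kerK R)
     (fun x v => - v * kerK1 x v) tau (tau - 1) (tau + 1) _ _ _ _ _ (kerW_int R) _).
  - exact: measurable_pos.
  - lra.
  - move=> x _; have := @kerK_int R x (fun=> 1) (measurable_cst _).
    have h v : 0 < v -> `|1| <= 1 + v ^+ 2 by rewrite normr1 lerDl sqr_ge0.
    move=> /(_ h); apply: eq_integrableR; first exact: measurable_pos.
    by move=> v _; rewrite mul1r.
  - by move=> x v _ _; exact: der_kerK.
  - move=> x v _; rewrite /= in_itv /= andbT => v0; apply: kerK1_bound => //.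
    by rewrite normrN gtr0_norm//; have := sqr_ge0 (v - 2^-1); nra.
have E : (fun x => \int[mu]_(v in `]0, +oo[) kerK x v) = @kerG R.
  by apply/funext => x; exact: int_kerK.
rewrite E in D; rewrite -(@derive_val _ _ _ _ _ _ _ D).
exact: (@derive_val _ _ _ _ _ _ _ (der_kerG tau)).
Qed.

Lemma int_kerK2 tau :
  \int[mu]_(v in `]0, +oo[) (- v ^+ 2 * kerK tau v) = kerG tau / 4 - wkerG tau.
Proof.
have D : is_derive tau 1 (fun x => \int[mu]_(v in `]0, +oo[) (- v * kerK1 x v))
    (\int[mu]_(v in `]0, +oo[) (- v ^+ 2 * kerK tau v)).
  refine (@is_derive_under_integral _ _ _ mu `]0, +oo[ (fun x v => - v * kerK1 x v)
     (fun x v => - v ^+ 2 * kerK x v) tau (tau - 1) (tau + 1) _ _ _ _ _ (kerW_int R) _).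
  - exact: measurable_pos.
  - lra.
  - by move=> x _; exact: kerK1_int.
  - by move=> x v _ _; exact: der_kerK1.
  - move=> x v _; rewrite /= in_itv /= andbT => v0; apply: kerK_bound => //.
    by rewrite normrN ger0_norm ?sqr_ge0// lerDr.
have E : (fun x => \int[mu]_(v in `]0, +oo[) (- v * kerK1 x v)) = @kerG' R.
  by apply/funext => x; exact: int_kerK1.
have Q0 : 0 < 1 + expR (2 * tau) by rewrite addr_gt0// expR_gt0.
have D' : is_derive tau 1 (@kerG' R) (kerG tau / 4 - wkerG tau).
  rewrite /kerG' /kerG /wkerG; eapply der_eq; first by der; rewrite gt_eqF// exprn_gt0.
  by field; rewrite gt_eqF.
rewrite E in D; rewrite -(@derive_val _ _ _ _ _ _ _ D).
exact: (@derive_val _ _ _ _ _ _ _ D').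
Qed.

(** Differentiating [int_kerK] twice in tau multiplies the integrand by - v^2. *)
Lemma int_weighted_kerK tau : \int[mu]_(v in `]0, +oo[)
  ((4^-1 + v ^+ 2) * kerK tau v) = wkerG tau.
Proof.
have i0 := @kerK_int R tau (fun=> 4^-1) (measurable_cst _).
have {}i0 : mu.-integrable `]0, +oo[ (EFin \o (fun v => 4^-1 * kerK tau v)).
  by apply: i0 => v _; rewrite ger0_norm//; have := sqr_ge0 v; lra.
have i1 : mu.-integrable `]0, +oo[ (EFin \o (fun v => - v ^+ 2 * kerK tau v)).
  by apply: kerK_int; [mf|move=> v _; rewrite normrN ger0_norm ?sqr_ge0// lerDr].
have i2 : mu.-integrable `]0, +oo[ (EFin \o (fun v => 1 * kerK tau v)).
  by apply: kerK_int; [mf|move=> v _; rewrite normr1 lerDl sqr_ge0].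
have {}i2 : mu.-integrable `]0, +oo[ (EFin \o kerK tau).
  by apply: eq_integrableR i2; [exact: measurable_pos|move=> v _; rewrite mul1r].
transitivity (\int[mu]_(v in `]0, +oo[) (4^-1 * kerK tau v - - v ^+ 2 * kerK tau v)).
  by apply: eq_RintegralR => v _; ring.
rewrite (RintegralB (measurable_pos R) i0 i1) int_kerK2.
by rewrite (RintegralZl _ (measurable_pos R) i2) int_kerK; field.
Qed.

End kernel_derivatives.

(** * The double integral over fractional parts *)

Section double_integral.
Variable R : realType.
Notation mu := (@lebesgue_measure R).
Implicit Types x y v : R.

Definition Psi x : R := fract x * expR (- (3 / 2 * ln x)).

Lemma sqrt_expR x : 0 < x -> Num.sqrt x = expR (ln x / 2).
Proof.
move=> x0; have e0 := expR_ge0 (ln x / 2).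
rewrite -[LHS](_ : Num.sqrt (expR (ln x / 2) ^+ 2) = _); first by rewrite sqrtr_sqr ger0_norm.
congr Num.sqrt; rewrite -expRM_natl (_ : 2 * (ln x / 2) = ln x); last by field.
by rewrite lnK.
Qed.

(** A majorant of Psi with an elementary primitive: {x} is at most both 1 and x, hence
   at most 2 x / (1 + x). *)
Let weight x := 2 * expR (- (ln x / 2)) / (1 + x).

Lemma Psi_weight_int : mu.-integrable `]0, +oo[ (EFin \o weight).
Proof.
pose F x := 4 * atan (Num.sqrt x).
have dF x : 0 < x -> is_derive x 1 F (weight x).
  move=> x0; have s := is_derive1_sqrt x0.
  apply: (der_eq (der_mul (der_cst x 4) (der_comp s (is_derive1_atan _)))).
  rewrite /weight sqr_sqrtr ?ltW// sqrt_expR// expRN.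
  by have := expR_gt0 (ln x / 2) => e0; field; rewrite !gt_eqF//; lra.
refine (@integrable_oy R weight F 0 0 (4 * (pi / 2)) _ _ _ _ _ _).
- move=> x x0; eapply is_derive_cont; rewrite /weight; der => //.
  by rewrite gt_eqF//; lra.
- by rewrite /weight; mf.
- have F0 : F 0 = 0 by rewrite /F sqrtr0 atan0 mulr0.
  rewrite -[X in _ --> X]F0; apply: cvg_at_right_filter; apply: cvgMr.
  by apply: (@continuous_comp _ _ _ (@Num.sqrt R) (@atan R));
    [exact: sqrt_continuous|exact: continuous_atan].
- apply: cvgMr; apply: (@cvg_comp _ _ _ (@Num.sqrt R) (@atan R)); last exact: cvgy_atan.
  apply/cvgryPge => A; near=> x.
  apply: (@le_trans _ _ `|A|); first exact: ler_norm.
  rewrite -sqrtr_sqr ler_sqrt//; near: x; exact: nbhs_pinfty_ge.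
- move=> x x0; rewrite divr_ge0// ?mulr_ge0 ?expR_ge0//; lra.
Unshelve. all: by end_near. Qed.

Lemma Psi_ge0 x : 0 <= Psi x.
Proof. by rewrite mulr_ge0 ?fract_ge0 ?expR_ge0. Qed.

Lemma fract_le x : 0 < x -> fract x <= x.
Proof.
by move=> x0; rewrite /fract lerBlDr lerDl ler0z floor_ge0 ltW.
Qed.

Lemma meas_Psi : measurable_fun setT Psi.
Proof. by rewrite /Psi; mf. Qed.

Lemma Psi_int : mu.-integrable `]0, +oo[ (EFin \o Psi).
Proof.
apply: (le_integrableR (measurable_pos R) _ Psi_weight_int).
  exact: measurable_funTS meas_Psi.
move=> x; rewrite /= in_itv /= andbT => x0.
rewrite (ger0_norm (Psi_ge0 x)) /Psi /weight.
have -> : expR (- (3 / 2 * ln x)) = expR (- (ln x / 2)) / x.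
  have ex : expR (ln x) = x by rewrite lnK.
  rewrite (_ : expR (- (ln x / 2)) / x = expR (- (ln x / 2)) / expR (ln x)); last by rewrite ex.
  by rewrite -expRB; congr expR; field.
have e0 := expR_gt0 (- (ln x / 2)).
have f1 := fract_le1 x; have f2 := fract_le x0.
have x1 : 0 < 1 + x by lra.
have -> : fract x * (expR (- (ln x / 2)) / x) = expR (- (ln x / 2)) * (fract x / x).
  by ring.
have -> : 2 * expR (- (ln x / 2)) / (1 + x) = expR (- (ln x / 2)) * (2 / (1 + x)).
  by ring.
rewrite ler_pM2l// ler_pdivrMr// mulrAC ler_pdivlMr//; nra.
Qed.

(** [Psi_cos] - i [Psi_sin] is the integral of {x} x^(-s-1) at s = 1/2 + iv. *)
Definition Psi_cos v := \int[mu]_(x in `]0, +oo[) (Psi x * cos (v * ln x)).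
Definition Psi_sin v := \int[mu]_(x in `]0, +oo[) (Psi x * sin (v * ln x)).

Lemma Psi_cos_int v : mu.-integrable `]0, +oo[ (EFin \o (fun x => Psi x * cos (v * ln x))).
Proof.
apply: (le_integrableR (measurable_pos R) _ Psi_int).
  by apply: measurable_funTS; rewrite /Psi; mf.
move=> x _; rewrite normrM (ger0_norm (Psi_ge0 x)) ler_piMr ?Psi_ge0//.
exact: cos_max.
Qed.

Lemma Psi_sin_int v : mu.-integrable `]0, +oo[ (EFin \o (fun x => Psi x * sin (v * ln x))).
Proof.
apply: (le_integrableR (measurable_pos R) _ Psi_int).
  by apply: measurable_funTS; rewrite /Psi; mf.
move=> x _; rewrite normrM (ger0_norm (Psi_ge0 x)) ler_piMr ?Psi_ge0//.
exact: sin_max.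
Qed.

Lemma wkerG_bound tau : `|wkerG tau| <= \int[mu]_(v in `]0, +oo[) kerW v.
Proof.
have mi := measurable_pos R.
have i : mu.-integrable `]0, +oo[ (EFin \o (fun v => (4^-1 + v ^+ 2) * kerK tau v)).
  apply: kerK_int; first by mf.
  by move=> v _; have := sqr_ge0 v => h; rewrite ger0_norm; lra.
rewrite -int_weighted_kerK; apply: (le_trans (le_normr_Rintegral mi i)).
apply: (le_RintegralR mi (integrable_norm i) (kerW_int R)) => v.
rewrite /= in_itv /= andbT => v0; apply: kerK_bound => //.
by have := sqr_ge0 v => h; rewrite ger0_norm; lra.
Qed.

Lemma kerK_shift (L s v : R) :
  kerK (L + s) v = cos (v * s) * kerK L v - sin (v * s) * kerK1 L v.
Proof. by rewrite /kerK /kerK1 (mulrDr v) cosD sinD; ring. Qed.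

Section double_integral_fubini.
Variable L : R.

Definition Psi2 (z : R * R) : R := Psi z.1 * Psi z.2.

(** The double integral of Psi x Psi y against a bounded function, in either order. *)
Lemma Psi2_fubini (phi : R * R -> R) (c : R) : measurable_fun setT phi ->
  (forall z, `|phi z| <= c) ->
  [/\ (mu \x mu)%E.-integrable (`]0, +oo[ `*` `]0, +oo[) (EFin \o (fun z => Psi2 z * phi z)),
    \int[mu]_(x in `]0, +oo[) \int[mu]_(y in `]0, +oo[) (Psi2 (x, y) * phi (x, y)) =
    \int[(mu \x mu)%E]_(z in `]0, +oo[ `*` `]0, +oo[) (Psi2 z * phi z) &
    \int[mu]_(y in `]0, +oo[) \int[mu]_(x in `]0, +oo[) (Psi2 (x, y) * phi (x, y)) =
    \int[(mu \x mu)%E]_(z in `]0, +oo[ `*` `]0, +oo[) (Psi2 z * phi z)].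
Proof.
move=> mphi phic; have mi := measurable_pos R.
have mh : measurable_fun setT (fun z => Psi2 z * phi z).
  by rewrite /Psi2 /Psi; mf.
have hb x y : `]0, +oo[%classic x -> `]0, +oo[%classic y ->
    `|Psi2 (x, y) * phi (x, y)| <= (c * Psi x) * Psi y.
  move=> _ _; rewrite /Psi2 /= normrM mulrC -mulrA; apply: ler_pM => //.
  by rewrite ger0_norm// mulr_ge0// Psi_ge0.
have [h1 _ h2 h3] := @Rfubini _ _ _ _ R mu mu _ _ _ _ _ mi mi mh
  (integrableZR c mi Psi_int) Psi_int hb.
by [].
Qed.

Lemma Psi_transform_bound v : `|Psi_cos v| <= \int[mu]_(x in `]0, +oo[) Psi x /\
  `|Psi_sin v| <= \int[mu]_(x in `]0, +oo[) Psi x.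
Proof.
have mi := measurable_pos R.
split.
  apply: (le_trans (le_normr_Rintegral mi (Psi_cos_int v))).
  apply: (le_RintegralR mi (integrable_norm (Psi_cos_int v)) Psi_int) => x _ /=.
  rewrite normrM (ger0_norm (Psi_ge0 x)) ler_piMr ?Psi_ge0//; exact: cos_max.
apply: (le_trans (le_normr_Rintegral mi (Psi_sin_int v))).
apply: (le_RintegralR mi (integrable_norm (Psi_sin_int v)) Psi_int) => x _ /=.
rewrite normrM (ger0_norm (Psi_ge0 x)) ler_piMr ?Psi_ge0//; exact: sin_max.
Qed.

Lemma measurable_transform (tr : R -> R) : continuous tr -> (forall x, `|tr x| <= 1) ->
  measurable_fun setT (fun v => \int[mu]_(x in `]0, +oo[) (Psi x * tr (v * ln x))).
Proof.
move=> ctr tr1; apply: continuous_measurable_fun => a.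
have b v x : `|Psi x * tr (v * ln x)| <= Psi x.
  by rewrite normrM (ger0_norm (Psi_ge0 x)) ler_piMr ?Psi_ge0.
have ii v : mu.-integrable `]0, +oo[ (EFin \o (fun x => Psi x * tr (v * ln x))).
  apply: (le_integrableR (measurable_pos R) _ Psi_int); last by move=> x _; exact: b.
  apply: measurable_funTS; apply: measurable_funM; first exact: meas_Psi.
  by apply: meas_comp => //; mf.
have cf : {ae mu, forall x, `]0, +oo[%classic x ->
    {in (`]a - 1, a + 1[%classic : set R), continuous (fun v => Psi x * tr (v * ln x))}}.
  apply: aeW => x _ v _; apply: (@cvgM _ _ _ _ (fun=> Psi x)); first exact: cvg_cst.
  apply: (@cvg_comp _ _ _ (fun v => v * ln x) tr); last exact: ctr.
  by apply: cvgMl; exact: cvg_id.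
apply: (@continuity_under_integral R _ _ mu (fun v x => Psi x * tr (v * ln x)) `]0, +oo[
  (measurable_pos R) (a - 1) (a + 1) (fun v _ => ii v) cf Psi Psi_int).
  by move=> v _; apply: aeW => x _; exact: b.
by rewrite inE /= in_itv /=; lra.
Qed.

Lemma meas_Psi_cos : measurable_fun setT Psi_cos.
Proof. by apply: measurable_transform; [exact: continuous_cos|exact: cos_max]. Qed.

Lemma meas_Psi_sin : measurable_fun setT Psi_sin.
Proof. by apply: measurable_transform; [exact: continuous_sin|exact: sin_max]. Qed.

Lemma weight_bound v : `|4^-1 + v ^+ 2| <= 1 + v ^+ 2.
Proof. by have := sqr_ge0 v => h; rewrite ger0_norm; lra. Qed.

(** The integrand after expanding only one of the two factors of C^2 + S^2, so that
    Fubini in two variables suffices. *)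
Definition Psi_half (z : R * R) : R := (4^-1 + z.1 ^+ 2) *
  ((kerK L z.1 * Psi_cos z.1 + kerK1 L z.1 * Psi_sin z.1) * (Psi z.2 * cos (z.1 * ln z.2))
 + (kerK L z.1 * Psi_sin z.1 - kerK1 L z.1 * Psi_cos z.1) * (Psi z.2 * sin (z.1 * ln z.2))).

Lemma Psi_half_outer v : \int[mu]_(x in `]0, +oo[) Psi_half (v, x) =
  (4^-1 + v ^+ 2) * (Psi_cos v ^+ 2 + Psi_sin v ^+ 2) * kerK L v.
Proof.
have mi := measurable_pos R; have ic := Psi_cos_int v; have is_ := Psi_sin_int v.
rewrite /Psi_half /= (RintegralZl _ mi (integrableDR mi (integrableZR _ mi ic) (integrableZR _ mi is_))).
rewrite (RintegralD mi (integrableZR _ mi ic) (integrableZR _ mi is_)).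
rewrite (RintegralZl _ mi ic) (RintegralZl _ mi is_) -/(Psi_cos v) -/(Psi_sin v).
by ring.
Qed.

(** Expanding the second factor turns the phase v ln x into v (ln x - ln y), which
    [kerK_shift] absorbs into the parameter of [kerK]. The terms with [kerK1] that
    this brings in cancel in [Psi_half_outer]. *)
Lemma Psi_half_inner v x : Psi_half (v, x) = \int[mu]_(y in `]0, +oo[)
  (Psi2 (x, y) * ((4^-1 + v ^+ 2) * kerK (L + (ln x - ln y)) v)).
Proof.
have mi := measurable_pos R; have ic := Psi_cos_int v; have is_ := Psi_sin_int v.
pose p := (4^-1 + v ^+ 2) * Psi x * (cos (v * ln x) * kerK L v - sin (v * ln x) * kerK1 L v).
pose q := (4^-1 + v ^+ 2) * Psi x * (sin (v * ln x) * kerK L v + cos (v * ln x) * kerK1 L v).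
transitivity (p * Psi_cos v + q * Psi_sin v); first by rewrite /p /q /Psi_half /=; ring.
rewrite -(RintegralZl p mi ic) -(RintegralZl q mi is_).
rewrite -(RintegralD mi (integrableZR p mi ic) (integrableZR q mi is_)).
apply: eq_RintegralR => y _.
by rewrite kerK_shift (mulrBr v) cosB sinB /Psi2 /p /q /=; ring.
Qed.

(** The v-integral is carried out innermost by [int_weighted_kerK]. *)
Lemma Psi_fubini :
  mu.-integrable `]0, +oo[ (EFin \o (fun v => (4^-1 + v ^+ 2) *
    (Psi_cos v ^+ 2 + Psi_sin v ^+ 2) * kerK L v)) /\
  \int[mu]_(v in `]0, +oo[) ((4^-1 + v ^+ 2) *
    (Psi_cos v ^+ 2 + Psi_sin v ^+ 2) * kerK L v) =
  \int[mu]_(y in `]0, +oo[) \int[mu]_(x in `]0, +oo[)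
    (Psi2 (x, y) * wkerG (L + (ln x - ln y))).
Proof.
have mi := measurable_pos R.
pose c := \int[mu]_(x in `]0, +oo[) Psi x.
have mh : measurable_fun setT Psi_half.
  rewrite /Psi_half /kerK /kerK1 /Psi; mf.
  - by apply: (measurableT_comp meas_Psi_cos); exact: measurable_fst.
  - by apply: (measurableT_comp meas_Psi_sin); exact: measurable_fst.
  - by apply: (measurableT_comp meas_Psi_sin); exact: measurable_fst.
  - by apply: (measurableT_comp meas_Psi_cos); exact: measurable_fst.
have bh v x : `]0, +oo[%classic v -> `]0, +oo[%classic x ->
    `|Psi_half (v, x)| <= (4 * c) * kerW v * Psi x.
  rewrite /= in_itv /= andbT => v0 _.
  have [bC bS] := Psi_transform_bound v.
  have bK := kerK_bound L v0 (weight_bound v).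
  have bK1 := kerK1_bound L v0 (weight_bound v).
  have P0 := Psi_ge0 x.
  have bx (t : R) : `|t| <= 1 -> `|Psi x * t| <= Psi x.
    by move=> t1; rewrite normrM (ger0_norm P0) ler_piMr.
  have h1 := ler_normM (ler_normM bK bC) (bx _ (cos_max (v * ln x))).
  have h2 := ler_normM (ler_normM bK1 bS) (bx _ (cos_max (v * ln x))).
  have h3 := ler_normM (ler_normM bK bS) (bx _ (sin_max (v * ln x))).
  have h4 := ler_normM (ler_normM bK1 bC) (bx _ (sin_max (v * ln x))).
  rewrite -/c in h1 h2 h3 h4; move: h1 h2 h3 h4.
  set t1 := _ * (Psi x * cos _); set t2 := _ * (Psi x * cos _).
  set t3 := _ * (Psi x * sin _); set t4 := _ * (Psi x * sin _) => h1 h2 h3 h4.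
  have -> : Psi_half (v, x) = t1 + t2 + (t3 - t4).
    by rewrite /Psi_half /t1 /t2 /t3 /t4 /=; ring.
  apply: (le_trans (ler_normD _ _)).
  have := ler_normD t1 t2; have := ler_normB t3 t4; lra.
have [_ iv F1 F2] := @Rfubini _ _ _ _ R mu mu _ _ _ _ _ mi mi mh
  (integrableZR (4 * c) mi (kerW_int R)) Psi_int bh.
split; first by apply: eq_integrableR iv => // v _; exact: Psi_half_outer.
transitivity (\int[mu]_(v in `]0, +oo[) \int[mu]_(x in `]0, +oo[) Psi_half (v, x)).
  by apply: eq_RintegralR => v _; rewrite Psi_half_outer.
have mphi : measurable_fun setT (fun z : R * R => wkerG (L + (ln z.1 - ln z.2))).
  by rewrite /wkerG; mf.
have [_ G1 G2] := @Psi2_fubini _ _ mphi (fun z => wkerG_bound _).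
rewrite (etrans F1 (esym F2)) {F1 F2 iv}.
rewrite -[RHS](etrans G1 (esym G2)) {G1 G2}.
apply: eq_RintegralR => x _.
under eq_Rintegral do rewrite Psi_half_inner.
have mx : measurable_fun setT (fun z : R * R =>
    Psi2 (x, z.2) * ((4^-1 + z.1 ^+ 2) * kerK (L + (ln x - ln z.2)) z.1)).
  by rewrite /Psi2 /Psi /kerK /=; mf.
have bx v y : `]0, +oo[%classic v -> `]0, +oo[%classic y ->
    `|Psi2 (x, y) * ((4^-1 + v ^+ 2) * kerK (L + (ln x - ln y)) v)| <=
    kerW v * (Psi x * Psi y).
  rewrite /= in_itv /= andbT => v0 _; rewrite mulrC; apply: ler_normM.
    exact: kerK_bound v0 (weight_bound v).
  by rewrite /Psi2 /= ger0_norm// mulr_ge0// Psi_ge0.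
have [_ _ F1 F2] := @Rfubini _ _ _ _ R mu mu _ _ _ _ _ mi mi mx
  (kerW_int R) (integrableZR (Psi x) mi Psi_int) bx.
rewrite (etrans F1 (esym F2)) {F1 F2}; apply: eq_RintegralR => y _ /=.
rewrite -int_weighted_kerK RintegralZl//.
by apply: kerK_int; [mf|move=> v _; exact: weight_bound].
Qed.

End double_integral_fubini.

End double_integral.

(** * Partial fractions of the hyperbolic cotangent *)

Lemma norm_sinB_le (R : realType) (x : R) : 0 < x -> `|sin x - x| <= x ^+ 3 / 2.
Proof.
move=> x0; have [|c] := @MVT R (fun t => sin t - t) (fun t => cos t - 1) 0 x x0.
- by apply: continuous_subspaceT => z; eapply is_derive_cont; der.
rewrite in_itv /= => /andP[c0 cx]; rewrite sin0 !subr0 => ->.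
have /andP[k0 k1] := oneBcos_le c.
rewrite normrM (gtr0_norm x0) distrC ger0_norm//.
have -> : x ^+ 3 / 2 = x ^+ 2 / 2 * x by ring.
rewrite ler_pM2r//; apply: (le_trans k1).
by nra.
Qed.

(** sin x = 2 sin(x/2) cos(x/2) with sin(x/2) = cos(c) x/2, and both cosines are at least
    cos(pi/4). *)
Lemma sin_ge_half (R : realType) (x : R) : 0 < x <= pi / 2 -> x / 2 <= sin x.
Proof.
move=> /andP[x0 xp]; have p0 := pi_gt0 R.
have z0 : 0 < x / 2 by lra.
have cz : cos (pi / 2 / 2) <= cos (x / 2).
  case: (ltgtP (x / 2) (pi / 2 / 2)) => [h|h|->//]; last by lra.
  by apply/ltW; rewrite ltr_cos ?in_itv //=; apply/andP; split; lra.
have [/andP[k0 _] [k2 _]] := @cos_quarter R.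
have [|c] := @MVT R sin cos 0 (x / 2) z0.
- by apply: continuous_subspaceT => z; exact: continuous_sin.
rewrite in_itv /= => /andP[c0 cx]; rewrite sin0 !subr0 => sE.
have cc : cos (x / 2) <= cos c.
  by apply/ltW; rewrite ltr_cos ?in_itv //=; apply/andP; split; lra.
have -> : sin x = 2 * (cos (x / 2) * sin (x / 2)).
  by rewrite -[in LHS](_ : (x / 2) *+ 2 = x) ?sin_mulr2n ?mulr2n; [ring|field].
rewrite sE; have h : cos (pi / 2 / 2) * cos (pi / 2 / 2) <= cos (x / 2) * cos c.
  by apply: ler_pM; [exact/ltW|exact/ltW|exact: cz|exact: le_trans cz cc].
by rewrite expr2 in k2; nra.
Qed.

Section finite_coth.
Variable R : realType.
Implicit Types r t : R.

Lemma geom_cos r t n : (1 - 2 * r * cos t + r ^+ 2) * \sum_(0 <= m < n) r ^+ m * cos (m%:R * t) =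
  1 - r * cos t - r ^+ n * cos (n%:R * t)
  + r ^+ n.+1 * (cos (n%:R * t) * cos t + sin (n%:R * t) * sin t).
Proof.
elim: n => [|n IH].
  by rewrite big_nil mul0r cos0 sin0 expr0 expr1; ring.
rewrite big_nat_recr //= mulrDr IH.
have -> : n.+1%:R * t = n%:R * t + t by rewrite -addn1 natrD mulrDl mul1r.
rewrite cosD sinD !exprS expr0; have := cos2Dsin2 t.
move: (cos t) (sin t) (cos (n%:R * t)) (sin (n%:R * t)) (r ^+ n) => C S A B p CS.
have -> : (A * C - B * S) * C + (B * C + A * S) * S = A * (C ^+ 2 + S ^+ 2) by ring.
by rewrite CS; ring.
Qed.

Lemma cos_nat_2pi (k : nat) : cos (k%:R * (2 * pi) : R) = 1 /\ sin (k%:R * (2 * pi) : R) = 0.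
Proof.
elim: k => [|k [c s]]; first by rewrite mul0r cos0 sin0.
have -> : k.+1%:R * (2 * pi) = k%:R * (2 * pi) + pi *+ 2 :> R.
  by rewrite -addn1 natrD mulr2n; ring.
by rewrite cosD2pi sinD2pi.
Qed.

(** Multiplied by 2 sin(m pi / n) the sum telescopes. *)
Lemma sum_cos_roots (n m : nat) : (0 < m < n)%N ->
  \sum_(0 <= k < n) cos (m%:R * (k%:R * (2 * pi) / n%:R) : R) = 0.
Proof.
move=> /andP[m0 mn]; have n0 : (n%:R : R) != 0 by rewrite pnatr_eq0 -lt0n (ltn_trans m0).
pose a : R := m%:R * pi / n%:R.
have a0 : 0 < sin a.
  have n1 : 0 < (n%:R : R) by rewrite ltr0n (ltn_trans m0).
  apply: sin_gt0_pi; rewrite /a; apply/andP; split.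
    by rewrite divr_gt0// mulr_gt0 ?ltr0n ?pi_gt0.
  by rewrite ltr_pdivrMr// mulrC ltr_pM2l ?pi_gt0// ltr_nat.
apply: (mulfI (x := 2 * sin a)); first by rewrite mulf_neq0// gt_eqF.
rewrite mulr0 mulr_sumr.
have E (k : nat) : 2 * sin a * cos (m%:R * (k%:R * (2 * pi) / n%:R)) =
    sin ((2 * k%:R + 1) * a) - sin ((2 * k%:R - 1) * a).
  have -> : m%:R * (k%:R * (2 * pi) / n%:R) = 2 * k%:R * a by rewrite /a; field.
  by rewrite [(_ + 1) * a]mulrDl [(_ - 1) * a]mulrBl mul1r sinD sinB; ring.
have T (N : nat) : \sum_(0 <= k < N) (2 * sin a * cos (m%:R * (k%:R * (2 * pi) / n%:R))) =
    sin ((2 * N%:R - 1) * a) + sin a.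
  elim: N => [|N IH]; first by rewrite big_nil mulr0 sub0r mulN1r sinN addNr.
  rewrite big_nat_recr //= IH E.
  have -> : (2 * N.+1%:R - 1) * a = (2 * N%:R + 1) * a by rewrite -addn1 natrD; ring.
  by ring.
rewrite T; have [c s] := cos_nat_2pi m.
have -> : (2 * n%:R - 1) * a = m%:R * (2 * pi) - a by rewrite /a; field.
by rewrite sinB c s; ring.
Qed.

Lemma poisson_den_gt0 r t : 0 < r < 1 -> 0 < 1 - 2 * r * cos t + r ^+ 2.
Proof.
move=> /andP[r0 r1]; have := cos_le1 t => c1.
have : 0 < (1 - r) ^+ 2 by rewrite exprn_gt0// subr_gt0.
have : 0 <= r * (1 - cos t) by rewrite mulr_ge0 ?subr_ge0// ltW.
by nra.
Qed.

(** The terms are the real parts of 1 / (1 - r w) for the n-th roots of unity w. In the geometric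
    expansion in r only the powers divisible by n survive the summation over w. *)
Lemma sum_poisson r (n : nat) : 0 < r < 1 -> (0 < n)%N ->
  \sum_(0 <= k < n) ((1 - r * cos (k%:R * (2 * pi) / n%:R))
     / (1 - 2 * r * cos (k%:R * (2 * pi) / n%:R) + r ^+ 2)) = n%:R / (1 - r ^+ n).
Proof.
move=> r01 n0; have /andP[r0 r1] := r01.
have nn : (n%:R : R) != 0 by rewrite pnatr_eq0 -lt0n.
have rn : 1 - r ^+ n != 0.
  by rewrite subr_eq0 eq_sym lt_eqF// exprn_ilt1// ?ltW// -lt0n.
have E (k : nat) : (1 - r * cos (k%:R * (2 * pi) / n%:R))
     / (1 - 2 * r * cos (k%:R * (2 * pi) / n%:R) + r ^+ 2) =
   (\sum_(0 <= m < n) r ^+ m * cos (m%:R * (k%:R * (2 * pi) / n%:R))) / (1 - r ^+ n).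
  set t := k%:R * (2 * pi) / n%:R; have D0 := poisson_den_gt0 t r01.
  have := geom_cos r t n.
  have -> : n%:R * t = k%:R * (2 * pi) by rewrite /t; field.
  have [-> ->] := cos_nat_2pi k; rewrite [r ^+ n.+1]exprS => G.
  have D1 : 1 - 2 * r * cos t + r ^+ 2 != 0 by rewrite gt_eqF.
  by apply/eqP; rewrite (eqr_div _ _ D1 rn); apply/eqP; rewrite [RHS]mulrC G; ring.
under eq_bigr do rewrite E.
rewrite -mulr_suml; congr (_ / _).
rewrite exchange_big /= big_ltn//=.
rewrite [X in X + _](_ : _ = n%:R); last first.
  under eq_bigr do rewrite mul0r cos0 expr0 mul1r.
  by rewrite big_const_nat subn0 iter_addr addr0.
rewrite [X in _ + X]big_nat_cond big1 ?addr0// => m /andP[/andP[m1 mn] _].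
by rewrite -mulr_sumr sum_cos_roots ?mulr0// m1.
Qed.

End finite_coth.

Lemma cvg_harmonic_bound (R : realType) (u : nat -> R) (l C : R) :
  (forall n, `|u n - l| <= C / n.+1%:R) -> u @ \oo --> l.
Proof.
move=> h; have H : (fun n : nat => C / n.+1%:R : R) @ \oo --> (0 : R).
  rewrite -[X in _ --> X](mulr0 C); apply: cvgM; first exact: cvg_cst.
  exact: cvg_harmonic.
have H1 : (fun n : nat => l - C / n.+1%:R : R) @ \oo --> l.
  by rewrite -[X in _ --> X](subr0 l); apply: cvgB => //; exact: cvg_cst.
have H2 : (fun n : nat => l + C / n.+1%:R : R) @ \oo --> l.
  by rewrite -[X in _ --> X](addr0 l); apply: cvgD => //; exact: cvg_cst.
apply: (squeeze_cvgr _ H1 H2); near=> n.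
by have := h n; rewrite ler_distl.
Unshelve. all: end_near. Qed.

Lemma sum_invsq_le (R : realType) (N M : nat) : (0 < N)%N -> (N <= M)%N ->
  \sum_(N.+1 <= k < M.+1) ((k%:R : R) ^+ 2)^-1 <= N%:R^-1 - M%:R^-1.
Proof.
move=> N0; elim: M => [|M IH]; first by rewrite leqn0 => /eqP E; rewrite E in N0.
rewrite leq_eqVlt => /predU1P[<-|]; first by rewrite big_geq// subrr.
rewrite ltnS => NM; rewrite big_nat_recr//=.
apply: (le_trans (lerD (IH NM) (lexx _))).
have M0 : (0 : R) < M%:R by rewrite ltr0n (leq_trans N0).
rewrite -addn1 natrD; move: (M%:R : R) M0 => x x0.
suff : ((x + 1) ^+ 2)^-1 <= x^-1 - (x + 1)^-1 by lra.
have -> : x^-1 - (x + 1)^-1 = (x * (x + 1))^-1 by field; lra.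
by rewrite lef_pV2 ?posrE ?mulr_gt0 ?exprn_gt0 //; nra.
Qed.

(** Termwise limits of sums with majorant C / k^2: the tails beyond N are at most C / N,
    uniformly in the parameter. *)
Lemma tannery (R : realType) (a : nat -> nat -> R) (b : nat -> R) (C l : R) :
  0 <= C ->
  (forall k, (0 < k)%N -> a ^~ k @ \oo --> b k) ->
  (forall M k, (0 < k <= M)%N -> `|a M k| <= C / k%:R ^+ 2) ->
  (fun M => \sum_(1 <= k < M.+1) a M k) @ \oo --> l ->
  (fun N => \sum_(1 <= k < N.+1) b k) @ \oo --> l.
Proof.
move=> C0 ab aC al.
have tail (N M : nat) : (0 < N)%N -> (N <= M)%N ->
    `|\sum_(1 <= k < M.+1) a M k - \sum_(1 <= k < N.+1) a M k| <= C / N%:R.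
  move=> N0 NM; rewrite [X in X - _](big_cat_nat (n := N.+1))//= addrAC subrr add0r.
  apply: (le_trans (ler_norm_sum _ _ _)).
  apply: (@le_trans _ _ (\sum_(N.+1 <= k < M.+1) C * (k%:R ^+ 2)^-1)).
    rewrite big_nat_cond [leRHS]big_nat_cond; apply: ler_sum => k.
    by rewrite andbT => /andP[k1 k2]; apply: aC; rewrite (leq_ltn_trans _ k1).
  rewrite -mulr_sumr ler_wpM2l//; apply: (le_trans (sum_invsq_le R N0 NM)).
  by rewrite gerBl invr_ge0.
have lim (N : nat) : (0 < N)%N -> `|\sum_(1 <= k < N.+1) b k - l| <= C / N%:R.
  move=> N0; rewrite distrC.
  have H : (fun M => `|\sum_(1 <= k < M.+1) a M k - \sum_(1 <= k < N.+1) a M k|) @ \oo -->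
      `|l - \sum_(1 <= k < N.+1) b k|.
    apply: cvg_norm; apply: cvgB => //.
    elim: N {N0} => [|N IH].
      rewrite [X in X @ _](_ : _ = fun=> 0); first by rewrite big_geq//; exact: cvg_cst.
      by apply/funext => M; rewrite big_geq.
    rewrite big_nat_recr//= [X in X @ _](_ : _ =
      fun M => \sum_(1 <= k < N.+1) a M k + a M N.+1); last first.
      by apply/funext => M; rewrite big_nat_recr.
    by apply: cvgD => //; exact: ab.
  apply: (cvgr_to_le H); near=> M; apply: tail => //; near: M; exact: nbhs_infty_ge.
rewrite -cvg_shiftS; apply: (@cvg_harmonic_bound _ _ _ C) => N; exact: lim.
Unshelve. all: end_near. Qed.

Section coth.
Variable R : realType.

(** n (1 - r) for r = exp(- y / n); it tends to y, which makes [poisson_term] tend to the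
    partial fraction. *)
Definition rate (y n : R) := n * (1 - expR (- (y / n))).

Lemma rate_bounds (y n : R) : 0 < y -> 0 < n -> `|rate y n - y| <= y ^+ 2 / n /\ 0 < rate y n <= y.
Proof.
move=> y0 n0; set z := y / n; have z0 : 0 < z by rewrite divr_gt0.
have yE : y = n * z by rewrite /z; field; lra.
have e1 : 1 - z <= expR (- z) by have := expR_ge1Dx (- z); rewrite addrC; lra.
have e2 : expR (- z) < 1 by rewrite expR_lt1; lra.
have e3 : (1 + z) * expR (- z) <= 1.
  rewrite expRN ler_pdivrMr ?expR_gt0// mul1r; exact: expR_ge1Dx.
have e4 := expR_gt0 (- z).
rewrite /rate -/z; have -> : y ^+ 2 / n = n * z ^+ 2 by rewrite yE; field; lra.
move: yE e1 e2 e3 e4; move: (expR _) => e yE e1 e2 e3 e4.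
split; last by rewrite yE ler_pM2l// mulr_gt0//; lra.
rewrite yE -mulrBr normrM (gtr0_norm n0) ler_pM2l// ler_norml.
by apply/andP; split; nra.
Qed.

Lemma poisson_den (r t : R) : 1 - 2 * r * cos (t *+ 2) + r ^+ 2 = (1 - r) ^+ 2 + 4 * r * sin t ^+ 2.
Proof.
by rewrite cos_mulr2n -mulr_natr; have := cos2Dsin2 t; rewrite addrC => /(canRL (addrK _)) ->; ring.
Qed.

(** With n = 2 M + 1 and r = exp(- y / n), the real part of 1 / (1 - r w) at w = e^(2 i k pi / n) is
    1/2 + n/2 times this term. *)
Definition poisson_term (y : R) (M k : nat) :=
  let n := M.*2.+1%:R in let r := expR (- (y / n)) in
  rate y n * (1 + r) / (rate y n ^+ 2 + 4 * r * (n * sin (k%:R * pi / n)) ^+ 2).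

(** [sum_poisson] with the terms k and n - k, which are equal, put together; the term
    k = 0 gives the last summand. *)
Lemma sum_poisson_term (y : R) (M : nat) : 0 < y ->
  let n := M.*2.+1%:R in let r := expR (- (y / n)) in
  \sum_(1 <= k < M.+1) poisson_term y M k =
  (1 - expR (- y))^-1 - 2^-1 - (1 + r) / (2 * rate y n).
Proof.
move=> y0 n r; have n0 : 0 < n by rewrite ltr0n.
have r01 : 0 < r < 1.
  by rewrite expR_gt0 expR_lt1 oppr_lt0 divr_gt0.
have /andP[r0 r1] := r01.
have rnE : r ^+ M.*2.+1 = expR (- y).
  by rewrite /r -expRM_natl; congr expR; rewrite mulrN -[M.*2.+1%:R]/n; field; lra.
have := @sum_poisson R r M.*2.+1 r01 isT; rewrite -[M.*2.+1%:R]/n rnE.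
have e1 : expR (- y) < 1 by rewrite expR_lt1 oppr_lt0.
pose P (k : nat) := (1 - r ^+ 2) / ((1 - r) ^+ 2 + 4 * r * sin (k%:R * pi / n) ^+ 2).
have D0 (k : nat) : 0 < (1 - r) ^+ 2 + 4 * r * sin (k%:R * pi / n) ^+ 2.
  by rewrite ltr_wpDr ?exprn_gt0 ?subr_gt0// mulr_ge0 ?sqr_ge0// mulr_ge0// ltW.
under eq_bigr => k _.
  rewrite (_ : k%:R * (2 * pi) / n = (k%:R * pi / n) *+ 2); last by rewrite mulr2n; ring.
  rewrite poisson_den.
  rewrite (_ : _ / _ = 2^-1 + 2^-1 * P k); last first.
    have := D0 k; rewrite /P => d0; have := poisson_den r (k%:R * pi / n).
    move: (cos _) d0 => C d0 E.
    have -> : 1 - r * C = 2^-1 * (((1 - r) ^+ 2 + 4 * r * sin (k%:R * pi / n) ^+ 2) + (1 - r ^+ 2)).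
      by rewrite -E; field.
    by field; rewrite gt_eqF.
  over.
rewrite [X in X = _ -> _](_ : _ = 2^-1 * n + 2^-1 * \sum_(0 <= k < M.*2.+1) P k); last first.
  by rewrite big_split/= -mulr_sumr sumr_const_nat subn0 mulr_natr.
have half : \sum_(0 <= k < M.*2.+1) P k = P 0%N + 2 * \sum_(1 <= k < M.+1) P k.
  rewrite big_ltn//; congr (_ + _).
  rewrite (big_cat_nat (n := M.+1))//=; last by rewrite ltnS -addnn leq_addr.
  rewrite mulrDl mul1r; congr (_ + _).
  rewrite -{1}[M.+1]add1n big_addn (_ : M.*2.+1 - M = M.+1)%N; last by rewrite -addnn -addnS addKn.
  rewrite big_nat_rev/=; apply: eq_big_nat => k /andP[k1 kM].
  rewrite /P (_ : (1 + M.+1 - k.+1 + M)%N%:R = n - k%:R).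
    rewrite (_ : (n - k%:R) * pi / n = pi - k%:R * pi / n); last by field; rewrite gt_eqF.
    by rewrite sinB sinpi cospi mul0r sub0r mulN1r opprK.
  by apply/eqP; rewrite eq_sym subr_eq -natrD add1n subSS addnAC subnK ?addSn ?addnn// ltnW.
rewrite half => H.
have TE (k : nat) : poisson_term y M k = n^-1 * P k.
  rewrite /poisson_term -/n -/r /rate -/r /P; have := D0 k => d0.
  have -> : (n * (1 - r)) ^+ 2 + 4 * r * (n * sin (k%:R * pi / n)) ^+ 2 =
    n ^+ 2 * ((1 - r) ^+ 2 + 4 * r * sin (k%:R * pi / n) ^+ 2) by ring.
  by move: (_ + _) d0 => D d0; field; rewrite !gt_eqF.
under eq_bigr do rewrite TE; rewrite -mulr_sumr.
have P0 : P 0%N = (1 + r) / (1 - r).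
  by rewrite /P !mul0r sin0 expr0n mulr0 addr0; field; lra.
rewrite P0 in H; rewrite /rate -/r.
move: H; move: (\sum_(_ <= _ < _) _) (expR (- y)) e1 => S e e1 H.
have -> : S = n / (1 - e) - 2^-1 * n - 2^-1 * ((1 + r) / (1 - r)) by rewrite -H; field; lra.
by field; rewrite !gt_eqF; lra.
Qed.

Lemma nM_ge (M : nat) : (M.+1%:R : R) <= M.*2.+1%:R.
Proof. by rewrite ler_nat ltnS -addnn leq_addr. Qed.

Lemma rate_cvg (y : R) : 0 < y -> (fun M : nat => rate y M.*2.+1%:R) @ \oo --> y.
Proof.
move=> y0; apply: (@cvg_harmonic_bound _ _ _ (y ^+ 2)) => M.
have n0 : (0 : R) < M.*2.+1%:R by rewrite ltr0n.
have [h _] := rate_bounds y0 n0; apply: (le_trans h).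
by rewrite ler_wpM2l ?sqr_ge0// lef_pV2 ?posrE ?ltr0n// nM_ge.
Qed.

Lemma decay_cvg (y : R) : 0 < y -> (fun M : nat => expR (- (y / M.*2.+1%:R))) @ \oo --> (1 : R).
Proof.
move=> y0; apply: (@cvg_harmonic_bound _ _ _ y) => M.
have n0 : (0 : R) < M.*2.+1%:R by rewrite ltr0n.
have [_ /andP[h1 h2]] := rate_bounds y0 n0.
have h : 1 - expR (- (y / M.*2.+1%:R)) <= y / M.*2.+1%:R.
  by rewrite ler_pdivlMr// mulrC.
have h0 : 0 <= 1 - expR (- (y / M.*2.+1%:R)).
  by rewrite subr_ge0 ltW// expR_lt1 oppr_lt0 divr_gt0.
rewrite distrC ger0_norm//; apply: (le_trans h).
by rewrite ler_pM2l// lef_pV2 ?posrE ?ltr0n// nM_ge.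
Qed.

Lemma poisson_term_cvg (y : R) (k : nat) : 0 < y -> (0 < k)%N ->
  (poisson_term y) ^~ k @ \oo --> 2 * y / (y ^+ 2 + (2 * pi * k%:R) ^+ 2).
Proof.
move=> y0 k0.
have cs : (fun M : nat => M.*2.+1%:R * sin (k%:R * pi / M.*2.+1%:R)) @ \oo --> (k%:R * pi : R).
  set t := k%:R * pi : R; have t0 : 0 < t by rewrite mulr_gt0 ?pi_gt0// ltr0n.
  apply: (@cvg_harmonic_bound _ _ _ (t ^+ 3)) => M.
  have n1 := nM_ge M; have n2 : (1 : R) <= M.+1%:R by rewrite ler1n.
  move: (M.*2.+1%:R : R) n1 n2 => n n1 n2.
  have n0 : 0 < n by lra.
  have -> : n * sin (t / n) - t = n * (sin (t / n) - t / n) by field; rewrite gt_eqF.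
  rewrite normrM (gtr0_norm n0).
  apply: (le_trans (ler_wpM2l (ltW n0) (norm_sinB_le (divr_gt0 t0 n0)))).
  have -> : n * ((t / n) ^+ 3 / 2) = t ^+ 3 * ((2 * n) * n)^-1 by field; rewrite gt_eqF.
  by rewrite ler_pM2l ?exprn_gt0// lef_pV2 ?posrE; nra.
have cr := rate_cvg y0; have ce := decay_cvg y0.
have -> : 2 * y / (y ^+ 2 + (2 * pi * k%:R) ^+ 2) =
  y * (1 + 1) / (y * y + 4 * 1 * (k%:R * pi * (k%:R * pi))).
  by congr (_ / _); [ring|ring].
have E : (poisson_term y) ^~ k = fun M : nat => rate y M.*2.+1%:R * (1 + expR (- (y / M.*2.+1%:R))) /
  (rate y M.*2.+1%:R * rate y M.*2.+1%:R + 4 * expR (- (y / M.*2.+1%:R)) *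
   (M.*2.+1%:R * sin (k%:R * pi / M.*2.+1%:R) * (M.*2.+1%:R * sin (k%:R * pi / M.*2.+1%:R)))).
  by apply/funext.
rewrite E; apply: cvgM.
  by apply: cvgM => //; apply: cvgD => //; exact: cvg_cst.
apply: cvgV.
  rewrite gt_eqF// ltr_pwDl ?mulr_gt0// mulr_ge0 ?mulr_ge0 ?pi_ge0 ?ler0n//.
apply: cvgD; first exact: cvgM.
by apply: cvgM; [apply: cvgM => //; exact: cvg_cst|exact: cvgM].
Qed.

Lemma poisson_term_le (y : R) (M k : nat) : 0 < y -> (0 < k <= M)%N ->
  `|poisson_term y M k| <= 2 * y * expR y / k%:R ^+ 2.
Proof.
move=> y0 /andP[k0 kM]; rewrite /poisson_term.
have n2 : (1 : R) <= M.*2.+1%:R by rewrite ler1n.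
have kn : (2 * k%:R : R) <= M.*2.+1%:R.
  by rewrite -natrM ler_nat mul2n ltnW// ltnS leq_double.
have k1 : (1 : R) <= k%:R by rewrite ler1n.
move: (M.*2.+1%:R : R) (k%:R : R) n2 kn k1 => n x n1 xn x1.
have n0 : 0 < n by lra.
have [_ /andP[r0 ry]] := rate_bounds y0 n0.
have e1 : expR (- (y / n)) < 1 by rewrite expR_lt1 oppr_lt0 divr_gt0.
have e2 : expR (- y) <= expR (- (y / n)).
  by rewrite ler_expR lerN2 ler_pdivrMr// ler_peMr// ltW.
have e0 := expR_gt0 (- y).
have p2 := pi_ge2 R.
have s1 : x <= n * sin (x * pi / n).
  have t0 : 0 < x * pi / n by rewrite divr_gt0// mulr_gt0//; lra.
  have := @sin_ge_half R (x * pi / n); rewrite t0 /= => h.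
  have : x * pi / n <= pi / 2.
    rewrite ler_pdivrMr//; have : 0 <= pi * (n - 2 * x) by rewrite mulr_ge0//; lra.
    lra.
  move=> /h s; apply: (@le_trans _ _ (n * (x * pi / n / 2))); last by rewrite ler_pM2l.
  have -> : n * (x * pi / n / 2) = x * (pi / 2) by field; rewrite gt_eqF.
  by rewrite ler_peMr//; lra.
move: (n * sin _) s1 => s s1.
move: (rate y n) r0 ry => d d0 dy; move: e2 e1; move: (expR (- (y / n))) => r e2 e1.
have r0 : 0 < r by apply: lt_le_trans e2.
have D0 : 0 < d ^+ 2 + 4 * r * s ^+ 2.
  by rewrite ltr_pwDl ?exprn_gt0// mulr_ge0 ?sqr_ge0// mulr_ge0// ltW.
rewrite ger0_norm; last by rewrite divr_ge0 ?ltW// mulr_gt0//; lra.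
have x0 : 0 < x by lra.
rewrite ler_pdivrMr// mulrAC ler_pdivlMr ?exprn_gt0//.
have ee : expR y * expR (- y) = 1 by rewrite -expRD subrr expR0.
have E0 := expR_gt0 y; move: (expR y) (expR (- y)) ee E0 e0 e2 => E e ee E0 e0 e2.
have a1 : x ^+ 2 <= s ^+ 2 by nra.
have a2 : 1 <= E * r by rewrite -ee ler_pM2l.
have a3 : 4 * x ^+ 2 <= E * (d ^+ 2 + 4 * r * s ^+ 2).
  apply: (@le_trans _ _ (4 * (E * r) * s ^+ 2)).
    have : 0 <= s ^+ 2 by exact: sqr_ge0.
    nra.
  have : 0 <= E * d ^+ 2 by rewrite mulr_ge0 ?sqr_ge0// ltW.
  nra.
apply: (@le_trans _ _ (y * 2 * x ^+ 2)).
  by apply: ler_wpM2r; [exact: sqr_ge0|apply: ler_pM; lra].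
have := sqr_ge0 x; nra.
Qed.

(** The right side is (coth (y / 2) - 2 / y) / 2. Let M tend to infinity in [sum_poisson_term], with
    sin t >= t / 2 on [0, pi / 2] providing the majorant for [tannery]. *)
Lemma coth_partial_fractions (y : R) : 0 < y ->
  (fun N => \sum_(1 <= k < N.+1) 2 * y / (y ^+ 2 + (2 * pi * k%:R) ^+ 2)) @ \oo -->
  (expR y - 1)^-1 + 2^-1 - y^-1.
Proof.
move=> y0; apply: (@tannery _ (poisson_term y) _ (2 * y * expR y)).
- by rewrite !mulr_ge0 ?expR_ge0// ltW.
- by move=> k k0; exact: poisson_term_cvg.
- by move=> M k h; exact: poisson_term_le.
under eq_cvg do rewrite sum_poisson_term//.
have e1 : 1 < expR y by rewrite expR_gt1.
have -> : (expR y - 1)^-1 + 2^-1 - y^-1 = (1 - expR (- y))^-1 - 2^-1 - (1 + 1) / (2 * y).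
  by rewrite expRN; move: (expR y) e1 => E E1; field; lra.
apply: cvgB; first exact: cvg_cst.
apply: cvgM; first by apply: cvgD; [exact: cvg_cst|exact: decay_cvg].
apply: cvgV; first by rewrite gt_eqF// mulr_gt0.
by apply: cvgM; [exact: cvg_cst|exact: rate_cvg].
Qed.

End coth.

(** * Euler summation *)

Section euler_summation.
Variables (R : realType) (g g' G : R -> R).
Notation mu := (@lebesgue_measure R).
Variable m : nat.
Hypothesis dg : forall x : R, m%:R < x -> is_derive x 1 g (g' x).
Hypothesis dG : forall x : R, m%:R < x -> is_derive x 1 G (g x).
Hypothesis cg' : forall x : R, m%:R < x -> {for x, continuous g'}.
Hypothesis mg' : measurable_fun setT g'.
Hypothesis cGm : G x @[x --> (m%:R)^'+] --> G m%:R.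
Hypothesis xgm : (x - m%:R) * g x @[x --> (m%:R)^'+] --> (0 : R).
Hypothesis ig' : mu.-integrable `]m%:R, +oo[ (EFin \o (fun x => fract x * g' x)).

Let mm : measurable (`]m%:R, +oo[ : set (measurableTypeR R)).
Proof. exact: measurable_itv. Qed.

(** A primitive of {x} g'(x) on ]n, n + 1[. *)
Let F (n : nat) (x : R) := (x - n%:R) * g x - G x.

Let dF n (x : R) : m%:R < x -> is_derive x 1 (F n) ((x - n%:R) * g' x).
Proof.
move=> x0; refine (der_eq (der_add (der_mul (der_add (der_id x) (der_cst x (- n%:R))) (dg x0)) (der_opp (dG x0))) _).
by ring.
Qed.

Let F_right n : (m <= n)%N -> F n x @[x --> (n%:R)^'+] --> - G n%:R.
Proof.
rewrite leq_eqVlt => /predU1P[<-|mn].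
  by rewrite -[X in _ --> X]sub0r; exact: cvgB.
have n0 : (m%:R : R) < n%:R by rewrite ltr_nat.
rewrite (_ : - G n%:R = F n n%:R); last by rewrite /F subrr mul0r sub0r.
by apply: cvg_at_right_filter; exact: is_derive_cont (dF n n0).
Qed.

Let inv3 i : 0 < (i.+3%:R : R)^-1 <= 3^-1.
Proof. by rewrite invr_gt0 ltr0n/= lef_pV2 ?posrE// ler_nat. Qed.

Let inv3_cvg : (fun i : nat => (i.+3%:R : R)^-1) @ \oo --> (0 : R).
Proof.
rewrite (cvg_shiftS (fun i : nat => (i.+2%:R : R)^-1)) (cvg_shiftS (fun i : nat => (i.+1%:R : R)^-1)).
exact: cvg_harmonic.
Qed.

Let int_piece n : (m <= n)%N -> \int[mu]_(x in `]n%:R, n.+1%:R]) (fract x * g' x) = g n.+1%:R - G n.+1%:R + G n%:R.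
Proof.
move=> mn; have nE : n.+1%:R = n%:R + 1 :> R by rewrite -addn1 natrD.
have n0 : (m%:R : R) <= n%:R by rewrite ler_nat.
have n1 : (m%:R : R) < n.+1%:R by rewrite ltr_nat ltnS.
have I x : `]n%:R, n.+1%:R[%classic x <-> n%:R < x < n.+1%:R.
  by rewrite /= in_itv.
have mD : measurable (`]n%:R, n.+1%:R[ : set (measurableTypeR R)) by exact: measurable_itv.
have mfg : measurable_fun setT (fun x : R => fract x * g' x).
  by apply: measurable_funM => //; apply: meas_fract.
have fE x : `]n%:R, n.+1%:R[%classic x -> fract x * g' x = (x - n%:R) * g' x.
  by move=> /I /andP[/ltW h1 h2]; rewrite (@fract_int _ n)// h1.
have x0 (x : R) : n%:R < x -> m%:R < x by exact: le_lt_trans.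
have ig : mu.-integrable `]n%:R, n.+1%:R[ (EFin \o (fun x => fract x * g' x)).
  apply: (integrableS mm mD _ ig').
  by move=> x /I /andP[h _]; rewrite /= in_itv /= andbT; exact: x0 h.
rewrite -Rintegral_itv_bndo_bndc// (eq_RintegralR mu fE).
refine (@FTC_exhaust R `]n%:R, n.+1%:R[ (fun x => (x - n%:R) * g' x) (F n)
  (fun i => n%:R + i.+3%:R^-1) (fun i => n.+1%:R - i.+3%:R^-1) mD _ _ _ _ _ _ _ _ _).
- apply: measurable_funM => //; last exact: measurable_funTS.
  by apply: measurable_funB => //.
- by move=> i; have /andP[] := inv3 i; rewrite nE; move: (_^-1) => z; lra.
- move=> i x /=; rewrite !in_itv /=; have /andP[] := inv3 i; move: (_^-1) => z z0 z1.
  by move=> /andP[h1 h2]; apply/andP; split; lra.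
- by move=> x /I /andP[h _]; apply: dF; exact: x0 h.
- move=> x /I /andP[h _]; apply: cvgM; last exact: cg' (x0 _ h).
  by apply: cvgB; [exact: cvg_id|exact: cvg_cst].
- move=> x /I /andP[h1 h2].
  have k : 0 < Num.min (x - n%:R) (n.+1%:R - x) by rewrite lt_min !subr_gt0 h1.
  have /cvgr_le/(_ _ k) := inv3_cvg; apply: filterS => i.
  rewrite le_min; move: (i.+3%:R^-1) => z /andP[j1 j2].
  by apply/andP; split; [rewrite -lerBrDl|rewrite lerBrDr -lerBrDl].
- exact: (eq_integrableR mD fE ig).
rewrite (_ : g n.+1%:R - G n.+1%:R + G n%:R = F n n.+1%:R - - G n%:R); last first.
  by rewrite /F nE; ring.
apply: cvgB.
  have c := is_derive_cont (dF n n1).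
  apply: (@cvg_comp _ _ _ (fun i : nat => n.+1%:R - i.+3%:R^-1 : R) (F n) _ _ _ _ c).
  rewrite -[X in _ `=>` nbhs X](subr0 (n.+1%:R : R)).
  by apply: cvgB; [exact: cvg_cst|exact: inv3_cvg].
rewrite (cvg_shiftS (fun i : nat => F n (n%:R + i.+2%:R^-1))).
rewrite (cvg_shiftS (fun i : nat => F n (n%:R + i.+1%:R^-1))).
exact: cvg_at_right_seq (F_right mn).
Qed.

(** On each interval {x} g'(x) integrates by parts to the value of g at the right end minus the
    increment of G. At m only one-sided limits are assumed, since g may be
    singular there. *)
Lemma euler_summation_finite N : (m <= N)%N ->
  \int[mu]_(x in `]m%:R, N%:R]) (fract x * g' x) =
  \sum_(m.+1 <= k < N.+1) g k%:R - G N%:R + G m%:R.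
Proof.
elim: N => [|N IH].
  by rewrite leqn0 => /eqP ->; rewrite set_itvoc0 Rintegral_set0 big_geq// sub0r addNr.
rewrite leq_eqVlt => /predU1P[<-|mN].
  by rewrite set_itvoc0 Rintegral_set0 big_geq// sub0r addNr.
have E : `]m%:R, N.+1%:R]%classic = `]m%:R, N%:R] `|` `]N%:R, N.+1%:R] :> set R.
  by rewrite -itv_bndbnd_setU//= ?bnd_simp ?ler_nat.
rewrite E Rintegral_setU ?(IH mN) ?int_piece//.
- rewrite [in RHS]big_nat_recr//=; move: (\sum_(_ <= _ < _) _) => S.
  by move: (g _) (G N%:R) (G N.+1%:R) => x y z; ring.
- rewrite -E; apply: integrableS ig' => //.
  by move=> x /=; rewrite !in_itv /= andbT => /andP[].
- apply/disj_setPS => x []/=; rewrite !in_itv /= => /andP[_ h1] /andP[h2 _].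
  by have := lt_le_trans h2 h1; rewrite ltxx.
Qed.

Lemma euler_summation :
  (fun N => \sum_(m.+1 <= k < N.+1) g k%:R - G N%:R + G m%:R) @ \oo -->
  \int[mu]_(x in `]m%:R, +oo[) (fract x * g' x).
Proof.
have mfg : measurable_fun setT (fun x : R => fract x * g' x).
  by apply: measurable_funM => //; apply: meas_fract.
have [||||_] := @Rdominated_cvg _ _ _ mu `]m%:R, +oo[ (fun N => (fun x => fract x * g' x) \_ `]m%:R, N%:R])
  (fun x => fract x * g' x) (fun x => `|fract x * g' x|) mm.
- by move=> N; apply/measurable_restrict => //; exact: measurable_funTS.
- move=> x /=; rewrite in_itv /= andbT => x0; apply: cvg_near_cst; near=> N.
  rewrite patchE ifT// inE /= in_itv /= x0/=; near: N; exact: nbhs_infty_ger.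
- exact: integrable_norm.
- by move=> N x _; rewrite patchE; case: ifPn => // _; rewrite normr0.
apply: cvg_trans; apply: near_eq_cvg; near=> N.
have mN : (m <= N)%N by near: N; exact: nbhs_infty_ge.
rewrite -Rintegral_mkcondr -(euler_summation_finite mN); congr (Rintegral _ _ _).
by rewrite setIidr// => x /=; rewrite !in_itv /= andbT => /andP[].
Unshelve. all: end_near. Qed.

End euler_summation.

(** The case m = 0 with the primitive normalised at the origin. *)
Lemma euler_summation0 (R : realType) (g g' G : R -> R) :
  (forall x : R, 0 < x -> is_derive x 1 g (g' x)) ->
  (forall x : R, 0 < x -> is_derive x 1 G (g x)) ->
  (forall x : R, 0 < x -> {for x, continuous g'}) ->
  measurable_fun setT g' -> G 0 = 0 ->
  G x @[x --> 0^'+] --> (0 : R) -> x * g x @[x --> 0^'+] --> (0 : R) ->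
  (@lebesgue_measure R).-integrable `]0, +oo[ (EFin \o (fun x => fract x * g' x)) ->
  (fun N => \sum_(1 <= k < N.+1) g k%:R - G N%:R) @ \oo -->
  \int[@lebesgue_measure R]_(x in `]0, +oo[) (fract x * g' x).
Proof.
move=> dg dG cg' mg' G0 cG0 xg0 ig'.
have cG : G x @[x --> 0^'+] --> G 0 by rewrite G0.
have xg : (x - 0) * g x @[x --> 0^'+] --> (0 : R).
  by under eq_cvg do rewrite subr0.
have := @euler_summation R g g' G 0 dg dG cg' mg' cG xg ig'.
rewrite (_ : (fun N => _ - _ + _) = fun N => \sum_(1 <= k < N.+1) g k%:R - G N%:R)//.
by apply/funext => N; rewrite G0 addr0.
Qed.

(** * The inner integral *)

Section bose.
Variable R : realType.
Notation mu := (@lebesgue_measure R).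
Implicit Types x y : R.

(** The Bose-Einstein function without its pole at 0. *)
Definition bose y : R := (expR y - 1)^-1 - y^-1.
Definition bose' y : R := y ^- 2 - expR y / (expR y - 1) ^+ 2.

(** The partial fractions of [coth_partial_fractions], as a function of a real x in place
    of k, and its first and mixed second derivatives. *)
Definition coth_term y x : R := 2 * y / (y ^+ 2 + (2 * pi * x) ^+ 2).
Definition coth_term_dx y x : R := - (4 * (2 * pi) ^+ 2 * x * y / (y ^+ 2 + (2 * pi * x) ^+ 2) ^+ 2).
Definition coth_term_dxdy y x : R := 8 * pi * (2 * pi * x) * (3 * y ^+ 2 - (2 * pi * x) ^+ 2)
  / (y ^+ 2 + (2 * pi * x) ^+ 2) ^+ 3.

Lemma coth_den_gt0 y x : 0 < y -> 0 < y ^+ 2 + (2 * pi * x) ^+ 2.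
Proof. by move=> y0; rewrite ltr_pwDl ?exprn_gt0// sqr_ge0. Qed.

Lemma der_coth_term y x : 0 < y -> is_derive x 1 (coth_term y) (coth_term_dx y x).
Proof.
move=> y0; have D := coth_den_gt0 x y0; rewrite /coth_term.
eapply der_eq; first by der; rewrite gt_eqF.
by rewrite /coth_term_dx; field; rewrite gt_eqF//; lra.
Qed.

Lemma der_coth_term_dx y x : 0 < y -> is_derive y 1 (coth_term_dx^~ x) (coth_term_dxdy y x).
Proof.
move=> y0; have D := coth_den_gt0 x y0; rewrite /coth_term_dx.
eapply der_eq; first by der; rewrite gt_eqF// exprn_gt0.
by rewrite /coth_term_dxdy; field; rewrite gt_eqF//; lra.
Qed.

Lemma cont_coth_term_dx y x : 0 < y -> {for x, continuous (coth_term_dx y)}.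
Proof.
move=> y0; have D := coth_den_gt0 x y0; rewrite /coth_term_dx.
by eapply is_derive_cont; der; rewrite gt_eqF// exprn_gt0.
Qed.

Lemma meas_coth_term_dx y : measurable_fun setT (coth_term_dx y).
Proof. by rewrite /coth_term_dx; mf. Qed.

Lemma coth_term_cvgy y : 0 < y -> coth_term y x @[x --> +oo] --> (0 : R).
Proof.
move=> y0; rewrite /coth_term -[X in _ --> X](mulr0 (2 * y)); apply: cvgMr.
have K : (fun t : R => 2 * pi * t) @ +oo --> +oo.
  by apply: gt0_cvgMry => //; rewrite mulr_gt0// pi_gt0.
apply/gtr0_cvgV0; first by near=> x; exact: coth_den_gt0.
have /cvgryPge/(_ 1) K1 := K; apply: ger_cvgy K; move: K1; apply: filterS => x.
by move: (2 * pi * x) => X X1; have := sqr_ge0 y; nra.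
Unshelve. all: end_near. Qed.

Lemma int_coth_term_dx y : 0 < y -> mu.-integrable `]0, +oo[ (EFin \o coth_term_dx y).
Proof.
move=> y0.
have H : mu.-integrable `]0, +oo[ (EFin \o (fun x => - coth_term_dx y x)).
  apply: (@integrable_oy R (fun x => - coth_term_dx y x) (fun x => - coth_term y x) 0 (- coth_term y 0) (- 0)).
  - by move=> x _; apply: der_opp; exact: der_coth_term.
  - by move=> x _; apply: cvgN; exact: cont_coth_term_dx.
  - by apply: meas_opp; exact: meas_coth_term_dx.
  - by apply: cvg_at_right_filter; apply: cvgN; exact: is_derive_cont (der_coth_term 0 y0).
  - by apply: cvgN; exact: coth_term_cvgy.
  - move=> x x0; rewrite /coth_term_dx opprK divr_ge0 ?sqr_ge0//.
    by apply: mulr_ge0 (ltW y0); apply: mulr_ge0 (ltW x0); rewrite mulr_ge0// sqr_ge0.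
apply: (eq_integrableR (measurable_pos R) _ (integrableNR (measurable_pos R) H)).
by move=> x _; rewrite opprK.
Qed.

Lemma int_fract_coth_term_dx y : 0 < y ->
  mu.-integrable `]0, +oo[ (EFin \o (fun x => fract x * coth_term_dx y x)).
Proof.
move=> y0; apply: (le_integrableR (measurable_pos R) _ (integrable_norm (int_coth_term_dx y0))).
  by apply: measurable_funTS; apply: measurable_funM; [apply: meas_fract|exact: meas_coth_term_dx].
move=> x _ /=; rewrite normrM ger0_norm ?fract_ge0// ler_piMl//; exact: fract_le1.
Qed.

(** Euler summation of [coth_term]: its primitive in x is pi^-1 atan(2 pi x / y), which tends to 1/2,
    and this 1/2 cancels the one of [coth_partial_fractions]. *)
Lemma bose_fract y : 0 < y -> \int[mu]_(x in `]0, +oo[) (fract x * coth_term_dx y x) = bose y.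
Proof.
move=> y0; have p0 := pi_gt0 R.
have K0 : 0 < 2 * pi / y by rewrite divr_gt0// mulr_gt0.
pose G x : R := pi^-1 * atan (2 * pi / y * x).
have dG x : is_derive x 1 G (coth_term y x).
  have D := coth_den_gt0 x y0; rewrite /G; eapply der_eq; first by der.
  move: p0 D; rewrite /coth_term; clear -y0; move: (pi : R) => p p0 D.
  by field; rewrite !gt_eqF//; lra.
have G0 : G 0 = 0 by rewrite /G mulr0 atan0 mulr0.
have := @euler_summation0 R (coth_term y) (coth_term_dx y) G (fun x _ => der_coth_term x y0) (fun x _ => dG x)
  (fun x _ => @cont_coth_term_dx y x y0) (meas_coth_term_dx y) G0 _ _ (int_fract_coth_term_dx y0).
have cG : G x @[x --> 0^'+] --> (0 : R) by exact: cvg_right_derive (dG 0) G0.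
have ch : x * coth_term y x @[x --> 0^'+] --> (0 : R).
  by eapply cvg_right_derive; [apply: der_mul (der_id 0) (der_coth_term 0 y0)|rewrite mul0r].
move=> /(_ cG ch) E1; have E2 := coth_partial_fractions y0.
have E3 : (fun N : nat => G N%:R) @ \oo --> (2^-1 : R).
  have <- : pi^-1 * (pi / 2) = 2^-1 :> R by rewrite mulrA mulVf ?mul1r// gt_eqF.
  rewrite /G.
  apply: cvgMr; apply: (@cvg_comp _ _ _ (fun N : nat => 2 * pi / y * N%:R) (@atan R) _ +oo).
    apply: (@cvg_comp _ _ _ (fun N : nat => N%:R : R) ( *%R (2 * pi / y)) _ +oo).
      exact: cvgr_idn.
    by apply: gt0_cvgMry.
  exact: cvgy_atan.
by rewrite (cvg_unique _ E1 (cvgB E2 E3)) /bose//; ring.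
Qed.

Definition bose_slope y := \int[mu]_(x in `]0, +oo[) (fract x * coth_term_dxdy y x).

(** A majorant uniform in y >= u, as needed to differentiate under the integral sign. *)
Lemma coth_term_dxdy_le u y x : 0 < u <= y -> 0 < x -> `|coth_term_dxdy y x| <= 3 / u * - coth_term_dx u x.
Proof.
move=> /andP[u0 uy] x0; have p0 := pi_gt0 R; rewrite /coth_term_dxdy /coth_term_dx opprK.
have X0 : 0 < 2 * pi * x by rewrite !mulr_gt0.
have -> : 4 * (2 * pi) ^+ 2 * x * u = 8 * pi * (2 * pi * x) * u by ring.
move: (2 * pi * x) X0 => X X0; have y0 := lt_le_trans u0 uy.
have u2 := exprn_gt0 2 u0; have y2 := exprn_gt0 2 y0; have X2 := exprn_gt0 2 X0.
have uy2 : u ^+ 2 <= y ^+ 2 by rewrite ler_pXn2r// nnegrE ltW.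
have -> : 3 / u * (8 * pi * X * u / (u ^+ 2 + X ^+ 2) ^+ 2) =
  8 * pi * X * (3 / (u ^+ 2 + X ^+ 2) ^+ 2).
  by move: ((u ^+ 2 + X ^+ 2) ^- 2) => D; field; rewrite gt_eqF.
rewrite -mulrA normrM (ger0_norm (_ : 0 <= 8 * pi * X)); last by rewrite !mulr_ge0// ltW.
rewrite ler_pM2l; last by rewrite !mulr_gt0.
have D0 : 0 < y ^+ 2 + X ^+ 2 by lra.
have E0 : 0 < u ^+ 2 + X ^+ 2 by lra.
apply: (@le_trans _ _ (3 / (y ^+ 2 + X ^+ 2) ^+ 2)); last first.
  rewrite ler_pM2l// lef_pV2 ?posrE ?exprn_gt0// ler_pXn2r ?nnegrE ?(ltW D0) ?(ltW E0)//; lra.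
have -> : 3 / (y ^+ 2 + X ^+ 2) ^+ 2 = 3 * (y ^+ 2 + X ^+ 2) / (y ^+ 2 + X ^+ 2) ^+ 3.
  by move: D0; move: (_ + _) => D D0; field; rewrite gt_eqF.
have V0 : 0 < (y ^+ 2 + X ^+ 2) ^- 3 by rewrite invr_gt0 exprn_gt0.
rewrite normrM (gtr0_norm V0) (ler_pM2r V0).
by rewrite ler_norml; apply/andP; split; lra.
Qed.

Lemma meas_coth_term_dxdy y : measurable_fun setT (coth_term_dxdy y).
Proof. by rewrite /coth_term_dxdy; mf. Qed.

(** Differentiation of [bose_fract] under the integral sign. *)
Lemma der_bose_slope y : 0 < y -> is_derive y 1 bose (bose_slope y).
Proof.
move=> y0; have mi := measurable_pos R; have u0 : 0 < y / 2 by rewrite divr_gt0.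
apply: (@near_eq_is_derive _ _ _ (fun t => \int[mu]_(x in `]0, +oo[) (fract x * coth_term_dx t x))).
  near=> t; apply: bose_fract; near: t; exact: lt_nbhsr.
have yuv : y / 2 < y < y + 1 by apply/andP; split; lra.
refine (@is_derive_under_integral _ _ _ mu _ (fun t x => fract x * coth_term_dx t x)
  (fun t x => fract x * coth_term_dxdy t x) _ _ _ (fun x => 3 / (y / 2) * - coth_term_dx (y / 2) x) mi yuv _ _ _ _).
- by move=> t /andP[t0 _]; apply: int_fract_coth_term_dx; exact: lt_trans t0.
- move=> t x /andP[t0 _] _.
  by refine (der_eq (der_mul (der_cst t (fract x)) (der_coth_term_dx x (lt_trans u0 t0))) _); rewrite mul0r add0r.
- exact (integrableZR _ mi (integrableNR mi (int_coth_term_dx u0))).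
- move=> t x /andP[/ltW t0 _]; rewrite /= in_itv /= andbT => x0.
  have ut : 0 < y / 2 <= t by rewrite u0.
  rewrite normrM ger0_norm ?fract_ge0//; apply: le_trans (coth_term_dxdy_le ut x0).
  by rewrite ler_piMl//; exact: fract_le1.
Unshelve. all: end_near. Qed.

Lemma der_bose y : 0 < y -> is_derive y 1 bose (bose' y).
Proof.
move=> y0; have e1 : 0 < expR y - 1 by rewrite subr_gt0 expR_gt1.
rewrite /bose; eapply der_eq.
  by der; rewrite gt_eqF.
by rewrite /bose'; field; rewrite !gt_eqF.
Qed.

Lemma bose_slopeE y : 0 < y -> bose_slope y = bose' y.
Proof.
by move=> y0; have [_ <-] := der_bose_slope y0; have [_ <-] := der_bose y0.
Qed.

End bose.

(** * The outer integral *)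

Section bose_sum.
Variable R : realType.
Notation mu := (@lebesgue_measure R).
Implicit Types x y : R.

Lemma sum_invsq_le2 N : \sum_(1 <= k < N.+1) ((k%:R : R) ^+ 2)^-1 <= 2.
Proof.
case: N => [|N]; first by rewrite big_geq.
rewrite big_ltn// expr1n invr1.
have := @sum_invsq_le R 1 N.+1 isT isT; rewrite invr1.
have : (0 : R) <= N.+1%:R^-1 by rewrite invr_ge0.
by move: (\sum_(_ <= _ < _) _) (_^-1) => s t; lra.
Qed.

(** bose y + 1/2 is the sum of the partial fractions, each at most (y / 2) / k^2. *)
Lemma bose_near0 y : 0 < y -> `|bose y + 2^-1| <= y.
Proof.
move=> y0; have p2 := pi_ge2 R; have H := coth_partial_fractions y0.
have -> : bose y + 2^-1 = (expR y - 1)^-1 + 2^-1 - y^-1 by rewrite /bose; ring.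
have D (k : nat) : 0 < y ^+ 2 + (2 * pi * k%:R) ^+ 2 by exact: coth_den_gt0.
rewrite ger0_norm; last first.
  apply: (cvgr_to_ge H); apply: nearW => N; apply: sumr_ge0 => k _.
  by rewrite divr_ge0 ?(ltW (D k))// mulr_ge0// ltW.
apply: (cvgr_to_le H); apply: nearW => N.
apply: (@le_trans _ _ (\sum_(1 <= k < N.+1) y / 2 * (k%:R ^+ 2)^-1)).
  rewrite big_nat_cond [leRHS]big_nat_cond; apply: ler_sum => k.
  rewrite andbT => /andP[k1 _]; have k0 : (0 : R) < k%:R by rewrite ltr0n.
  rewrite ler_pdivrMr//; have k2 : 0 < (k%:R : R) ^+ 2 by rewrite exprn_gt0.
  have -> : 2 * y = y / 2 / k%:R ^+ 2 * (4 * k%:R ^+ 2) by field; rewrite gt_eqF.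
  rewrite ler_pM2l ?divr_gt0//.
  have : 2 * k%:R <= pi * k%:R :> R by rewrite ler_pM2r.
  move: (k%:R) (pi : R) k0 k2 p2 => x p x0 x2 p2 xp.
  have := sqr_ge0 y; nra.
rewrite -mulr_sumr; have := sum_invsq_le2 N.
move: (\sum_(_ <= _ < _) _) => s; nra.
Qed.

Lemma bose_cvg0 : bose y @[y --> 0^'+] --> (- 2^-1 : R).
Proof.
have id0 : y @[y --> 0^'+] --> (0 : R) by exact: cvg_at_right_filter cvg_id.
have H1 : (fun y => - 2^-1 - y) @ 0^'+ --> (- 2^-1 : R).
  by rewrite -[X in _ --> X](subr0 (- 2^-1)); apply: cvgB => //; exact: cvg_cst.
have H2 : (fun y => - 2^-1 + y) @ 0^'+ --> (- 2^-1 : R).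
  by rewrite -[X in _ --> X](addr0 (- 2^-1)); apply: cvgD => //; exact: cvg_cst.
apply: (squeeze_cvgr _ H1 H2); near=> y.
have y0 : 0 < y by near: y; exact: nbhs_right_gt.
by have := bose_near0 y0; rewrite -{1}[2^-1]opprK ler_distl.
Unshelve. all: end_near. Qed.

Lemma inv_cvgy : y^-1 @[y --> +oo] --> (0 : R).
Proof.
by apply/gtr0_cvgV0; [near=> y; near: y; exact: nbhs_pinfty_gt|exact: cvg_id].
Unshelve. all: end_near. Qed.

Lemma bose_cvgy : bose y @[y --> +oo] --> (0 : R).
Proof.
rewrite /bose -[X in _ --> X](subr0 (0 : R)); apply: cvgB; last exact: inv_cvgy.
apply/gtr0_cvgV0.
  by near=> y; rewrite subr_gt0 expR_gt1; near: y; exact: nbhs_pinfty_gt.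
apply: (@ger_cvgy _ _ _ _ id); last exact: cvg_id.
by near=> y; rewrite lerBrDl; exact: expR_ge1Dx.
Unshelve. all: end_near. Qed.

(** The claim is y / 2 <= sinh(y / 2) in disguise. *)
Lemma bose'_ge0 y : 0 < y -> 0 <= bose' y.
Proof.
move=> y0; rewrite /bose' subr_ge0; have z0 : 0 < y / 2 by rewrite divr_gt0.
have e1 : 0 < expR y - 1 by rewrite subr_gt0 expR_gt1.
rewrite ler_pdivrMr ?exprn_gt0// ler_pdivlMl ?exprn_gt0//.
have -> : expR y = expR (y / 2) ^+ 2.
  by rewrite -expRM_natl; congr expR; field.
have [||c] := @MVT R (@sinh R) (@cosh R) 0 (y / 2) z0.
- by move=> x _; refine (der_eq (der_sinh (der_id x)) (mul1r _)).
- by apply: continuous_subspaceT => z; exact: is_derive_cont (der_sinh (der_id z)).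
rewrite sinh0 !subr0 => _ sE.
have s1 : y / 2 <= sinh (y / 2) by rewrite sE ler_peMl ?(ltW z0)//; exact: cosh_ge1.
move: s1; rewrite /sinh expRN; have := expR_gt0 (y / 2); move: (expR _) => e e0.
have -> : (e - e^-1) / 2 = (e ^+ 2 - 1) / e / 2 by field; rewrite gt_eqF.
rewrite ler_pM2r ?invr_gt0// ler_pdivlMr// => h.
have ye := mulr_gt0 y0 e0; rewrite -exprMn ler_pXn2r// nnegrE ?(ltW ye)//.
by apply: le_trans h; exact: ltW.
Qed.

Lemma meas_bose' : measurable_fun setT (@bose' R).
Proof. by rewrite /bose'; mf. Qed.

Lemma cont_bose' y : 0 < y -> {for y, continuous (@bose' R)}.
Proof.
move=> y0; have e1 : 0 < expR y - 1 by rewrite subr_gt0 expR_gt1.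
by rewrite /bose'; eapply is_derive_cont; der; rewrite gt_eqF// exprn_gt0.
Qed.

(** A derivative of constant sign whose primitive has limits at both ends. *)
Lemma int_bose' : mu.-integrable `]0, +oo[ (EFin \o @bose' R).
Proof.
apply: (@integrable_oy R (@bose' R) (@bose R) 0 (- 2^-1) 0).
- exact: der_bose.
- exact: cont_bose'.
- exact: meas_bose'.
- exact: bose_cvg0.
- exact: bose_cvgy.
- exact: bose'_ge0.
Qed.

Lemma int_fract_bose' : mu.-integrable `]0, +oo[ (EFin \o (fun y => fract y * bose' y)).
Proof.
apply: (le_integrableR (measurable_pos R) _ (integrable_norm int_bose')).
  by apply: measurable_funTS; apply: measurable_funM; [apply: meas_fract|exact: meas_bose'].
move=> x _ /=; rewrite normrM ger0_norm ?fract_ge0// ler_piMl//; exact: fract_le1.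
Qed.

(** The primitive of [bose] that vanishes at the origin; at 0 it is ln 0 = 0 by convention,
    which agrees with its limit. *)
Definition bose_prim y : R := ln ((1 - expR (- y)) / y).

Lemma der_bose_prim y : 0 < y -> is_derive y 1 bose_prim (bose y).
Proof.
move=> y0; have e1 : 0 < 1 - expR (- y) by rewrite subr_gt0 expR_lt1 oppr_lt0.
rewrite /bose_prim; eapply der_eq.
  by der; rewrite ?gt_eqF// divr_gt0.
rewrite /bose; move: e1; rewrite expRN; have := expR_gt0 y; move: (expR y) => e e0.
have -> : 1 - e^-1 = (e - 1) / e by field; rewrite gt_eqF.
move=> h; have e1 : 0 < e - 1 by have := mulr_gt0 h e0; rewrite divfK ?gt_eqF.
by field; rewrite !gt_eqF.
Qed.

Lemma bose_prim_cvg0 : bose_prim y @[y --> 0^'+] --> (0 : R).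
Proof.
rewrite /bose_prim -[X in _ --> X](@ln1 R).
apply: (@cvg_comp _ _ _ (fun y : R => (1 - expR (- y)) / y) (@ln R) _ (nbhs (1 : R))); last first.
  by apply: continuous_ln.
have H1 : (fun y : R => (1 + y)^-1) @ 0^'+ --> (1 : R).
  eapply cvg_right_derive; first by der; rewrite addr0 oner_neq0.
  by rewrite addr0 invr1.
have H2 : (fun y : R => 1 : R) @ 0^'+ --> (1 : R) by exact: cvg_cst.
apply: (squeeze_cvgr _ H1 H2); near=> y.
have y0 : 0 < y by near: y; exact: nbhs_right_gt.
have e1 := expR_ge1Dx y; have e2 := expR_ge1Dx (- y); have e0 := expR_gt0 y.
rewrite ler_pdivlMr// ler_pdivrMr// mul1r; apply/andP; split; last by lra.
rewrite mulrC ler_pdivrMr; last by lra.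
rewrite expRN mulrC -subr_ge0 (_ : _ - y = (expR y - 1 - y) / expR y); last by field; rewrite gt_eqF.
by rewrite divr_ge0 ?(ltW e0)//; lra.
Unshelve. all: end_near. Qed.

Lemma ybose_cvg0 : y * bose y @[y --> 0^'+] --> (0 : R).
Proof.
rewrite -[X in _ --> X](mul0r (- 2^-1)); apply: cvgM; last exact: bose_cvg0.
exact: cvg_at_right_filter cvg_id.
Qed.

(** Euler summation of [bose] compares the difference of the sum of 1 / (e^k - 1) and the
    harmonic sum with ln(1 - e^(-N)) - ln N. As the first sum converges, so does the
    harmonic sum minus ln N, and its limit is Euler's constant by definition. *)
Lemma sum_bose : exists2 S : R,
  (fun N => \sum_(1 <= k < N.+1) (expR (k%:R : R) - 1)^-1) @ \oo --> S &
  \int[mu]_(y in `]0, +oo[) (fract y * bose' y) = S - euler_gamma R.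
Proof.
pose u (N : nat) : R := \sum_(1 <= k < N.+1) (expR (k%:R : R) - 1)^-1.
have b0 (k : nat) : (0 < k)%N -> (expR (k%:R : R) - 1)^-1 <= 4 * (k%:R ^+ 2)^-1.
  move=> k1; have k0 : (0 : R) < k%:R by rewrite ltr0n.
  have h : k%:R ^+ 2 / 4 <= expR (k%:R : R) - 1.
    have -> : expR (k%:R : R) = expR (k%:R / 2) ^+ 2.
      by rewrite -expRM_natl; congr expR; field.
    move: (k%:R : R) k0 => x x0; have := expR_ge1Dx (x / 2); move: (expR (x / 2)) => e h; nra.
  have k2 : 0 < (k%:R : R) ^+ 2 / 4 by rewrite divr_gt0// exprn_gt0.
  have -> : 4 * (k%:R ^+ 2)^-1 = (k%:R ^+ 2 / 4)^-1 :> R by field; rewrite gt_eqF.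
  by rewrite lef_pV2// posrE; exact: lt_le_trans h.
have [S uS] : exists S : R, u @ \oo --> S.
  exists (limn u); apply: (@nondecreasing_is_cvgn R u); last first.
    exists 8 => _ [N _ <-]; rewrite /u.
    apply: (@le_trans _ _ (\sum_(1 <= k < N.+1) 4 * (k%:R ^+ 2)^-1)).
      rewrite big_nat_cond [leRHS]big_nat_cond; apply: ler_sum => k.
      by rewrite andbT => /andP[k1 _]; exact: b0.
    by rewrite -mulr_sumr; have := sum_invsq_le2 N; move: (\sum_(_ <= _ < _) _) => s; lra.
  apply/nondecreasing_seqP => N; rewrite /u [leRHS]big_nat_recr//= lerDl invr_ge0.
  by rewrite subr_ge0 ltW// expR_gt1 ltr0n.
exists S => //.
have G0 : bose_prim 0 = 0 by rewrite /bose_prim oppr0 expR0 subrr mul0r ln0.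
have := @euler_summation0 R (@bose R) (@bose' R) bose_prim (@der_bose R) der_bose_prim cont_bose' meas_bose' G0
  bose_prim_cvg0 ybose_cvg0 int_fract_bose'.
set I := \int[mu]_(y in _) _ => HI.
have HL : (fun N : nat => ln (1 - expR (- (N%:R : R)))) @ \oo --> (0 : R).
  rewrite -[X in _ --> X](@ln1 R).
  apply: (@cvg_comp _ _ _ (fun N : nat => 1 - expR (- (N%:R : R))) (@ln R) _ (nbhs (1 : R))); last first.
    by apply: continuous_ln.
  rewrite -[X in _ `=>` nbhs X](subr0 (1 : R)); apply: cvgB; first exact: cvg_cst.
  apply: (@cvg_comp _ _ _ (fun N : nat => N%:R : R) (fun x => expR (- x)) _ +oo); first exact: cvgr_idn.
  exact: cvgr_expR.
have E (N : nat) : (0 < N)%N -> u N - (\sum_(1 <= k < N.+1) bose (k%:R : R) - bose_prim N%:R)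
    - ln (1 - expR (- (N%:R : R))) = (\sum_(1 <= k < N.+1) k%:R^-1) - ln (N%:R : R).
  move=> N1; have N0 : (0 : R) < N%:R by rewrite ltr0n.
  have e0 : 0 < 1 - expR (- (N%:R : R)) by rewrite subr_gt0 expR_lt1 oppr_lt0.
  rewrite /bose_prim (ln_div e0 N0) /bose sumrB -/(u N).
  move: (u N) (\sum_(_ <= _ < _) _) (ln (1 - expR (- (N%:R : R)))) (ln (N%:R : R)) => a b c d; ring.
have HG : (fun n : nat => (\sum_(1 <= k < n.+1) k%:R^-1) - ln (n%:R : R)) @ \oo --> S - I.
  rewrite -[X in _ --> X](subr0 (S - I)).
  apply: cvg_trans (cvgB (cvgB uS HI) HL).
  apply: near_eq_cvg; near=> N.
  by apply: E; near: N; exact: nbhs_infty_gt.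
have -> : euler_gamma R = S - I by exact: (cvg_lim (@Rhausdorff R) HG).
by rewrite opprB addrC subrK.
Unshelve. all: end_near. Qed.

End bose_sum.

Section evaluation.
Variable R : realType.
Notation mu := (@lebesgue_measure R).

(** Where sqrt(pi) comes from: the constant 1 / sqrt 2 of [kerG] times the square root of
    2 pi contributed by the phase ln(2 pi). *)
Lemma sqrt_pi : cos (pi / 2 / 2) * expR (ln (2 * pi) / 2) = Num.sqrt pi :> R.
Proof.
have [/andP[k0 _] [k2 _]] := @cos_quarter R; have p0 := pi_gt0 R.
rewrite -[LHS]gtr0_norm; last by rewrite mulr_gt0// expR_gt0.
rewrite -sqrtr_sqr exprMn k2 -expRM_natl; congr Num.sqrt.
rewrite (_ : 2%:R * (ln (2 * pi) / 2) = ln (2 * pi)); last by field.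
by rewrite lnK ?posrE ?mulr_gt0//; field.
Qed.

(** e^tau = 2 pi x / y at tau = ln(2 pi) + ln x - ln y, and the half-integral powers of x and y cancel. *)
Lemma Psi2_wkerG (x y : R) : 0 < x -> 0 < y ->
  Psi2 (x, y) * wkerG (ln (2 * pi) + (ln x - ln y)) =
  Num.sqrt pi * fract y * (fract x * coth_term_dxdy y x).
Proof.
move=> x0 y0; have p0 := pi_gt0 R; rewrite -sqrt_pi /Psi2 /Psi /wkerG /coth_term_dxdy /=.
have eL : expR (ln (2 * pi)) = 2 * pi :> R by rewrite lnK// posrE mulr_gt0.
have ex : expR (ln x) = x by rewrite lnK.
have ey : expR (ln y) = y by rewrite lnK.
have -> : expR (2 * (ln (2 * pi) + (ln x - ln y))) = (2 * pi * x / y) ^+ 2.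
  by rewrite expRM_natl !expRD expRN eL ex ey mulrA.
have H : expR (- (3 / 2 * ln x)) * expR (- (3 / 2 * ln y)) *
    expR ((ln (2 * pi) + (ln x - ln y)) / 2) = expR (ln (2 * pi) / 2) * (x^-1 * y^-1 ^+ 2).
  by rewrite -[in RHS]ex -[in RHS]ey -!expRN -expRM_natl -!expRD; congr expR; field.
apply: (@eq_trans _ _ (fract x * fract y * (4 * cos (pi / 2 / 2)) *
  (expR (- (3 / 2 * ln x)) * expR (- (3 / 2 * ln y)) * expR ((ln (2 * pi) + (ln x - ln y)) / 2)) *
  ((2 * pi * x / y) ^+ 2 * (3 - (2 * pi * x / y) ^+ 2) / (1 + (2 * pi * x / y) ^+ 2) ^+ 3))); first by ring.
rewrite H; have D := coth_den_gt0 x y0; move: (expR _) (cos _) (fract x) (fract y) => e k u w.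
move: p0 D; move: (pi : R) => p p0 D.
have -> : 1 + (2 * p * x / y) ^+ 2 = (y ^+ 2 + (2 * p * x) ^+ 2) / y ^+ 2 by field; rewrite gt_eqF.
have -> : 3 - (2 * p * x / y) ^+ 2 = (3 * y ^+ 2 - (2 * p * x) ^+ 2) / y ^+ 2 by field; rewrite gt_eqF.
move: D; move: (y ^+ 2 + _) (3 * _ - _) => D B D0.
by field; rewrite !gt_eqF.
Qed.

Lemma double_integral_value : exists2 S : R,
  (fun N => \sum_(1 <= k < N.+1) (expR (k%:R : R) - 1)^-1) @ \oo --> S &
  \int[mu]_(y in `]0, +oo[) \int[mu]_(x in `]0, +oo[)
    (Psi2 (x, y) * wkerG (ln (2 * pi) + (ln x - ln y))) = Num.sqrt pi * (S - euler_gamma R).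
Proof.
have mi := measurable_pos R.
have I (x : R) : `]0, +oo[%classic x <-> 0 < x by rewrite /= in_itv /= andbT.
have [S uS SE] := @sum_bose R; exists S => //; rewrite -SE.
rewrite -(RintegralZl _ mi (int_fract_bose' R)); apply: eq_RintegralR => y /I y0.
have hi : mu.-integrable `]0, +oo[ (EFin \o (fun x => fract x * coth_term_dxdy y x)).
  apply: (le_integrableR mi _ (integrableZR (3 / y) mi (integrableNR mi (int_coth_term_dx y0)))).
    by apply: measurable_funTS; apply: measurable_funM; [apply: meas_fract|exact: meas_coth_term_dxdy].
  move=> x /I x0; have yy : 0 < y <= y by rewrite y0 lexx.
  rewrite normrM ger0_norm ?fract_ge0//; apply: le_trans (coth_term_dxdy_le yy x0).
  by rewrite ler_piMl//; exact: fract_le1.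
rewrite (eq_RintegralR mu (fun x xD => Psi2_wkerG (proj1 (I x) xD) y0)).
by rewrite (RintegralZl _ mi hi) -/(bose_slope y) (bose_slopeE y0); ring.
Qed.

End evaluation.

(** * Real-analytic functions *)

Section real_analytic.
Variable R : realType.
Implicit Types (f g : R -> R) (c : nat -> R) (x t r : R).

Definition real_analytic f x := exists c r, 0 < r /\
  forall t, `|t| < r -> series (fun k => c k * t ^+ k) @ \oo --> f (x + t).

Lemma real_analytic_cst (a x : R) : real_analytic (fun=> a) x.
Proof.
exists (fun k => if k is 0%N then a else 0), 1; split => // t _.
rewrite -cvg_shiftS; apply: cvg_near_cst; apply: nearW => n.
by rewrite /series/= big_nat_recl// expr0 mulr1 big1 ?addr0// => i _; rewrite mul0r.
Qed.

Lemma real_analyticD f g x : real_analytic f x -> real_analytic g x ->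
  real_analytic (fun t => f t + g t) x.
Proof.
move=> [c [r [r0 fr]]] [d [s [s0 gs]]].
exists (fun k => c k + d k), (Num.min r s); split; first by rewrite lt_min r0.
move=> t; rewrite lt_min => /andP[tr ts].
rewrite [X in X @ _ --> _](_ : _ = (series (fun k => c k * t ^+ k) \+
  series (fun k => d k * t ^+ k))); first exact: cvgD (fr t tr) (gs t ts).
apply/funext => n; rewrite /series /= -big_split /=; apply: eq_bigr => i _; exact: mulrDl.
Qed.

Lemma real_analyticZ (k : R) f x : real_analytic f x -> real_analytic (fun t => k * f t) x.
Proof.
move=> [c [r [r0 fr]]]; exists (fun j => k * c j), r; split => // t tr.
rewrite [X in X @ _ --> _](_ : _ = fun n => k * series (fun j => c j * t ^+ j) n).
  exact: cvgMr (fr t tr).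
apply/funext => n; rewrite /series /= mulr_sumr; apply: eq_bigr => i _.
by rewrite mulrA.
Qed.

Lemma real_analytic_pos f g x : 0 < x -> (forall t, 0 < t -> g t = f t) ->
  real_analytic f x -> real_analytic g x.
Proof.
move=> x0 fg [c [r [r0 fr]]]; exists c, (Num.min r x); split; first by rewrite lt_min r0.
move=> t; rewrite lt_min => /andP[tr]; rewrite ltr_norml => /andP[tx _].
by rewrite fg; [exact: fr|lra].
Qed.

Lemma real_analytic_mul1B f x : real_analytic f x ->
  real_analytic (fun t => (1 - t) * f t) x.
Proof.
move=> [c [r [r0 fr]]].
exists (fun k => (1 - x) * c k - (if k is j.+1 then c j else 0)), r; split => // t tr.
rewrite -cvg_shiftS.
have E n : series (fun k => ((1 - x) * c k - (if k is j.+1 then c j else 0)) * t ^+ k) n.+1 =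
    (1 - x) * series (fun k => c k * t ^+ k) n.+1 - t * series (fun k => c k * t ^+ k) n.
  elim: n => [|n IH]; first by rewrite /series/= !big_nat1 big_geq//; ring.
  have SE (d : nat -> R) k : series d k.+1 = series d k + d k by rewrite /series/= big_nat_recr.
  rewrite (SE _ n.+1) IH (SE (fun k => c k * t ^+ k) n.+1) (SE (fun k => c k * t ^+ k) n).
  by rewrite !exprS; ring.
rewrite [X in X @ _ --> _](funext E).
have -> : (1 - (x + t)) * f (x + t) = (1 - x) * f (x + t) - t * f (x + t) by ring.
have h := fr t tr; apply: cvgB; apply: cvgMr => //.
by rewrite (cvg_shiftS (series (fun k => c k * t ^+ k))).
Qed.

(** Terms of a convergent power series are bounded at a point p, so the sum differs from
    its constant term by O(t) as t tends to 0. *)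
Lemma power_series_coef0 c r : 0 < r ->
  (forall t, 0 < t < r -> series (fun k => c k * t ^+ k) @ \oo --> (0 : R)) -> c 0%N = 0.
Proof.
move=> r0 h; set p := r / 2; have p0 : 0 < p by rewrite divr_gt0.
have pr : 0 < p < r by apply/andP; split; rewrite /p; lra.
have [M [M0 Mb]] : exists M, 0 < M /\ forall k, `|c k * p ^+ k| <= M.
  have hp := h p pr.
  have : (fun k => c k * p ^+ k) @ \oo --> (0 : R).
    by apply: cvg_series_cvg_0; apply/cvg_ex; exists 0.
  move/(@cvgP _ _ _)/cvg_seq_bounded => -[M0 [_ MM]].
  exists (`|M0| + 1); split; first by rewrite ltr_pwDr.
  by move=> k; apply: MM => //; rewrite (le_lt_trans (ler_norm _))// ltrDl.
have b t : 0 < t <= p / 2 -> `|c 0%N| <= 2 * M / p * t.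
  move=> /andP[t0 tp]; have tr : 0 < t < r by rewrite t0/=; lra.
  set z := t / p; have z0 : 0 < z by rewrite divr_gt0.
  have z1 : z <= 1 / 2 by rewrite ler_pdivrMr//; lra.
  have H n : `|series (fun k => c k * t ^+ k) n.+1 - c 0%N| <= M * (2 * z).
    rewrite /series /= big_nat_recl// expr0 mulr1 addrAC subrr add0r.
    apply: (le_trans (ler_norm_sum _ _ _)).
    apply: (@le_trans _ _ (\sum_(0 <= k < n) M * z ^+ k.+1)).
      apply: ler_sum => k _; have -> : c k.+1 * t ^+ k.+1 = c k.+1 * p ^+ k.+1 * z ^+ k.+1.
        by rewrite -mulrA -exprMn /z mulrCA divff ?gt_eqF// mulr1.
      by rewrite normrM [`|z ^+ _|]ger0_norm ?ler_wpM2r ?exprn_ge0 ?(ltW z0).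
    rewrite -mulr_sumr ler_pM2l//.
    have : (1 - z) * \sum_(0 <= k < n) z ^+ k.+1 = z - z ^+ n.+1.
      elim: n => [|n IH]; first by rewrite big_nil expr1; ring.
      by rewrite big_nat_recr//= mulrDr IH !exprS; ring.
    have : 0 <= z ^+ n.+1 by rewrite exprn_ge0// ltW.
    move: (\sum_(_ <= _ < _) _) (z ^+ _) => s u u0 E; nra.
  have hc : (fun n => `|series (fun k => c k * t ^+ k) n.+1 - c 0%N|) @ \oo --> `|0 - c 0%N|.
    apply: cvg_norm; apply: cvgB; last exact: cvg_cst.
    by rewrite (cvg_shiftS (series (fun k => c k * t ^+ k))); exact: h.
  have : `|0 - c 0%N| <= M * (2 * z) by apply: (cvgr_to_le hc); exact: nearW.
  rewrite sub0r normrN => q; apply: (le_trans q).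
  by rewrite /z; apply: le_of_eq; field; rewrite gt_eqF.
apply/eqP; rewrite -normr_le0; apply/ler_addgt0Pl => e e0; rewrite addr0.
set K := 2 * M / p; have K0 : 0 < K by rewrite divr_gt0// mulr_gt0.
have t0 : 0 < Num.min (p / 2) (e / K) <= p / 2.
  by rewrite lt_min ge_min lexx (divr_gt0 p0)// (divr_gt0 e0 K0).
apply: (le_trans (b _ t0)); rewrite -/K mulrC -ler_pdivlMr//.
by rewrite ge_min lexx orbT.
Qed.

(** Divide by t, which shifts the coefficients. *)
Lemma power_series_coef c r k : 0 < r ->
  (forall t, 0 < t < r -> series (fun k => c k * t ^+ k) @ \oo --> (0 : R)) -> c k = 0.
Proof.
move=> r0; elim: k c => [|k IH] c h; first exact: power_series_coef0 h.
apply: (IH (fun j => c j.+1)) => t tr; have /andP[t0 _] := tr.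
have c0 := power_series_coef0 r0 h.
rewrite -[X in _ --> X](mulr0 t^-1).
rewrite [X in X @ _ --> _](_ : _ = fun n => t^-1 * series (fun j => c j * t ^+ j) n.+1).
  by apply: cvgMr; rewrite (cvg_shiftS (series (fun j => c j * t ^+ j))); exact: h.
apply/funext => n; rewrite /series /= big_nat_recl// c0 mul0r add0r mulr_sumr.
by apply: eq_bigr => j _; rewrite exprS; field; rewrite gt_eqF.
Qed.

(** At the supremum of the positive points where f does not vanish, the power series of f is zero
    to the right, hence everywhere, a contradiction. *)
Lemma identity_theorem f : (forall x, 0 < x -> real_analytic f x) ->
  (forall x, 1 < x -> f x = 0) -> forall x, 0 < x -> f x = 0.
Proof.
move=> fa f1 x x0; apply/eqP/negPn/negP => /eqP fx.
pose S := [set y | 0 < y /\ f y != 0].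
have Sx : S x by split => //; apply/eqP.
have ubS : has_ubound S.
  by exists 1 => y [_ fy]; rewrite leNgt; apply/negP => /f1 E; rewrite E eqxx in fy.
have supS : has_sup S by split; [exists x|].
have m0 : 0 < sup S by apply: lt_le_trans x0 _; exact: ub_le_sup.
have fm t : 0 < t -> f (sup S + t) = 0.
  move=> t0; apply/eqP/negPn/negP => ft.
  have : S (sup S + t) by split => //; rewrite addr_gt0.
  by move/(ub_le_sup ubS); rewrite gerDl leNgt t0.
have [c [r [r0 h]]] := fa _ m0.
have c0 k : c k = 0.
  apply: (power_series_coef k r0) => t /andP[t0 tr].
  by rewrite -(fm t t0); apply: h; rewrite gtr0_norm.
have [y [y0 fy] ym] := sup_adherent r0 supS.
have ys : y <= sup S by exact: ub_le_sup.
have yr : `|y - sup S| < r by rewrite distrC ger0_norm ?subr_ge0//; lra.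
have H : series (fun k => c k * (y - sup S) ^+ k) = fun=> 0.
  by apply/funext => n; rewrite /series /= big1// => k _; rewrite c0 mul0r.
have := h _ yr; rewrite H addrC subrK => E.
have : f y = 0 by apply: cvg_unique E _ => //; exact: cvg_cst.
by move=> fy0; rewrite fy0 eqxx in fy.
Qed.

End real_analytic.

Section laplace.
Variable R : realType.
Notation mu := (@lebesgue_measure R).
Implicit Types x s t : R.

Lemma series_exp_cvg x : series (exp_coeff x) @ \oo --> expR x.
Proof. exact: is_cvg_series_exp_coeff. Qed.

Lemma series_exp_le x n : `|series (exp_coeff x) n| <= expR `|x|.
Proof.
apply: (@le_trans _ _ (series (exp_coeff `|x|) n)).
  rewrite /series /=; apply: (le_trans (ler_norm_sum _ _ _)).
  apply: ler_sum => k _; rewrite /exp_coeff /= normrM normrX.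
  by rewrite [X in _ * X <= _]ger0_norm ?invr_ge0.
apply: nondecreasing_cvgn_le; last exact: is_cvg_series_exp_coeff.
by apply/nondecreasing_seqP => k; rewrite seriesSr lerDl exp_coeff_ge0.
Qed.

Lemma exp_term_le x n : 0 <= x -> x ^+ n / n`!%:R <= expR x.
Proof.
move=> x0; have := series_exp_le x n.+1; rewrite (ger0_norm x0).
rewrite (_ : series (exp_coeff x) n.+1 = series (exp_coeff x) n + x ^+ n / n`!%:R).
  apply: le_trans; apply: le_trans (ler_norm _); rewrite lerDr.
  by apply: sumr_ge0 => k _; exact: exp_coeff_ge0.
by rewrite /series /= big_nat_recr.
Qed.

Variable g : R -> R.
Hypothesis mg : measurable_fun setT g.
Hypothesis ig : forall s, 0 < s ->
  mu.-integrable `]1, +oo[ (EFin \o (fun x => g x * expR (- (s * ln x)))).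

(** Expand e^(-t ln x) in powers of t around s. For |t| <= s / 2 the partial sums are bounded by
    e^(|t| ln x), so dominated convergence with the integrand at s / 2 applies. *)
Lemma real_analytic_laplace s : 0 < s ->
  real_analytic (fun s => \int[mu]_(x in `]1, +oo[) (g x * expR (- (s * ln x)))) s.
Proof.
move=> s0; set r := s / 2; have r0 : 0 < r by rewrite divr_gt0.
have mi : measurable (`]1, +oo[ : set (measurableTypeR R)) by exact: measurable_itv.
pose G x := `|g x * expR (- (r * ln x))|.
have iG : mu.-integrable `]1, +oo[ (EFin \o G) by exact: integrable_norm (ig r0).
pose e k x := g x * expR (- (s * ln x)) * ((- ln x) ^+ k / k`!%:R).
have me k : measurable_fun setT (e k).
  by rewrite /e; mf.
have lnp x : `]1, +oo[%classic x -> 0 <= ln x.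
  by rewrite /= in_itv /= andbT => x1; rewrite ln_ge0// ltW.
have eG x t : `|t| <= r -> 0 <= ln x -> `|g x * expR (- (s * ln x))| * expR (`|t| * ln x) <= G x.
  move=> tr l0; rewrite /G !normrM -mulrA ler_wpM2l//.
  rewrite [`|expR (- (s * _))|]ger0_norm ?expR_ge0// [leRHS]ger0_norm ?expR_ge0//.
  rewrite -expRD ler_expR; have : `|t| * ln x <= r * ln x by rewrite ler_wpM2r.
  by have -> : s = r + r by [rewrite /r; field]; lra.
have ie k : mu.-integrable `]1, +oo[ (EFin \o e k).
  apply: (le_integrableR mi _ (integrableZR (r ^- k) mi iG)).
    exact: measurable_funTS (me k).
  move=> x /lnp l0; have rr : `|r| <= r by rewrite gtr0_norm.
  rewrite /e normrM ler_pdivlMl ?exprn_gt0//; apply: le_trans (eG x r rr l0).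
  rewrite mulrCA ler_wpM2l// (gtr0_norm r0).
  rewrite normrM normrX normrN (ger0_norm l0) [`|_^-1|]ger0_norm ?invr_ge0//.
  by rewrite mulrA -exprMn; apply: exp_term_le; rewrite mulr_ge0// ltW.
exists (fun k => \int[mu]_(x in `]1, +oo[) e k x), r; split => // t /ltW tr.
have E n : series (fun k => (\int[mu]_(x in `]1, +oo[) e k x) * t ^+ k) n =
  \int[mu]_(x in `]1, +oo[) (g x * expR (- (s * ln x)) * series (exp_coeff (- (t * ln x))) n) /\
  mu.-integrable `]1, +oo[
    (EFin \o (fun x => g x * expR (- (s * ln x)) * series (exp_coeff (- (t * ln x))) n)).
  elim: n => [|n [IH In]].
    rewrite /series /= big_geq//; split.
      rewrite (@eq_RintegralR _ _ _ mu _ _ (fun=> 0)); last by move=> x _; rewrite big_geq// mulr0.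
      by rewrite /Rintegral integral0.
    apply: (eq_integrableR mi (f := fun=> 0)); last exact: integrable0.
    by move=> x _; rewrite big_geq// mulr0.
  have SE (d : nat -> R) k : series d k.+1 = series d k + d k by rewrite /series/= big_nat_recr.
  have F x : g x * expR (- (s * ln x)) * series (exp_coeff (- (t * ln x))) n.+1 =
    g x * expR (- (s * ln x)) * series (exp_coeff (- (t * ln x))) n + t ^+ n * e n x.
    rewrite SE mulrDr; congr (_ + _); rewrite /exp_coeff /= /e.
    have -> : (- (t * ln x)) ^+ n = t ^+ n * (- ln x) ^+ n by rewrite -exprMn mulrN.
    by ring.
  have In' := integrableZR (t ^+ n) mi (ie n).
  split; last by apply: (eq_integrableR mi _ (integrableDR mi In In')) => x _; rewrite F.
  rewrite (eq_RintegralR mu (fun x _ => F x)) (RintegralD mi In In') -IH.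
  by rewrite (RintegralZl _ mi (ie n)) SE [X in _ + X]mulrC.
rewrite [X in X @ _ --> _](funext (fun n => proj1 (E n))).
have [||||_] := @Rdominated_cvg _ _ _ mu `]1, +oo[
  (fun n x => g x * expR (- (s * ln x)) * series (exp_coeff (- (t * ln x))) n)
  (fun x => g x * expR (- ((s + t) * ln x))) G mi.
- move=> n; have [_ /integrableP[/measurable_EFinP]] := E n; by [].
- move=> x _; rewrite (_ : - ((s + t) * ln x) = - (s * ln x) + - (t * ln x)); last by ring.
  by rewrite expRD mulrA; apply: cvgMr; exact: series_exp_cvg.
- exact: iG.
- move=> n x /lnp l0; apply: le_trans (eG x t tr l0); rewrite normrM ler_wpM2l//.
  by apply: le_trans (series_exp_le _ _) _; rewrite normrN normrM (ger0_norm l0).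
by [].
Qed.

End laplace.

(** * The zeta function on the critical line *)

Section dirichlet.
Variable R : realType.
Notation mu := (@lebesgue_measure R).
Variable v : R.
Hypothesis v0 : v != 0.
Implicit Types s x : R.

(** x^(-s - iv) = [pow_cos s x] - i [pow_sin s x]. *)
Definition pow_cos s x : R := expR (- (s * ln x)) * cos (v * ln x).
Definition pow_sin s x : R := expR (- (s * ln x)) * sin (v * ln x).
Definition pow_cos' s x : R := x^-1 * (- s * pow_cos s x - v * pow_sin s x).
Definition pow_sin' s x : R := x^-1 * (v * pow_cos s x - s * pow_sin s x).
Definition sqdist s : R := (1 - s) ^+ 2 + v ^+ 2.
(** The real part and minus the imaginary part of x^(1 - s - iv) / (1 - s - iv), with [sqdist] = |1 - s - iv|^2. *)
Definition pow_cos_prim s x : R := x * ((1 - s) * pow_cos s x + v * pow_sin s x) / sqdist s.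
Definition pow_sin_prim s x : R := x * ((1 - s) * pow_sin s x - v * pow_cos s x) / sqdist s.

Lemma sqdist_gt0 s : 0 < sqdist s.
Proof. by rewrite ltr_wpDl ?sqr_ge0// exprn_even_gt0. Qed.

Lemma der_pow_cos s x : 0 < x -> is_derive x 1 (pow_cos s) (pow_cos' s x).
Proof.
move=> x0; rewrite /pow_cos; eapply der_eq; first by der.
by rewrite /pow_cos' /pow_cos /pow_sin; field; rewrite gt_eqF.
Qed.

Lemma der_pow_sin s x : 0 < x -> is_derive x 1 (pow_sin s) (pow_sin' s x).
Proof.
move=> x0; rewrite /pow_sin; eapply der_eq; first by der.
by rewrite /pow_sin' /pow_cos /pow_sin; field; rewrite gt_eqF.
Qed.

Lemma der_pow_cos_prim s x : 0 < x -> is_derive x 1 (pow_cos_prim s) (pow_cos s x).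
Proof.
move=> x0; have := sqdist_gt0 s; have d1 := der_pow_cos s x0; have d2 := der_pow_sin s x0.
rewrite /pow_cos_prim => D0.
refine (der_eq (der_mul (der_mul (der_id x) (der_add (der_mul (der_cst x (1 - s)) d1) (der_mul (der_cst x v) d2)))
  (der_cst x (sqdist s)^-1)) _).
rewrite /pow_cos' /pow_sin'; move: (pow_cos s x) (pow_sin s x) => p q; rewrite mulr0 addr0.
rewrite -[RHS](mulfK (lt0r_neq0 D0)); congr (_ / _).
by rewrite /sqdist; field; rewrite gt_eqF.
Qed.

Lemma der_pow_sin_prim s x : 0 < x -> is_derive x 1 (pow_sin_prim s) (pow_sin s x).
Proof.
move=> x0; have := sqdist_gt0 s; have d1 := der_pow_cos s x0; have d2 := der_pow_sin s x0.
rewrite /pow_sin_prim => D0.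
refine (der_eq (der_mul (der_mul (der_id x) (der_add (der_mul (der_cst x (1 - s)) d2) (der_opp (der_mul (der_cst x v) d1))))
  (der_cst x (sqdist s)^-1)) _).
rewrite /pow_cos' /pow_sin'; move: (pow_cos s x) (pow_sin s x) => p q; rewrite mulr0 addr0.
rewrite -[RHS](mulfK (lt0r_neq0 D0)); congr (_ / _).
by rewrite /sqdist; field; rewrite gt_eqF.
Qed.

Lemma cont_pow_cos' s x : 0 < x -> {for x, continuous (pow_cos' s)}.
Proof.
move=> x0; rewrite /pow_cos' /pow_cos /pow_sin.
by eapply is_derive_cont; der; rewrite ?gt_eqF.
Qed.

Lemma cont_pow_sin' s x : 0 < x -> {for x, continuous (pow_sin' s)}.
Proof.
move=> x0; rewrite /pow_sin' /pow_cos /pow_sin.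
by eapply is_derive_cont; der; rewrite ?gt_eqF.
Qed.

Lemma meas_pow_cos' s : measurable_fun setT (pow_cos' s).
Proof. by rewrite /pow_cos' /pow_cos /pow_sin; mf. Qed.

Lemma meas_pow_sin' s : measurable_fun setT (pow_sin' s).
Proof. by rewrite /pow_sin' /pow_cos /pow_sin; mf. Qed.

Lemma ln_cvgy : ln x @[x --> +oo] --> (+oo : set_system R).
Proof.
apply/cvgryPge => A; near=> x.
have xA : expR A <= x by near: x; exact: nbhs_pinfty_ge.
by rewrite -[A]expRK ler_ln ?posrE ?expR_gt0// (lt_le_trans _ xA)// expR_gt0.
Unshelve. all: end_near. Qed.

Lemma exp_ln_cvgy s : 0 < s -> expR (- (s * ln x)) @[x --> +oo] --> (0 : R).
Proof.
move=> s0; apply: (@cvg_comp _ _ _ (@ln R) (fun t => expR (- (s * t))) _ +oo).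
  exact: ln_cvgy.
exact: cvg_expNy.
Qed.

Lemma int_pow s : 0 < s ->
  mu.-integrable `]1, +oo[ (EFin \o (fun x => x^-1 * expR (- (s * ln x)))).
Proof.
move=> s0; apply: (@integrable_oy R (fun x => x^-1 * expR (- (s * ln x)))
  (fun x => - s^-1 * expR (- (s * ln x))) 1 (- s^-1) (- s^-1 * 0)).
- move=> x x1; have x0 : 0 < x by rewrite (lt_trans _ x1).
  by eapply der_eq; [der|field; rewrite !gt_eqF].
- move=> x x1; have x0 : 0 < x by rewrite (lt_trans _ x1).
  by eapply is_derive_cont; der; rewrite ?gt_eqF.
- by mf.
- by eapply cvg_right_derive; [der|rewrite ln1 mulr0 oppr0 expR0 mulr1].
- by apply: cvgMr; exact: exp_ln_cvgy.
- move=> x x1; have x0 : 0 < x by rewrite (lt_trans _ x1).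
  by rewrite mulr_ge0 ?expR_ge0// invr_ge0 ltW.
Qed.

Let gc x : R := fract x * x^-1 * cos (v * ln x).
Let gs x : R := fract x * x^-1 * sin (v * ln x).

Let int_dom s (h : R -> R) : 0 < s -> measurable_fun setT h -> (forall x, `|h x| <= 1) ->
  mu.-integrable `]1, +oo[ (EFin \o (fun x => fract x * x^-1 * h x * expR (- (s * ln x)))).
Proof.
move=> s0 mh h1; have mi : measurable (`]1, +oo[ : set (measurableTypeR R)) by exact: measurable_itv.
apply: (le_integrableR mi _ (int_pow s0)).
  by apply: measurable_funTS; mf.
move=> x; rewrite /= in_itv /= andbT => x1; have x0 : 0 < x by rewrite (lt_trans _ x1).
rewrite !normrM ger0_norm ?fract_ge0// [`|_^-1|]gtr0_norm ?invr_gt0//.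
rewrite (ger0_norm (expR_ge0 _)) ler_pM2r ?expR_gt0// mulrAC ler_piMl//.
  by rewrite invr_ge0 ltW.
by rewrite mulr_ile1 ?fract_ge0 ?fract_le1.
Qed.

Let int_gc s : 0 < s -> mu.-integrable `]1, +oo[ (EFin \o (fun x => gc x * expR (- (s * ln x)))).
Proof.
move=> s0; apply: int_dom => // [|x]; first by mf.
by rewrite ler_norml cos_geN1 cos_le1.
Qed.

Let int_gs s : 0 < s -> mu.-integrable `]1, +oo[ (EFin \o (fun x => gs x * expR (- (s * ln x)))).
Proof.
move=> s0; apply: int_dom => // [|x]; first by mf.
by rewrite ler_norml sin_geN1 sin_le1.
Qed.

(** [tail_cos] - i [tail_sin] is - (s + iv) times the integral of {x} x^(- s - iv - 1) over x > 1. *)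
Definition tail_cos s := \int[mu]_(x in `]1, +oo[) (fract x * pow_cos' s x).
Definition tail_sin s := \int[mu]_(x in `]1, +oo[) (fract x * pow_sin' s x).

Let Ac s := \int[mu]_(x in `]1, +oo[) (gc x * expR (- (s * ln x))).
Let As s := \int[mu]_(x in `]1, +oo[) (gs x * expR (- (s * ln x))).

Lemma tail_linear s : 0 < s ->
  [/\ mu.-integrable `]1, +oo[ (EFin \o (fun x => fract x * pow_cos' s x)),
      mu.-integrable `]1, +oo[ (EFin \o (fun x => fract x * pow_sin' s x)),
      tail_cos s = - s * Ac s + - v * As s & tail_sin s = v * Ac s + - s * As s].
Proof.
move=> s0; have mi : measurable (`]1, +oo[ : set (measurableTypeR R)) by exact: measurable_itv.
have ic := int_gc s0; have jn := int_gs s0.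
pose c x := gc x * expR (- (s * ln x)); pose d x := gs x * expR (- (s * ln x)).
have Ec x : fract x * pow_cos' s x = - s * c x + - v * d x.
  by rewrite /c /d /gc /gs /pow_cos' /pow_cos /pow_sin; ring.
have Es x : fract x * pow_sin' s x = v * c x + - s * d x.
  by rewrite /c /d /gc /gs /pow_sin' /pow_cos /pow_sin; ring.
have i1 := integrableZR (- s) mi ic; have i2 := integrableZR (- v) mi jn.
have i3 := integrableZR v mi ic; have i4 := integrableZR (- s) mi jn.
rewrite /tail_cos /tail_sin; split.
- by apply: (eq_integrableR mi _ (integrableDR mi i1 i2)) => x _; rewrite Ec.
- by apply: (eq_integrableR mi _ (integrableDR mi i3 i4)) => x _; rewrite Es.
- rewrite (eq_RintegralR mu (fun x _ => Ec x)) (RintegralD mi i1 i2).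
  by rewrite (RintegralZl _ mi ic) (RintegralZl _ mi jn).
- rewrite (eq_RintegralR mu (fun x _ => Es x)) (RintegralD mi i3 i4).
  by rewrite (RintegralZl _ mi ic) (RintegralZl _ mi jn).
Qed.

Lemma real_analytic_tail s : 0 < s -> real_analytic tail_cos s /\ real_analytic tail_sin s.
Proof.
move=> s0; have ac : real_analytic Ac s.
  by apply: real_analytic_laplace s0 => // ; rewrite /gc; mf.
have as_ : real_analytic As s.
  by apply: real_analytic_laplace s0 => // ; rewrite /gs; mf.
split.
  apply: (real_analytic_pos (f := fun t => (1 - t) * Ac t + -1 * Ac t + - v * As t)) => //.
    by move=> t t0; have [_ _ -> _] := tail_linear t0; ring.
  apply: real_analyticD; last exact: real_analyticZ.
  by apply: real_analyticD; [exact: real_analytic_mul1B|exact: real_analyticZ].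
apply: (real_analytic_pos (f := fun t => (1 - t) * As t + -1 * As t + v * Ac t)) => //.
  by move=> t t0; have [_ _ _ ->] := tail_linear t0; ring.
apply: real_analyticD; last exact: real_analyticZ.
by apply: real_analyticD; [exact: real_analytic_mul1B|exact: real_analyticZ].
Qed.

Lemma norm_pow_cos_sin_le s x : 0 < x -> `|pow_cos s x| <= expR (- (s * ln x)) /\ `|pow_sin s x| <= expR (- (s * ln x)).
Proof.
move=> x0; rewrite /pow_cos /pow_sin !normrM ger0_norm ?expR_ge0//.
by split; rewrite ler_piMr ?expR_ge0// ler_norml ?cos_geN1 ?cos_le1 ?sin_geN1 ?sin_le1.
Qed.

Lemma norm_pow_prim_le s x : 0 < x ->
  `|pow_cos_prim s x| <= (`|1 - s| + `|v|) / sqdist s * expR (- ((s - 1) * ln x)) /\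
  `|pow_sin_prim s x| <= (`|1 - s| + `|v|) / sqdist s * expR (- ((s - 1) * ln x)).
Proof.
move=> x0; have [c1 s1] := norm_pow_cos_sin_le s x0; have D0 := sqdist_gt0 s.
have -> : expR (- ((s - 1) * ln x)) = x * expR (- (s * ln x)).
  rewrite (_ : - ((s - 1) * ln x) = ln x + - (s * ln x)); last by ring.
  by rewrite expRD lnK.
move: c1 s1; set e := expR _ => c1 s1.
have K (p q : R) : `|p| <= e -> `|q| <= e ->
    `|x * ((1 - s) * p + v * q) / sqdist s| <= (`|1 - s| + `|v|) / sqdist s * (x * e).
  move=> pe qe; rewrite normrM [`|_^-1|]gtr0_norm ?invr_gt0// [leRHS]mulrAC ler_pM2r ?invr_gt0//.
  rewrite normrM (gtr0_norm x0) [leRHS]mulrCA ler_pM2l//.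
  apply: (le_trans (ler_normD _ _)); rewrite !normrM mulrDl.
  by apply: lerD; rewrite ler_wpM2l.
split; first exact: K.
have nc : `|- pow_cos s x| <= e by rewrite normrN.
by have := K _ _ s1 nc; rewrite mulrN.
Qed.

Lemma pow_cos_sin1 s : [/\ pow_cos s 1 = 1, pow_sin s 1 = 0, pow_cos_prim s 1 = (1 - s) / sqdist s &
  pow_sin_prim s 1 = - v / sqdist s].
Proof.
have c1 : pow_cos s 1 = 1 by rewrite /pow_cos ln1 !mulr0 oppr0 expR0 cos0 mulr1.
have s1 : pow_sin s 1 = 0 by rewrite /pow_sin ln1 !mulr0 sin0 mulr0.
by split=> //; rewrite /pow_cos_prim /pow_sin_prim c1 s1; congr (_ / _); ring.
Qed.

(** Euler summation from 1 of the two parts of x^(-s - iv), whose primitives tend to 0 at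
    infinity as s > 1. The relation is multiplied by [sqdist], a polynomial in s, to keep it
    real-analytic without division. *)
Lemma dirichlet_tail s (U V : R) : 1 < s ->
  series (fun n => pow_cos s n.+1%:R) @ \oo --> U ->
  series (fun n => pow_sin s n.+1%:R) @ \oo --> V ->
  sqdist s * (U - 1 - tail_cos s) + (1 - s) = 0 /\
  sqdist s * (V - tail_sin s) - v = 0.
Proof.
move=> s1 cU cV; have s0 : 0 < s by exact: lt_trans s1.
have D0 := sqdist_gt0 s; have [ic jn _ _] := tail_linear s0; have [c1 z1 C1 S1] := pow_cos_sin1 s.
have x0 (x : R) : 1 < x -> 0 < x by exact: lt_trans.

have d1 (x : R) : 1%:R < x -> is_derive x 1 (pow_cos s) (pow_cos' s x) by move/x0; exact: der_pow_cos.
have d2 (x : R) : 1%:R < x -> is_derive x 1 (pow_sin s) (pow_sin' s x) by move/x0; exact: der_pow_sin.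
have d3 (x : R) : 1%:R < x -> is_derive x 1 (pow_cos_prim s) (pow_cos s x) by move/x0; exact: der_pow_cos_prim.
have d4 (x : R) : 1%:R < x -> is_derive x 1 (pow_sin_prim s) (pow_sin s x) by move/x0; exact: der_pow_sin_prim.
have k1 (x : R) : 1%:R < x -> {for x, continuous (pow_cos' s)} by move/x0; exact: cont_pow_cos'.
have k2 (x : R) : 1%:R < x -> {for x, continuous (pow_sin' s)} by move/x0; exact: cont_pow_sin'.
have r1 := cvg_at_right_filter (is_derive_cont (der_pow_cos_prim s ltr01)).
have r2 := cvg_at_right_filter (is_derive_cont (der_pow_sin_prim s ltr01)).
have Ec := @euler_summation R _ _ _ 1 d1 d3 k1 (meas_pow_cos' s) r1.
have Es := @euler_summation R _ _ _ 1 d2 d4 k2 (meas_pow_sin' s) r2.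
have limc : (x - 1) * pow_cos s x @[x --> 1^'+] --> (0 : R).
  eapply cvg_right_derive; last by rewrite subrr mul0r.
  by apply: der_mul (der_pow_cos s ltr01); apply: der_add (der_id 1) (der_cst 1 (- 1)).
have lims : (x - 1) * pow_sin s x @[x --> 1^'+] --> (0 : R).
  eapply cvg_right_derive; last by rewrite subrr mul0r.
  by apply: der_mul (der_pow_sin s ltr01); apply: der_add (der_id 1) (der_cst 1 (- 1)).
have {}Ec := Ec limc ic; have {}Es := Es lims jn.
have s2 : 0 < s - 1 by rewrite subr_gt0.
set K := (`|1 - s| + `|v|) / sqdist s.
have KN : (fun N : nat => K * expR (- ((s - 1) * ln N%:R))) @ \oo --> (0 : R).
  rewrite -[X in _ --> X](mulr0 K); apply: cvgMr.
  apply: (@cvg_comp _ _ _ (fun N : nat => N%:R : R) (fun x => expR (- ((s - 1) * ln x))) _ +oo).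
    exact: cvgr_idn.
  exact: exp_ln_cvgy.
have lim0 (G : R -> R) : (forall x, 0 < x -> `|G x| <= K * expR (- ((s - 1) * ln x))) ->
    (fun N : nat => G N%:R) @ \oo --> (0 : R).
  move=> GK; apply/norm_cvg0P; apply: (squeeze_cvgr _ (cvg_cst 0) KN); near=> N.
  by rewrite normr_ge0 GK// ltr0n; near: N; exact: nbhs_infty_gt.
have lc := lim0 (pow_cos_prim s) (fun x h => proj1 (norm_pow_prim_le s h)).
have ls := lim0 (pow_sin_prim s) (fun x h => proj2 (norm_pow_prim_le s h)).
have sumE (f : R -> R) (N : nat) : (0 < N)%N ->
    \sum_(2 <= k < N.+1) f k%:R = series (fun n => f n.+1%:R) N - f 1.
  case: N => // N _; rewrite /series /= [in RHS]big_nat_recl//= addrAC subrr add0r.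
  by rewrite (big_addn 0 N.+2 2) subn2; apply: eq_big_nat => k _; rewrite addn2.
have lim1 (f G : R -> R) (W I : R) : series (fun n => f n.+1%:R) @ \oo --> W ->
    (fun N : nat => G N%:R) @ \oo --> (0 : R) ->
    (fun N => \sum_(2 <= k < N.+1) f k%:R - G N%:R + G 1%:R) @ \oo --> I ->
    W - f 1 - 0 + G 1 = I.
  move=> fW G0 FI; apply: cvg_unique FI => //.
  have : (fun N => series (fun n => f n.+1%:R) N - f 1 - G N%:R + G 1) @ \oo --> W - f 1 - 0 + G 1.
    by apply: cvgD; [apply: cvgB => //; apply: cvgB => //; exact: cvg_cst|exact: cvg_cst].
  apply: cvg_trans; apply: near_eq_cvg; near=> N.
  by rewrite sumE//; near: N; exact: nbhs_infty_gt.
have -> : tail_cos s = U - 1 + (1 - s) / sqdist s.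
  have := lim1 _ _ _ _ cU lc Ec; rewrite c1 C1 subr0 => H; exact: esym H.
have -> : tail_sin s = V + - v / sqdist s.
  have := lim1 _ _ _ _ cV ls Es; rewrite z1 S1 !subr0 => H; exact: esym H.
by split; field; rewrite gt_eqF.
Unshelve. all: end_near. Qed.

End dirichlet.

Section complex_parts.
Variable R : realType.

Lemma normc_ge_Im (z : R[i]) : `|complex.Im z|%:C%C <= `|z|.
Proof.
case: z => a b; rewrite /= lecR -sqrtr_sqr ler_wsqrtr//= lerDr.
by rewrite sqr_ge0.
Qed.

Lemma cvg_ReIm (u : nat -> R[i]) (l : R[i]) :
  (u : nat -> R[i]^o) @ \oo --> (l : R[i]^o) ->
  (fun n => complex.Re (u n)) @ \oo --> complex.Re l /\
  (fun n => complex.Im (u n)) @ \oo --> complex.Im l.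
Proof.
move/cvgrPdist_lt => h; split; apply/cvgrPdist_lt => e e0.
  have := h e%:C%C; rewrite ltcR => /(_ e0); apply: filterS => n.
  rewrite -ltcR; apply: le_lt_trans; rewrite -raddfB; exact: normc_ge_Re.
have := h e%:C%C; rewrite ltcR => /(_ e0); apply: filterS => n.
rewrite -ltcR; apply: le_lt_trans; rewrite -raddfB; exact: normc_ge_Im.
Qed.

Lemma Re_series (u : nat -> R[i]) n :
  complex.Re (series (u : nat -> R[i]^o) n) = series (fun k => complex.Re (u k)) n.
Proof. by rewrite /series /= raddf_sum. Qed.

Lemma Im_series (u : nat -> R[i]) n :
  complex.Im (series (u : nat -> R[i]^o) n) = series (fun k => complex.Im (u k)) n.
Proof. by rewrite /series /= raddf_sum. Qed.

Lemma real_exp_complex (t : R) k : (t%:C%C : R[i]) ^+ k = (t ^+ k)%:C%C.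
Proof. by rewrite rmorphXn. Qed.

Variable zeta : R[i] -> R[i].
Hypothesis zetaP : is_riemann_zeta zeta.
Variable v : R.
Hypothesis v0 : v != 0.

(** The signs agree with x^(-s - iv) = [pow_cos s x] - i [pow_sin s x]. *)
Let zc (s : R) : R := complex.Re (zeta (s +i* v)%C).
Let zs (s : R) : R := - complex.Im (zeta (s +i* v)%C).

Let zeta_analytic s : real_analytic zc s /\ real_analytic zs s.
Proof.
have [an _] := zetaP.
have [|c [r [r0 h]]] := an (s +i* v)%C.
  by apply/eqP => -[_ E]; have := v0; rewrite E eqxx.
have H t : `|t| < r -> series (fun k => complex.Re (c k) * t ^+ k) @ \oo --> zc (s + t) /\
    series (fun k => complex.Im (c k) * t ^+ k) @ \oo --> complex.Im (zeta ((s + t) +i* v)%C).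
  move=> tr; have zE : ((s + t) +i* v)%C - (s +i* v)%C = t%:C%C.
    by apply/eqP; rewrite eq_complex /= addrAC !subrr add0r !eqxx.
  have := h ((s + t) +i* v)%C; rewrite zE.
  rewrite (_ : `|t%:C%C| = `|t|%:C%C); last first.
    by rewrite normc_def /= expr0n addr0 sqrtr_sqr.
  rewrite ltcR => /(_ tr) /cvg_ReIm [cR cI].
  have E1 : (fun n => complex.Re (series (fun k => c k * t%:C%C ^+ k : R[i]^o) n)) =
      series (fun k => complex.Re (c k) * t ^+ k).
    apply/funext => n; rewrite Re_series; congr (series _ n); apply/funext => k.
    by rewrite real_exp_complex; case: (c k) => a b /=; rewrite mulr0 subr0.
  have E2 : (fun n => complex.Im (series (fun k => c k * t%:C%C ^+ k : R[i]^o) n)) =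
      series (fun k => complex.Im (c k) * t ^+ k).
    apply/funext => n; rewrite Im_series; congr (series _ n); apply/funext => k.
    by rewrite real_exp_complex; case: (c k) => a b /=; rewrite mulr0 add0r.
  by rewrite -E1 -E2.
split; first by exists (fun k => complex.Re (c k)), r; split => // t /H[].
have : real_analytic (fun s => complex.Im (zeta (s +i* v)%C)) s.
  by exists (fun k => complex.Im (c k)), r; split => // t /H[].
by move=> /(real_analyticZ (-1)); rewrite /zs; under eq_fun do rewrite mulN1r.
Qed.

Let zeta_dirichlet s : 1 < s ->
  series (fun n => pow_cos v s n.+1%:R) @ \oo --> zc s /\
  series (fun n => pow_sin v s n.+1%:R) @ \oo --> zs s.
Proof.
move=> s1; have [_ /(_ (s +i* v)%C s1) /cvg_ReIm [cR cI]] := zetaP.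
have E n : complex.Re (cpow_nat n.+1 (- (s +i* v)%C)) = pow_cos v s n.+1%:R /\
    complex.Im (cpow_nat n.+1 (- (s +i* v)%C)) = - pow_sin v s n.+1%:R.
  rewrite /cpow_nat /cexp /pow_cos /pow_sin /= !mulr0 subr0 add0r !mulNr cosN sinN mulrN.
  by [].
split.
  have -> : series (fun n => pow_cos v s n.+1%:R) =
    (fun n => complex.Re (series (fun n => cpow_nat n.+1 (- (s +i* v)%C) : R[i]^o) n)).
    apply/funext => n; rewrite Re_series; congr (series _ n); apply/funext => k.
    by rewrite (proj1 (E k)).
  exact: cR.
have -> : series (fun n => pow_sin v s n.+1%:R) =
  (fun n => - complex.Im (series (fun n => cpow_nat n.+1 (- (s +i* v)%C) : R[i]^o) n)).
  apply/funext => n; rewrite Im_series (funext (fun k => proj2 (E k))).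
  by rewrite /series /= sumrN opprK.
exact: cvgN cI.
Qed.

(** Both relations hold for s > 1 by [dirichlet_tail], and they extend to s > 0 by the
    identity theorem; v != 0 keeps the line away from the pole at 1. *)
Lemma zeta_tail s : 0 < s ->
  sqdist v s * (zc s - 1 - tail_cos v s) + (1 - s) = 0 /\
  sqdist v s * (zs s - tail_sin v s) - v = 0.
Proof.
have poly f t : real_analytic f t -> real_analytic (fun s => sqdist v s * f s) t.
  move=> fa; rewrite (_ : (fun s => _) = (fun s => (1 - s) * ((1 - s) * f s) + v ^+ 2 * f s)).
    by apply: real_analyticD; [do 2 apply: real_analytic_mul1B|exact: real_analyticZ].
  by apply/funext => z; rewrite /sqdist; ring.
have lin t : real_analytic (fun s => 1 - s) t.
  rewrite (_ : (fun s => _) = (fun s => (1 - s) * 1)); last first.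
    by apply/funext => z; rewrite mulr1.
  by apply: real_analytic_mul1B; exact: real_analytic_cst.
move=> s0; split.
  apply: (@identity_theorem R (fun s => sqdist v s * (zc s - 1 - tail_cos v s) + (1 - s))) s0.
    move=> t t0; apply: real_analyticD => //; apply: poly.
    have [h _] := real_analytic_tail v t0; have [k _] := zeta_analytic t.
    have := real_analyticD (real_analyticD k (real_analytic_cst (-1) t)) (real_analyticZ (-1) h).
    by under eq_fun do rewrite mulN1r.
  by move=> t t1; have [h k] := zeta_dirichlet t1; have [] := dirichlet_tail v0 t1 h k.
apply: (@identity_theorem R (fun s => sqdist v s * (zs s - tail_sin v s) - v)) s0.
  move=> t t0; apply: real_analyticD; last exact: real_analytic_cst.
  have [_ h] := real_analytic_tail v t0; have [_ k] := zeta_analytic t.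
  by apply: poly; have := real_analyticD k (real_analyticZ (-1) h); under eq_fun do rewrite mulN1r.
by move=> t t1; have [h k] := zeta_dirichlet t1; have [] := dirichlet_tail v0 t1 h k.
Qed.

End complex_parts.

Section critical_line.
Variable R : realType.
Notation mu := (@lebesgue_measure R).

Lemma cvg_sqrt0 (K : R) (G : R -> R) :
  (forall x, 0 < x -> `|G x| <= K * Num.sqrt x) -> G x @[x --> 0^'+] --> (0 : R).
Proof.
move=> GK; have H : (fun x => K * Num.sqrt x) @ 0^'+ --> (0 : R).
  rewrite -[X in _ --> X](mulr0 K) -[in X in _ --> X](sqrtr0 R); apply: cvgMr.
  by apply: cvg_at_right_filter; exact: sqrt_continuous.
apply/norm_cvg0P; apply: (squeeze_cvgr _ (cvg_cst 0) H); near=> x.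
by rewrite normr_ge0 GK//; near: x; exact: nbhs_right_gt.
Unshelve. all: end_near. Qed.

Variable v : R.
Hypothesis v0 : v != 0.
Let s : R := 2^-1.

Let sqrtE (x : R) : 0 < x -> expR (- ((s - 1) * ln x)) = Num.sqrt x.
Proof. by move=> x0; rewrite sqrt_expR//; congr expR; rewrite /s; field. Qed.

Let prim0 : pow_cos_prim v s 0 = 0 /\ pow_sin_prim v s 0 = 0.
Proof. by rewrite /pow_cos_prim /pow_sin_prim !mul0r. Qed.

Let cprim0 : pow_cos_prim v s x @[x --> 0^'+] --> pow_cos_prim v s 0 /\
  pow_sin_prim v s x @[x --> 0^'+] --> pow_sin_prim v s 0.
Proof.
have [-> ->] := prim0; split; apply: (@cvg_sqrt0 ((`|1 - s| + `|v|) / sqdist v s)) => x x0.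
  by rewrite -sqrtE//; have [] := norm_pow_prim_le v0 s x0.
by rewrite -sqrtE//; have [] := norm_pow_prim_le v0 s x0.
Qed.

Let cfun0 : (x - 0) * pow_cos v s x @[x --> 0^'+] --> (0 : R) /\
  (x - 0) * pow_sin v s x @[x --> 0^'+] --> (0 : R).
Proof.
have E (x : R) : 0 < x -> x * expR (- (s * ln x)) = 1 * Num.sqrt x.
  move=> x0; rewrite mul1r sqrt_expR// -{1}[x]lnK// -expRD; congr expR.
  by rewrite /s; field.
split; apply: (@cvg_sqrt0 1) => x x0; rewrite subr0 normrM (gtr0_norm x0) -E// ler_pM2l//.
  by have [] := norm_pow_cos_sin_le v s x0.
by have [] := norm_pow_cos_sin_le v s x0.
Qed.

Let PsiE (x : R) : 0 < x ->
  fract x * pow_cos' v s x = - s * (Psi x * cos (v * ln x)) + - v * (Psi x * sin (v * ln x)) /\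
  fract x * pow_sin' v s x = v * (Psi x * cos (v * ln x)) + - s * (Psi x * sin (v * ln x)).
Proof.
move=> x0; have E : x^-1 * expR (- (s * ln x)) = expR (- (3 / 2 * ln x)).
  by rewrite -{1}[x]lnK// -expRN -expRD; congr expR; rewrite /s; field.
by rewrite /Psi -E /pow_cos' /pow_sin' /pow_cos /pow_sin; split; ring.
Qed.

(** The integral over 0 < x <= 1 is a single step of Euler summation from 0, whose
    value is the boundary term at 1 that separates zeta from its tail integral. *)
Lemma full_integrals :
  - s * Psi_cos v + - v * Psi_sin v = 1 - (1 - s) / sqdist v s + tail_cos v s /\
  v * Psi_cos v + - s * Psi_sin v = v / sqdist v s + tail_sin v s.
Proof.
have mi := measurable_pos R; have s0 : 0 < s by rewrite invr_gt0.
have ci := Psi_cos_int v; have si := Psi_sin_int v.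
have I (x : R) : `]0, +oo[%classic x <-> 0 < x by rewrite /= in_itv /= andbT.
have Ec (x : R) (xD : `]0, +oo[%classic x) := proj1 (PsiE (proj1 (I x) xD)).
have Es (x : R) (xD : `]0, +oo[%classic x) := proj2 (PsiE (proj1 (I x) xD)).
have i1 := integrableZR (- s) mi ci; have i2 := integrableZR (- v) mi si.
have i3 := integrableZR v mi ci; have i4 := integrableZR (- s) mi si.
have ic : mu.-integrable `]0, +oo[ (EFin \o (fun x => fract x * pow_cos' v s x)).
  by apply: (eq_integrableR mi _ (integrableDR mi i1 i2)) => x /Ec ->.
have jn : mu.-integrable `]0, +oo[ (EFin \o (fun x => fract x * pow_sin' v s x)).
  by apply: (eq_integrableR mi _ (integrableDR mi i3 i4)) => x /Es ->.
have -> : - s * Psi_cos v + - v * Psi_sin v = \int[mu]_(x in `]0, +oo[) (fract x * pow_cos' v s x).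
  rewrite (eq_RintegralR mu Ec) (RintegralD mi i1 i2).
  by rewrite (RintegralZl _ mi ci) (RintegralZl _ mi si).
have -> : v * Psi_cos v + - s * Psi_sin v = \int[mu]_(x in `]0, +oo[) (fract x * pow_sin' v s x).
  rewrite (eq_RintegralR mu Es) (RintegralD mi i3 i4).
  by rewrite (RintegralZl _ mi ci) (RintegralZl _ mi si).
have U : `]0, +oo[%classic = `]0, 1] `|` `]1, +oo[ :> set R.
  by rewrite -itv_bndbnd_setU//= ?bnd_simp// ler01.
have split1 (f : R -> R) : mu.-integrable `]0, +oo[ (EFin \o f) ->
    \int[mu]_(x in `]0, +oo[) f x = \int[mu]_(x in `]0, 1]) f x + \int[mu]_(x in `]1, +oo[) f x.
  move=> fi; rewrite U Rintegral_setU -?U//.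
  apply/disj_setPS => x []/=; rewrite !in_itv /= andbT => /andP[_ h1] h2.
  by have := le_lt_trans h1 h2; rewrite ltxx.
have [c1 z1 C1 S1] := pow_cos_sin1 v s; have [C0 S0] := prim0.
have [r1 r2] := cprim0; have [q1 q2] := cfun0.
have Fc := @euler_summation_finite R _ _ _ 0 (fun x => @der_pow_cos R v s x)
  (fun x => @der_pow_cos_prim R v v0 s x) (fun x => @cont_pow_cos' R v s x) (meas_pow_cos' v s) r1 q1 ic 1 isT.
have Fs := @euler_summation_finite R _ _ _ 0 (fun x => @der_pow_sin R v s x)
  (fun x => @der_pow_sin_prim R v v0 s x) (fun x => @cont_pow_sin' R v s x) (meas_pow_sin' v s) r2 q2 jn 1 isT.
rewrite big_nat1 in Fc; rewrite big_nat1 in Fs.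
rewrite !split1// /tail_cos /tail_sin Fc Fs c1 z1 C1 S1 C0 S0; split; ring.
Qed.

(** zeta(1/2 + iv) = - (1/2 + iv) (Psi_cos - i Psi_sin), by [zeta_tail] and [full_integrals]. *)
Lemma zeta_critical_line (zeta : R[i] -> R[i]) : is_riemann_zeta zeta ->
  ComplexField.Normc.normc (zeta (2^-1 +i* v)%C) ^+ 2 =
  (4^-1 + v ^+ 2) * (Psi_cos v ^+ 2 + Psi_sin v ^+ 2).
Proof.
move=> zetaP; have s0 : 0 < s by rewrite invr_gt0.
have [tc ts] := zeta_tail zetaP v0 s0; have [fc fs] := full_integrals.
have D0 := sqdist_gt0 v0 s.
move: tc ts; rewrite -/s; case: (zeta (s +i* v)%C) => a b /= tc ts.
have aE : a = - s * Psi_cos v + - v * Psi_sin v.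
  rewrite fc; apply: (mulfI (lt0r_neq0 D0)).
  by rewrite (_ : sqdist v s * a = - (1 - s) + sqdist v s * (1 + tail_cos v s));
    [field; rewrite gt_eqF|move: tc; lra].
have bE : - b = v * Psi_cos v + - s * Psi_sin v.
  rewrite fs; apply: (mulfI (lt0r_neq0 D0)).
  by rewrite (_ : sqdist v s * - b = v + sqdist v s * tail_sin v s);
    [field; rewrite gt_eqF|move: ts; lra].
rewrite sqr_sqrtr; last by rewrite addr_ge0 ?sqr_ge0.
by rewrite -[b ^+ 2]sqrrN aE bE /s; field.
Qed.

End critical_line.

(** * The integral *)

Section assembly.
Variables (R : realType) (zeta : R[i] -> R[i]).
Hypothesis zetaP : is_riemann_zeta zeta.
Notation mu := (@lebesgue_measure R).

Lemma zeta_integrandE (v : R) : 0 < v -> zeta_integrand zeta v =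
  (4^-1 + v ^+ 2) * (Psi_cos v ^+ 2 + Psi_sin v ^+ 2) * kerK (ln (2 * pi)) v.
Proof.
move=> v0; have vn : v != 0 by rewrite gt_eqF.
by rewrite /zeta_integrand (zeta_critical_line vn zetaP) /kerK -!mulrA; congr (_ * (_ * _)); rewrite mulrC.
Qed.

Lemma zeta_integral_oy :
  mu.-integrable `]0, +oo[ (EFin \o zeta_integrand zeta) /\
  exists2 S : R, (fun N => \sum_(1 <= k < N.+1) (expR (k%:R : R) - 1)^-1) @ \oo --> S &
    \int[mu]_(v in `]0, +oo[) zeta_integrand zeta v = Num.sqrt pi * (S - euler_gamma R).
Proof.
have mi := measurable_pos R; have [fi fE] := Psi_fubini (ln (2 * pi) : R).
have I (x : R) : `]0, +oo[%classic x -> 0 < x by rewrite /= in_itv /= andbT.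
have E (x : R) : `]0, +oo[%classic x -> (4^-1 + x ^+ 2) * (Psi_cos x ^+ 2 + Psi_sin x ^+ 2) *
    kerK (ln (2 * pi)) x = zeta_integrand zeta x by move=> /I /zeta_integrandE.
split; first exact: (eq_integrableR mi E fi).
have [S uS dS] := double_integral_value R; exists S => //.
by rewrite -(eq_RintegralR mu E) fE dS.
Qed.

(** The end point, which [zeta_critical_line] leaves out, is a null set. *)
Lemma integrable_closed_ray (f : R -> R) : mu.-integrable `]0, +oo[ (EFin \o f) ->
  mu.-integrable `[0, +oo[ (EFin \o f) /\
  (\int[mu]_(x in `[0%R, +oo[) (f x)%:E = (\int[mu]_(x in `]0, +oo[) f x)%:E)%E.
Proof.
move=> fi; have /integrableP[mf fy] := fi; split; last first.
  rewrite -integral_itv_obnd_cbnd// /Rintegral fineK//.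
  exact: (integrable_fin_num (measurable_pos R) fi).
apply/integrableP; split; first exact/emeasurable_fun_itv_obnd_cbndP.
by rewrite -integral_itv_obnd_cbnd//; exact: measurableT_comp.
Qed.

End assembly.
Local Open Scope ereal_scope.

Theorem mainTheorem6 (R : realType) (zeta : R[i] -> R[i])
    (zetaP : is_riemann_zeta zeta) :
  (@lebesgue_measure R).-integrable `[0%R, +oo[ (EFin \o zeta_integrand zeta) /\
  \int[@lebesgue_measure R]_(v in `[0%R, +oo[) (zeta_integrand zeta v)%:E =
    (Num.sqrt (pi : R))%:E *
      ((\sum_(1 <= j <oo) ((expR (j%:R : R) - 1)^-1)%:E) - (euler_gamma R)%:E).

Proof.
have [fi [S uS intE]] := zeta_integral_oy zetaP.
have [fi0 intE0] := integrable_closed_ray fi; split; first exact: fi0.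
rewrite intE0 intE; suff -> : \sum_(1 <= j <oo) ((expR (j%:R : R) - 1)^-1)%:E = S%:E.
  by rewrite -EFinB -EFinM.
apply: cvg_lim => //; rewrite -cvg_shiftS; under eq_fun do rewrite sumEFin.
by apply: cvg_EFin => //; exact: nearW.
Qed.
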